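(* Let $V$ be a braided vector space over a field $\kappa$. Suppose that there exists a nonnegative integer $d$ such that $H_0(B_n, V^{\otimes n}) = 0$ for every $n > d$. Then $H_i(B_n, V^{\otimes n}) = 0$ for all nonnegative integers $i, n$ with $n > (d+2)i + d$.
   Context: A braided vector space over a field $\kappa$ is a $\kappa$-vector space $V$ with an isomorphism $T \colon V \otimes V \to V \otimes V$ (the braiding) satisfying $(\mathrm{id}_V \otimes T)(T \otimes \mathrm{id}_V)(\mathrm{id}_V \otimes T) = (T \otimes \mathrm{id}_V)(\mathrm{id}_V \otimes T)(T \otimes \mathrm{id}_V)$ on $V \otimes V \otimes V$. The Artin braid group is $B_n = \langle \sigma_1, \dots, \sigma_{n-1} : \sigma_i\sigma_j = \sigma_j\sigma_i \text{ for } i > j+1,\ \sigma_i\sigma_{i+1}\sigma_i = \sigma_{i+1}\sigma_i\sigma_{i+1} \text{ for } i<n-1\rangle$ ($B_0 = B_1$ is trivial). It acts on $V^{\otimes n}$ by letting $\sigma_i$ act as $\mathrm{id}_{V^{\otimes (i-1)}} \otimes T \otimes \mathrm{id}_{V^{\otimes (n-i-1)}}$. $H_i(B_n, -)$ is group homology; $H_0$ denotes coinvariants. *)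

(* Defs.v *)
From HB Require Import structures.
From mathcomp Require Import all_boot all_order all_algebra.
From mathcomp Require Import zify.
From mathcomp Require Import finmap boolp.
From mathcomp.multinomials Require Import monalg.

Set Implicit Arguments.
Unset Strict Implicit.
Unset Printing Implicit Defensive.

Import GRing.Theory.

Local Open Scope ring_scope.

HB.lock Definition malg_ext (I : choiceType) (M A : zmodType)
    (f : I -> M -> A) (c : {malg M[I]}) : A :=
  \sum_(k <- msupp c) f k c@_k.

Section MalgExtension.
Variables (I : choiceType) (M A : zmodType).
Variable f : I -> M -> A.
Hypothesis f_additive : forall k, zmod_morphism (f k).

Let f0 k : f k 0 = 0.
Proof. by rewrite -(subrr 0) f_additive subrr. Qed.

Lemma malg_extEw (D : {fset I}) (c : {malg M[I]}) :
  (msupp c `<=` D)%fset -> malg_ext f c = \sum_(k <- D) f k c@_k.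
Proof.
move=> le; rewrite unlock (big_fset_incl _ le) => //= x xd /mcoeff_outdom ->.
by rewrite f0.
Qed.

Lemma malg_ext_is_zmod_morphism : zmod_morphism (malg_ext f).
Proof.
move=> x y; set D := (msupp x `|` msupp y)%fset.
rewrite (@malg_extEw D x) ?fsubsetUl // (@malg_extEw D y) ?fsubsetUr //.
rewrite (@malg_extEw D) ?msuppB_le // -sumrB.
by apply: eq_bigr => k _; rewrite mcoeffB f_additive.
Qed.

Lemma malg_extU k m : malg_ext f << m *g k >> = f k m.
Proof. by rewrite (malg_extEw msuppU_le) big_seq_fset1 mcoeffUU. Qed.

End MalgExtension.

Section TensorQuotient.
Variables (K : fieldType) (U W : lmodType K).

(* The submodule of the free module on U * W generated by the bilinearity
   relations. *)
Inductive tensor_relation : {malg K[(U * W)%type]} -> Prop :=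
| TensRel0 : tensor_relation 0
| TensRelP a x y :
    tensor_relation x -> tensor_relation y -> tensor_relation (a *: x + y)
| TensRelL a u u' w :
    tensor_relation (<< (a *: u + u', w) >> - (a *: << (u, w) >> + << (u', w) >>))
| TensRelR a u w w' :
    tensor_relation (<< (u, a *: w + w') >> - (a *: << (u, w) >> + << (u, w') >>)).

Definition tensor_rel (x : {malg K[(U * W)%type]}) : bool :=
  `[< tensor_relation x >].

Lemma tensor_rel_submod : subsemimod_closed tensor_rel.
Proof.
split; first split; first exact/asboolP/TensRel0.
  by move=> x y /asboolP ? /asboolP ?; apply/asboolP;
     rewrite -[x]scale1r; apply: TensRelP.
by move=> a x /asboolP ?; apply/asboolP;
   rewrite -[a *: x]addr0; apply: TensRelP => //; exact: TensRel0.
Qed.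

HB.instance Definition _ :=
  GRing.isSubmodClosed.Build K {malg K[(U * W)%type]} tensor_rel
    tensor_rel_submod.

Local Notation tquot := (Quotient.quot (GRing.ZmodClosed.clone _ tensor_rel _)).

Definition tensor_carrier : Type := tquot.

HB.instance Definition _ := GRing.Zmodule.on tensor_carrier.

Definition tensor_pi (x : {malg K[(U * W)%type]}) : tensor_carrier :=
  (\pi_tquot x)%qT.

Definition tensor_repr t : {malg K[(U * W)%type]} :=
  @repr _ tquot t.

Lemma tensor_reprK : cancel tensor_repr tensor_pi.
Proof. exact: reprK. Qed.

Lemma tensor_piB : {morph tensor_pi : x y / x - y}.
Proof. exact: (raddfB (\pi_tquot%qT)). Qed.

Lemma tensor_piD : {morph tensor_pi : x y / x + y}.
Proof. exact: (raddfD (\pi_tquot%qT)). Qed.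

Lemma tensor_piP x y :
  tensor_pi x = tensor_pi y <-> tensor_relation (x - y).
Proof.
have := @Quotient.idealrBE _ (GRing.ZmodClosed.clone _ tensor_rel _) x y => E; split=> [/eqP|] H.
  by apply/asboolP; move: H; rewrite -E.
by apply/eqP; rewrite -E; apply/asboolP.
Qed.

Definition tensor_scale (a : K) (t : tensor_carrier) : tensor_carrier :=
  tensor_pi (a *: tensor_repr t).

Lemma tensor_scale_pi a x : tensor_scale a (tensor_pi x) = tensor_pi (a *: x).
Proof.
apply/tensor_piP; rewrite -scalerBr -[_ *: _]addr0; apply: TensRelP.
  by apply/tensor_piP; rewrite tensor_reprK.
exact: TensRel0.
Qed.

Lemma tensor_scaleA a b t :
  tensor_scale a (tensor_scale b t) = tensor_scale (a * b) t.
Proof. by rewrite -[t]tensor_reprK !tensor_scale_pi scalerA. Qed.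

Lemma tensor_scale1 : left_id 1 tensor_scale.
Proof. by move=> t; rewrite -[t]tensor_reprK !tensor_scale_pi scale1r. Qed.

Lemma tensor_scaleDr : right_distributive tensor_scale +%R.
Proof.
move=> a s t; rewrite -[s]tensor_reprK -[t]tensor_reprK.
by rewrite -tensor_piD !tensor_scale_pi -tensor_piD scalerDr.
Qed.

Lemma tensor_scaleDl t : {morph tensor_scale^~ t : a b / a + b}.
Proof.
move=> a b; rewrite -[t]tensor_reprK.
by rewrite !tensor_scale_pi -tensor_piD scalerDl.
Qed.

HB.instance Definition _ := GRing.Zmodule_isLmodule.Build K tensor_carrier
  tensor_scaleA tensor_scale1 tensor_scaleDr tensor_scaleDl.

Definition tensor_quot : lmodType K := GRing.Lmodule.clone K tensor_carrier _.

Lemma tensor_pi_is_linear : linear (tensor_pi : _ -> tensor_quot).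
Proof. by move=> a x y; rewrite tensor_piD -tensor_scale_pi. Qed.

HB.instance Definition _ :=
  GRing.isLinear.Build K {malg K[(U * W)%type]} tensor_quot _ tensor_pi
    tensor_pi_is_linear.

Definition quot_pure (u : U) (w : W) : tensor_quot := tensor_pi << (u, w) >>.

Lemma quot_pure_is_bilinear :
  (forall w, linear (quot_pure^~ w)) * (forall u, linear (quot_pure u)).
Proof.
split=> [w a u u'|u a w w'] /=; rewrite -linearP; apply/tensor_piP.
  exact: TensRelL.
exact: TensRelR.
Qed.

HB.instance Definition _ :=
  bilinear_isBilinear.Build K U W tensor_quot *:%R *:%R quot_pure
    quot_pure_is_bilinear.

Lemma quot_ind (P : tensor_quot -> Prop) :
  P 0 -> (forall a s t, P s -> P t -> P (a *: s + t)) ->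
  (forall u w, P (quot_pure u w)) -> forall t, P t.
Proof.
move=> P0 PP Pp t; rewrite -[t]tensor_reprK [tensor_repr t]monalgE raddf_sum /=.
elim/big_ind: _ => [//|x y Px Py|[u w] _]; first by rewrite -[x]scale1r; apply: PP.
set c := _@_ _; have -> : << c *g (u, w) >> = c *: << (u, w) >> :> {malg K[(U * W)%type]}.
  by apply/malgP=> k; rewrite mcoeffZ !mcoeffU mulrnAr mulr1.
by rewrite linearZ -[X in P X]addr0; apply: PP => //; apply: Pp.
Qed.

End TensorQuotient.

Definition quot_lift (K : fieldType) (U W A : lmodType K)
    (f : U -> W -> A) (t : tensor_quot U W) : A :=
  malg_ext (fun (p : U * W) c => c *: f p.1 p.2) (tensor_repr t).

Section TensorLift.
Variables (K : fieldType) (U W A : lmodType K).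
Variable f : {bilinear U -> W -> A}.

Let ext : {malg K[(U * W)%type]} -> A :=
  malg_ext (fun (p : U * W) c => c *: f p.1 p.2).

Let extB : zmod_morphism ext.
Proof. by apply: malg_ext_is_zmod_morphism => p c c'; rewrite scalerBl. Qed.

Let ext0 : ext 0 = 0.
Proof. by rewrite -(subrr 0) extB subrr. Qed.

Let extD : {morph ext : x y / x + y}.
Proof. by move=> x y; rewrite -{1}[y]opprK -[- y]add0r !extB ext0 sub0r opprK. Qed.

Let extU c u w : ext << c *g (u, w) >> = c *: f u w.
Proof.
by rewrite /ext malg_extU // => p a b; rewrite scalerBl.
Qed.

Let extZ a x : ext (a *: x) = a *: ext x.
Proof.
have DE : (msupp (a *: x) `<=` msupp x)%fset by exact: msuppZ_le.
rewrite /ext (malg_extEw _ DE) => [|p c c']; last by rewrite scalerBl.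
rewrite malg_ext.unlock scaler_sumr; apply: eq_bigr => p _.
by rewrite mcoeffZ scalerA.
Qed.

Let ext_rel x : tensor_relation x -> ext x = 0.
Proof.
elim=> [|a {}x y _ Ex _ Ey|a u u' w|a u w w']; first exact: ext0.
- by rewrite extD extZ Ex Ey scaler0 addr0.
- by rewrite extB extD extZ !extU !scale1r linearPl subrr.
- by rewrite extB extD extZ !extU !scale1r linearPr subrr.
Qed.

Let lift_pi x : quot_lift f (tensor_pi x) = ext x.
Proof.
apply/subr0_eq; rewrite -[quot_lift _ _]/(ext _) -extB; apply: ext_rel.
by apply/tensor_piP; rewrite tensor_reprK.
Qed.

Lemma quot_liftE u w : quot_lift f (quot_pure u w) = f u w.
Proof. by rewrite lift_pi extU scale1r. Qed.

Lemma quot_lift_is_linear : linear (quot_lift f).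
Proof.
move=> a s t; rewrite -[s]tensor_reprK -[t]tensor_reprK -linearP !lift_pi.
by rewrite extD extZ.
Qed.

HB.instance Definition _ :=
  GRing.isLinear.Build K (tensor_quot U W) A _ (quot_lift f) quot_lift_is_linear.

End TensorLift.

(* tp_span expresses that the pure tensors span, i.e. that tp_lift is unique. *)
Record tensor_product (K : fieldType) (U W : lmodType K) := TensorProduct {
  tp_space : lmodType K;
  tp_pure : {bilinear U -> W -> tp_space};
  tp_lift : forall A : lmodType K,
    {bilinear U -> W -> A} -> {linear tp_space -> A};
  tp_liftE : forall (A : lmodType K) (f : {bilinear U -> W -> A}) u w,
    tp_lift f (tp_pure u w) = f u w;
  tp_span : forall P : tp_space -> Prop,
    P 0 -> (forall a s t, P s -> P t -> P (a *: s + t)) ->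
    (forall u w, P (tp_pure u w)) -> forall t, P t
}.

(* Locked, since unfolding the quotient makes unification diverge. *)
HB.lock Definition the_tensor_product (K : fieldType) (U W : lmodType K) :
    tensor_product U W :=
  @TensorProduct K U W (tensor_quot U W) (@quot_pure K U W)
    (fun A f => quot_lift f) (fun A f u w => quot_liftE f u w)
    (@quot_ind K U W).

Definition tensor (K : fieldType) (U W : lmodType K) : lmodType K :=
  tp_space (the_tensor_product U W).

Definition pure_tensor (K : fieldType) (U W : lmodType K) :
    {bilinear U -> W -> tensor U W} :=
  tp_pure (the_tensor_product U W).

Notation "u ⊗ w" := (pure_tensor _ _ u w) (at level 40, left associativity)
  : ring_scope.

Section TensorTheory.
Variables (K : fieldType) (U W : lmodType K).

Definition tensor_lift (A : lmodType K) (f : {bilinear U -> W -> A}) :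
    {linear tensor U W -> A} :=
  tp_lift (the_tensor_product U W) f.

Lemma tensor_liftE (A : lmodType K) (f : {bilinear U -> W -> A}) u w :
  tensor_lift f (u ⊗ w) = f u w.
Proof. exact: tp_liftE. Qed.

Lemma tensor_ind (P : tensor U W -> Prop) :
  P 0 -> (forall a s t, P s -> P t -> P (a *: s + t)) ->
  (forall u w, P (u ⊗ w)) -> forall t, P t.
Proof. exact: tp_span. Qed.

Lemma tensor_eq (A : lmodType K) (f g : {linear tensor U W -> A}) :
  (forall u w, f (u ⊗ w) = g (u ⊗ w)) -> f =1 g.
Proof.
move=> fg; apply: tensor_ind => [|a s t Es Et|//]; first by rewrite !linear0.
by rewrite !linearP Es Et.
Qed.

End TensorTheory.

Section TensorMap.
Variables (K : fieldType) (U U' W W' : lmodType K).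
Variables (f : {linear U -> U'}) (g : {linear W -> W'}).

Definition tensor_map_pure (u : U) (w : W) : tensor U' W' := f u ⊗ g w.

Lemma tensor_map_pure_is_bilinear :
  (forall w, linear (tensor_map_pure^~ w)) * (forall u, linear (tensor_map_pure u)).
Proof.
split=> [w a u u'|u a w w'] /=; rewrite /tensor_map_pure linearP.
  exact: linearPl.
exact: linearPr.
Qed.

HB.instance Definition _ :=
  bilinear_isBilinear.Build K U W (tensor U' W') *:%R *:%R tensor_map_pure
    tensor_map_pure_is_bilinear.

End TensorMap.

Definition tensor_map (K : fieldType) (U U' W W' : lmodType K)
    (f : {linear U -> U'}) (g : {linear W -> W'}) :
    {linear tensor U W -> tensor U' W'} :=
  tensor_lift (tensor_map_pure f g).

Lemma tensor_mapE (K : fieldType) (U U' W W' : lmodType K)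
    (f : {linear U -> U'}) (g : {linear W -> W'}) u w :
  tensor_map f g (u ⊗ w) = f u ⊗ g w.
Proof. exact: (tensor_liftE (tensor_map_pure f g)). Qed.

Section TensorPartial.
Variables (K : fieldType) (U W : lmodType K).

Definition pure_tensorl (u : U) : W -> tensor U W := fun w => u ⊗ w.
Definition pure_tensorr (w : W) : U -> tensor U W := fun u => u ⊗ w.

Lemma pure_tensorl_is_linear u : linear (pure_tensorl u).
Proof. by move=> a w w'; exact: linearPr. Qed.

Lemma pure_tensorr_is_linear w : linear (pure_tensorr w).
Proof. by move=> a u u'; exact: linearPl. Qed.

HB.instance Definition _ u :=
  GRing.isLinear.Build K W (tensor U W) _ (pure_tensorl u)
    (pure_tensorl_is_linear u).
HB.instance Definition _ w :=
  GRing.isLinear.Build K U (tensor U W) _ (pure_tensorr w)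
    (pure_tensorr_is_linear w).

End TensorPartial.

Fact scale_exchange (K : fieldType) (A : lmodType K) (a b : K) (x y x' y' : A) :
  b *: (a *: x + y) + (a *: x' + y') = a *: (b *: x + x') + (b *: y + y').
Proof. by rewrite !scalerDr !scalerA [b * a]mulrC addrACA. Qed.

Section TensorAssoc.
Variables (K : fieldType) (U W X : lmodType K).

Definition assocl_pure (u : U) (t : tensor W X) : tensor (tensor U W) X :=
  tensor_map (pure_tensorl u) idfun t.

Lemma assocl_pureE u w x : assocl_pure u (w ⊗ x) = (u ⊗ w) ⊗ x.
Proof. exact: tensor_mapE. Qed.

Lemma assocl_pure_is_bilinear :
  (forall w, linear (assocl_pure^~ w)) * (forall u, linear (assocl_pure u)).
Proof.
split=> [t a u u'|u]; last exact: linearP.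
elim/tensor_ind: t => [|b s t Es Et|w x].
- have Z v : assocl_pure v 0 = 0 by exact: linear0.
  by rewrite !Z scaler0 addr0.
- have P v : assocl_pure v (b *: s + t) = b *: assocl_pure v s + assocl_pure v t.
    exact: linearP.
  rewrite (P (a *: u + u')) (P u) (P u') Es Et.
  exact: scale_exchange.
- by rewrite !assocl_pureE !linearPl.
Qed.

HB.instance Definition _ :=
  bilinear_isBilinear.Build K U (tensor W X) (tensor (tensor U W) X)
    *:%R *:%R assocl_pure assocl_pure_is_bilinear.

Definition assocr_pure (t : tensor U W) (x : X) : tensor U (tensor W X) :=
  tensor_map idfun (pure_tensorr x) t.

Lemma assocr_pureE u w x : assocr_pure (u ⊗ w) x = u ⊗ (w ⊗ x).
Proof. exact: tensor_mapE. Qed.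

Lemma assocr_pure_is_bilinear :
  (forall w, linear (assocr_pure^~ w)) * (forall u, linear (assocr_pure u)).
Proof.
split=> [x|t a x x']; first exact: linearP.
elim/tensor_ind: t => [|b s t Es Et|u w].
- have Z y : assocr_pure 0 y = 0 by exact: linear0.
  by rewrite !Z scaler0 addr0.
- have P y : assocr_pure (b *: s + t) y = b *: assocr_pure s y + assocr_pure t y.
    exact: linearP.
  rewrite (P (a *: x + x')) (P x) (P x') Es Et.
  exact: scale_exchange.
- by rewrite !assocr_pureE !linearPr.
Qed.

HB.instance Definition _ :=
  bilinear_isBilinear.Build K (tensor U W) X (tensor U (tensor W X))
    *:%R *:%R assocr_pure assocr_pure_is_bilinear.

End TensorAssoc.

Definition assocl (K : fieldType) (U W X : lmodType K) :
    {linear tensor U (tensor W X) -> tensor (tensor U W) X} :=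
  tensor_lift (@assocl_pure K U W X).

Definition assocr (K : fieldType) (U W X : lmodType K) :
    {linear tensor (tensor U W) X -> tensor U (tensor W X)} :=
  tensor_lift (@assocr_pure K U W X).

Lemma assoclE (K : fieldType) (U W X : lmodType K) (u : U) (w : W) (x : X) :
  assocl U W X (u ⊗ (w ⊗ x)) = (u ⊗ w) ⊗ x.
Proof.
apply: etrans (assocl_pureE u w x).
exact: (tensor_liftE (@assocl_pure K U W X)).
Qed.

Lemma assocrE (K : fieldType) (U W X : lmodType K) (u : U) (w : W) (x : X) :
  assocr U W X ((u ⊗ w) ⊗ x) = u ⊗ (w ⊗ x).
Proof.
apply: etrans (assocr_pureE u w x).
exact: (tensor_liftE (@assocr_pure K U W X)).
Qed.

Arguments tensor : simpl never.
Arguments tensor_map : simpl never.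
Arguments assocl : simpl never.
Arguments assocr : simpl never.

Definition tensor_idl (K : fieldType) (V X Y : lmodType K)
    (g : {linear X -> Y}) : {linear tensor V X -> tensor V Y} :=
  tensor_map (idfun : {linear V -> V}) g.

Definition tensor_idr (K : fieldType) (X V Y : lmodType K)
    (f : {linear V -> Y}) : {linear tensor V X -> tensor Y X} :=
  tensor_map f (idfun : {linear X -> X}).

Lemma tensor_idlE (K : fieldType) (V X Y : lmodType K)
    (g : {linear X -> Y}) v x :
  tensor_idl V g (v ⊗ x) = v ⊗ g x.
Proof. by rewrite /tensor_idl tensor_mapE. Qed.

Lemma tensor_idrE (K : fieldType) (X V Y : lmodType K)
    (f : {linear V -> Y}) v x :
  tensor_idr X f (v ⊗ x) = f v ⊗ x.
Proof. by rewrite /tensor_idr tensor_mapE. Qed.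

(* T ⊗ id_X, read on V ⊗ (V ⊗ X). *)
Definition braid_left (K : fieldType) (V : lmodType K)
    (T : {linear tensor V V -> tensor V V}) (X : lmodType K) :
    {linear tensor V (tensor V X) -> tensor V (tensor V X)} :=
  assocr V V X \o tensor_idr X T \o assocl V V X.

(* The isomorphism T is given together with its (unique) inverse, and the triple
   tensor power is V ⊗ (V ⊗ V). *)
Record braidedVectorSpace (K : fieldType) := BraidedVectorSpace {
  bvs_sort :> lmodType K;
  braiding : {linear tensor bvs_sort bvs_sort -> tensor bvs_sort bvs_sort};
  braiding_inv : {linear tensor bvs_sort bvs_sort -> tensor bvs_sort bvs_sort};
  braidingK : cancel braiding braiding_inv;
  braiding_invK : cancel braiding_inv braiding;
  braid_equation :
    tensor_idl bvs_sort braiding \o braid_left braiding bvs_sort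
      \o tensor_idl bvs_sort braiding
    =1 braid_left braiding bvs_sort \o tensor_idl bvs_sort braiding
      \o braid_left braiding bvs_sort
}.

Fixpoint tensor_power (K : fieldType) (V : lmodType K) (n : nat) : lmodType K :=
  if n is m.+1 then tensor V (tensor_power V m) else K^o.

(* id^{⊗ i} ⊗ T ⊗ id^{⊗ (n - i - 2)} on V^{⊗ n}; only used for i.+1 < n. *)
Fixpoint braid_at (K : fieldType) (V : lmodType K)
    (T : {linear tensor V V -> tensor V V}) (n i : nat) :
    {linear tensor_power V n -> tensor_power V n} :=
  match n with
  | 0 => idfun
  | m.+1 =>
    match i with
    | 0 =>
      match m return {linear tensor_power V m.+1 -> tensor_power V m.+1} with
      | 0 => idfun
      | p.+1 => braid_left T (tensor_power V p)
      end
    | j.+1 => tensor_idl V (braid_at T m j)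
    end
  end.

Section Presentation.
Variables (X : choiceType).

(* The letter (x, true) stands for x and (x, false) for its inverse. *)
Definition word := seq (X * bool).

Definition gen_word (s : seq X) : word := [seq (x, true) | x <- s].

Definition inv_word (w : word) : word := rev [seq (p.1, ~~ p.2) | p <- w].

Variable R : seq X -> seq X -> Prop.

Inductive word_equiv : word -> word -> Prop :=
| WordRefl w : word_equiv w w
| WordSym w w' : word_equiv w w' -> word_equiv w' w
| WordTrans w w' w'' :
    word_equiv w w' -> word_equiv w' w'' -> word_equiv w w''
| WordCat u u' v v' :
    word_equiv u u' -> word_equiv v v' -> word_equiv (u ++ v) (u' ++ v')
| WordCancel x b : word_equiv [:: (x, b); (x, ~~ b)] [::]
| WordRel s t : R s t -> word_equiv (gen_word s) (gen_word t).

Definition word_eq : rel word := fun w w' => `[< word_equiv w w' >].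

Lemma word_eq_equiv : equiv_class_of word_eq.
Proof.
split=> [w|w w'|w' w w'']; first exact/asboolP/WordRefl.
  by apply/asboolP/asboolP=> /WordSym.
by move=> /asboolP ww' /asboolP w'w''; apply/asboolP/(WordTrans ww').
Qed.

Canonical word_eq_equiv_rel := EquivRelPack word_eq_equiv.
Canonical word_eq_encModRel := defaultEncModRel word_eq.

Definition presented : Type := {eq_quot word_eq}%qT.

HB.instance Definition _ := Choice.on presented.

Definition presented_pi (w : word) : presented := (\pi_{eq_quot word_eq} w)%qT.
Definition presented_repr (g : presented) : word := @repr _ {eq_quot word_eq}%qT g.

Lemma presented_reprK : cancel presented_repr presented_pi.
Proof. exact: reprK. Qed.

Lemma presented_piP w w' :
  presented_pi w = presented_pi w' <-> word_equiv w w'.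
Proof.
split=> [|H]; last by apply/eqmodP/asboolP.
by move/eqmodP/asboolP.
Qed.

Lemma presented_repr_pi w : word_equiv (presented_repr (presented_pi w)) w.
Proof. by apply/presented_piP; rewrite presented_reprK. Qed.

Definition presented_one : presented := presented_pi [::].
Definition presented_mul (g h : presented) : presented :=
  presented_pi (presented_repr g ++ presented_repr h).
Definition presented_inv (g : presented) : presented :=
  presented_pi (inv_word (presented_repr g)).

Lemma presented_mul_pi w w' :
  presented_mul (presented_pi w) (presented_pi w') = presented_pi (w ++ w').
Proof. by apply/presented_piP/WordCat; apply: presented_repr_pi. Qed.

Lemma inv_wordV w : word_equiv (inv_word w ++ w) [::].
Proof.
elim: w => [|[x b] w IH]; first exact: WordRefl.
rewrite /inv_word /= rev_cons cat_rcons.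
have -> l : l ++ [:: (x, ~~ b), (x, b) & w] = l ++ [:: (x, ~~ b); (x, b)] ++ w
  by [].
apply: WordTrans IH; apply: WordCat; first exact: WordRefl.
rewrite -[X in word_equiv _ X]cat0s; apply: WordCat; last exact: WordRefl.
by rewrite -{2}[b]negbK; apply: WordCancel.
Qed.

Lemma inv_wordK : involutive inv_word.
Proof.
move=> w; rewrite /inv_word map_rev revK -map_comp -[RHS]map_id.
by apply: eq_map => -[x b] /=; rewrite negbK.
Qed.

Lemma inv_word_equiv w w' :
  word_equiv w w' -> word_equiv (inv_word w) (inv_word w').
Proof.
move=> ww'; have V := inv_wordV.
have V' u : word_equiv (u ++ inv_word u) [::] by rewrite -{1}[u]inv_wordK.
rewrite -[inv_word w]cats0 -[inv_word w']cat0s.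
apply: (@WordTrans _ (inv_word w ++ (w' ++ inv_word w'))).
  by apply: WordCat; [exact: WordRefl | exact: WordSym].
rewrite catA; apply: WordCat; last exact: WordRefl.
apply: WordTrans (V w); apply: WordCat; first exact: WordRefl.
exact: WordSym.
Qed.

Lemma presented_inv_pi w :
  presented_inv (presented_pi w) = presented_pi (inv_word w).
Proof. by apply/presented_piP/inv_word_equiv; apply: presented_repr_pi. Qed.

Lemma presented_mulA : associative presented_mul.
Proof.
move=> g h k; rewrite -[g]presented_reprK -[h]presented_reprK.
by rewrite -[k]presented_reprK !presented_mul_pi catA.
Qed.

Lemma presented_mul1g : left_id presented_one presented_mul.
Proof. by move=> g; rewrite -[g]presented_reprK presented_mul_pi. Qed.

Lemma presented_mulg1 : right_id presented_one presented_mul.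
Proof. by move=> g; rewrite -[g]presented_reprK presented_mul_pi cats0. Qed.

Lemma presented_mulVg : left_inverse presented_one presented_inv presented_mul.
Proof.
move=> g; rewrite -[g]presented_reprK presented_inv_pi presented_mul_pi.
exact/presented_piP/inv_wordV.
Qed.

Lemma presented_mulgV : right_inverse presented_one presented_inv presented_mul.
Proof.
move=> g; rewrite -[g]presented_reprK presented_inv_pi presented_mul_pi.
by apply/presented_piP; rewrite -{1}[presented_repr g]inv_wordK; apply: inv_wordV.
Qed.

HB.instance Definition _ := isGroup.Build presented
  presented_mulA presented_mul1g presented_mulg1
  presented_mulVg presented_mulgV.

Definition presented_gen (x : X) : presented := presented_pi [:: (x, true)].

End Presentation.

(* The generator of index i : 'I_n.-1 is sigma_{i+1}. *)
Inductive braid_relation (n : nat) : seq 'I_n.-1 -> seq 'I_n.-1 -> Prop :=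
| BraidComm (i j : 'I_n.-1) :
    (j.+1 < i)%N -> braid_relation [:: i; j] [:: j; i]
| BraidBraid (i j : 'I_n.-1) :
    j = i.+1 :> nat -> braid_relation [:: i; j; i] [:: j; i; j].

Definition braid_group (n : nat) : groupType := presented (@braid_relation n).

Definition sigma (n : nat) (i : 'I_n.-1) : braid_group n :=
  presented_gen _ i.

(* Left Z[G]-modules: group homology only depends on the underlying abelian
   group of a K-linear representation. *)
Record gmodule (G : groupType) := GModule {
  gmod_sort :> zmodType;
  gact : G -> {additive gmod_sort -> gmod_sort};
  gact1 : forall m, gact 1%g m = m;
  gactM : forall g h m, gact (g * h)%g m = gact g (gact h m)
}.

Section Homology.
Variables (G : groupType) (M : gmodule G).

(* The bar complex: C_i = Z[G^i] ⊗ M, viewed as the finitely supported functions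
   G^i -> M, with boundary
     d([g_1|...|g_i] ⊗ m) = [g_2|...|g_i] ⊗ m
       + sum_(0 < j < i) (-1)^j [g_1|...|g_j g_(j+1)|...|g_i] ⊗ m
       + (-1)^i [g_1|...|g_(i-1)] ⊗ g_i m. *)
Definition bar_chain (i : nat) : zmodType := {malg M[{ffun 'I_i -> G}]}.

Definition bar_face (i : nat) (j : 'I_i.+2) (t : {ffun 'I_i.+1 -> G}) :
    {ffun 'I_i -> G} :=
  [ffun k : 'I_i =>
    let g := t (widen_ord (leqnSn i) k) in
    let g' := t (lift ord0 k) in
    if (k.+1 < j)%N then g else if k.+1 == j then (g * g')%g else g'].

Definition bar_coef (i : nat) (j : 'I_i.+2) (t : {ffun 'I_i.+1 -> G}) (m : M) :
    M :=
  if j == ord_max then gact M (t ord_max) m else m.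

Lemma bar_coefB i (j : 'I_i.+2) t : zmod_morphism (@bar_coef i j t).
Proof.
move=> m m'; rewrite /bar_coef; case: (j == ord_max); last by [].
exact: raddfB.
Qed.

Definition bar_boundary (i : nat) : bar_chain i.+1 -> bar_chain i :=
  malg_ext (fun (t : {ffun 'I_i.+1 -> G}) (m : M) =>
    \sum_(j < i.+2) << bar_coef j t m *g bar_face j t >> *~ (-1) ^+ j).

Lemma bar_boundary_is_zmod_morphism i : zmod_morphism (@bar_boundary i).
Proof.
apply: malg_ext_is_zmod_morphism => t m m'; rewrite -sumrB.
apply: eq_bigr => j _; rewrite -mulrzBl -monalgUB bar_coefB.
reflexivity.
Qed.

HB.instance Definition _ i :=
  GRing.isZmodMorphism.Build (bar_chain i.+1) (bar_chain i) (@bar_boundary i)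
    (@bar_boundary_is_zmod_morphism i).

Definition is_bar_cycle (i : nat) : bar_chain i -> bool :=
  if i is j.+1 then fun c => bar_boundary c == 0 else fun=> true.

Lemma is_bar_cycle_zmod i : zmod_closed (@is_bar_cycle i).
Proof.
case: i => [|i]; split=> //; first by rewrite unfold_in /= raddf0.
by move=> x y; rewrite !unfold_in /= => /eqP Ex /eqP Ey;
  rewrite bar_boundary_is_zmod_morphism Ex Ey subr0.
Qed.

HB.instance Definition _ i :=
  GRing.isZmodClosed.Build (bar_chain i) (@is_bar_cycle i)
    (@is_bar_cycle_zmod i).

Definition bar_cycle (i : nat) : Type := {c : bar_chain i | is_bar_cycle c}.

HB.instance Definition _ i := SubType.on (bar_cycle i).
HB.instance Definition _ i := Choice.on (bar_cycle i).
HB.instance Definition _ i := [SubChoice_isSubZmodule of bar_cycle i by <:].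

Definition is_bar_boundary (i : nat) (z : bar_cycle i) : bool :=
  `[< exists b : bar_chain i.+1, bar_boundary b = val z >].

Lemma is_bar_boundary_zmod i : zmod_closed (@is_bar_boundary i).
Proof.
split=> [|x y]; first by apply/asboolP; exists 0; rewrite !raddf0.
move=> /asboolP[b Eb] /asboolP[c Ec]; apply/asboolP; exists (b - c).
by rewrite !raddfB /= Eb Ec.
Qed.

HB.instance Definition _ i :=
  GRing.isZmodClosed.Build (bar_cycle i) (@is_bar_boundary i)
    (@is_bar_boundary_zmod i).

Definition group_homology (i : nat) : zmodType :=
  Quotient.quot (GRing.ZmodClosed.clone _ (@is_bar_boundary i) _).

End Homology.

Section BarComplex.
Variables (G : groupType) (M : gmodule G).

Let face (j : nat) (a : nat -> G) (n : nat) : G :=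
  if (n.+1 < j)%N then a n else if n.+1 == j then (a n * a n.+1)%g else a n.+1.

Let coef (N j : nat) (a : nat -> G) (m : M) : M :=
  if j == N.+1 then gact M (a N) m else m.

Let bar_faceE i (j : 'I_i.+2) (t : {ffun 'I_i.+1 -> G}) (a : nat -> G) :
  (forall x : 'I_i.+1, t x = a x) -> forall x : 'I_i, bar_face j t x = face j a x.
Proof. by move=> ta x; rewrite ffunE !ta /= /bump /= add1n. Qed.

Let bar_coefE i (j : 'I_i.+2) (t : {ffun 'I_i.+1 -> G}) (a : nat -> G) m :
  (forall x : 'I_i.+1, t x = a x) -> bar_coef j t m = coef i j a m.
Proof. by move=> ta; rewrite /bar_coef ta. Qed.

Let face_face a j k n : (k <= j)%N ->
  face k (face j.+1 a) n = face j (face k a) n.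
Proof.
move=> kj; rewrite /face.
do ![case: ifP => ?]; try lia; by rewrite ?mulgA.
Qed.

Let coef_face a i j k m : (k <= j)%N -> (j < i.+2)%N ->
  coef i k (face j.+1 a) (coef i.+1 j.+1 a m) =
  coef i j (face k a) (coef i.+1 k a m).
Proof.
move=> kj ji; rewrite /coef /face.
do ![case: ifP => ?]; try lia; rewrite -?gactM //.
Qed.

Let alternating_cancel (A : zmodType) n (F : nat -> nat -> A) :
  (forall j k, (k <= j)%N -> (j < n)%N -> F j.+1 k = F k j) ->
  \sum_(j < n.+1) \sum_(k < n) F j k *~ (-1) ^+ (j + k) = 0.
Proof.
move=> HF.
transitivity (\sum_(j < n.+1) (\sum_(k < n | (k < j)%N) F j k *~ (-1) ^+ (j + k)
              + \sum_(k < n | ~~ (k < j)%N) F j k *~ (-1) ^+ (j + k))).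
  by apply: eq_bigr => j _; rewrite (bigID (fun k : 'I_n => (k < j)%N)).
rewrite big_split /= big_ord_recl big_pred0 // add0r.
rewrite [X in _ + X]big_ord_recr /= [X in _ + (_ + X)]big_pred0 ?addr0; last first.
  by move=> k; rewrite ltn_ord.
rewrite [X in _ + X](exchange_big_dep xpredT) //= -big_split /=.
apply: big1 => j _.
rewrite (eq_bigl (fun k : 'I_n => ~~ (j < k)%N)); last first.
  by move=> k; rewrite /bump /= add1n ltnS leqNgt.
rewrite -big_split /=; apply: big1 => k; rewrite -leqNgt => kj.
by rewrite /bump /= add1n HF // addSn exprS mulN1r mulrNz addnC addNr.
Qed.

Lemma bar_boundaryU i (t : {ffun 'I_i.+1 -> G}) (m : M) :
  bar_boundary (<< m *g t >> : bar_chain M i.+1) =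
  \sum_(j < i.+2) << bar_coef j t m *g bar_face j t >> *~ (-1) ^+ j.
Proof.
rewrite /bar_boundary malg_extU // => {t m} t m m'.
rewrite -sumrB; apply: eq_bigr => j _.
by rewrite -mulrzBl -monalgUB bar_coefB.
Qed.

Lemma bar_boundary_boundary i (c : bar_chain M i.+2) :
  bar_boundary (bar_boundary c) = 0.
Proof.
rewrite [c]monalgE !raddf_sum /=; apply: big1_seq => t _.
set m := c@_t; rewrite bar_boundaryU raddf_sum /=.
pose a n := t (inord n); have ta (x : 'I_i.+2) : t x = a x by rewrite /a inord_val.
pose F j k : bar_chain M i :=
  << coef i k (face j a) (coef i.+1 j a m)
     *g [ffun x : 'I_i => face k (face j a) x] >>.
transitivity (\sum_(j < i.+3) \sum_(k < i.+2) F j k *~ (-1) ^+ (j + k)).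
  apply: eq_bigr => j _; rewrite raddfMz [X in X *~ _]bar_boundaryU mulrz_suml.
  apply: eq_bigr => k _; rewrite -mulrzA -exprD addnC.
  have fa := bar_faceE j ta.
  have -> : bar_coef k (bar_face j t) (bar_coef j t m) =
            coef i k (face j a) (coef i.+1 j a m).
    by rewrite (bar_coefE j m ta) (bar_coefE k _ fa).
  have -> : bar_face k (bar_face j t) = [ffun x : 'I_i => face k (face j a) x].
    by apply/ffunP => x; rewrite (bar_faceE k fa) ffunE.
  by [].
apply: alternating_cancel => j k kj ji; rewrite /F coef_face //.
by congr (<< _ *g _ >>); apply/ffunP => x; rewrite !ffunE face_face.
Qed.

Lemma group_homology_eq0 i :
  (forall x : group_homology M i, x = 0) <->
  (forall c : bar_chain M i, is_bar_cycle c ->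
     exists b : bar_chain M i.+1, bar_boundary b = c).
Proof.
split=> [H c cc|H x].
  have := H (\pi_(group_homology M i) (exist _ c cc : bar_cycle M i))%qT.
  move=> /eqP; rewrite -(raddf0 \pi_(group_homology M i)%qT).
  by rewrite -Quotient.idealrBE subr0 => /asboolP.
rewrite -[x]reprK -(raddf0 \pi_(group_homology M i)%qT); apply/eqP.
rewrite -Quotient.idealrBE subr0; apply/asboolP/H; exact: valP.
Qed.

(* The subgroup of M generated by the elements g m - m. *)
Inductive coinvariant_relation : M -> Prop :=
| CoinvRel0 : coinvariant_relation 0
| CoinvRelB m m' : coinvariant_relation m -> coinvariant_relation m' ->
    coinvariant_relation (m - m')
| CoinvRelG g m : coinvariant_relation (gact M g m - m).

Let pt : {ffun 'I_0 -> G} := [ffun=> 1%g].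

Let ptE (t : {ffun 'I_0 -> G}) : t = pt.
Proof. by apply/ffunP => -[]. Qed.

Let bar_boundary1 (t : {ffun 'I_1 -> G}) (m : M) :
  bar_boundary (<< m *g t >> : bar_chain M 1) =
  << m - gact M (t ord_max) m *g pt >>.
Proof.
rewrite bar_boundaryU !big_ord_recl big_ord0 addr0 !(ptE (bar_face _ _)).
by rewrite /bar_coef /= expr0 expr1 mulr1z mulrN1z monalgUB.
Qed.

Let coinvariant_relationN m : coinvariant_relation m -> coinvariant_relation (- m).
Proof. by move=> rm; rewrite -sub0r; apply: CoinvRelB => //; apply: CoinvRel0. Qed.

Let coinvariant_relationD m m' : coinvariant_relation m ->
  coinvariant_relation m' -> coinvariant_relation (m + m').
Proof.
by move=> rm rm'; rewrite -[m']opprK; apply/CoinvRelB/coinvariant_relationN.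
Qed.

(* H_0 is the group of coinvariants. *)
Lemma group_homology0_eq0 :
  (forall x : group_homology M 0, x = 0) <->
  (forall m : M, coinvariant_relation m).
Proof.
rewrite group_homology_eq0; split=> [H m|H c _].
  have [b Eb] := H << m *g pt >> isT.
  have -> : m = mcoeff pt (bar_boundary b) by rewrite Eb mcoeffUU.
  rewrite [b]monalgE !raddf_sum /=.
  elim/big_ind: _ => [||t _]; [exact: CoinvRel0 | exact: coinvariant_relationD |].
  rewrite bar_boundary1 mcoeffUU -opprB; apply: coinvariant_relationN.
  exact: CoinvRelG.
have -> : c = << c@_pt *g pt >> by apply/malgP => t; rewrite (ptE t) mcoeffUU.
elim: {c}(c@_pt) / (H c@_pt) => [|m m' _ [b Eb] _ [b' Eb']|g m].
- by exists 0; rewrite raddf0 monalgU0.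
- by exists (b - b'); rewrite raddfB /= Eb Eb' -monalgUB.
- exists << - m *g [ffun=> g] >>.
  by rewrite bar_boundary1 ffunE raddfN opprK addrC.
Qed.

End BarComplex.

Section PresentedAction.
Variables (X : choiceType) (R : seq X -> seq X -> Prop) (A : zmodType).
Variables (f f' : X -> {additive A -> A}).
Hypothesis fK : forall x, cancel (f x) (f' x).
Hypothesis f'K : forall x, cancel (f' x) (f x).
Hypothesis f_rel : forall s t, R s t ->
  forall a, foldr (fun x => f x) a s = foldr (fun x => f x) a t.

Definition word_act (w : word X) (a : A) : A :=
  foldr (fun p => if p.2 then f p.1 : A -> A else f' p.1) a w.

Lemma word_act_cat u v a : word_act (u ++ v) a = word_act u (word_act v a).
Proof. exact: foldr_cat. Qed.

Lemma word_act_is_zmod_morphism w : zmod_morphism (word_act w).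
Proof.
by move=> a b; elim: w => [//|[x []] w IH] /=; rewrite IH raddfB.
Qed.

Lemma word_act_gen s a : word_act (gen_word s) a = foldr (fun x => f x) a s.
Proof. by elim: s => [//|x s IH] /=; rewrite IH. Qed.

Lemma word_act_equiv w w' : word_equiv R w w' -> word_act w =1 word_act w'.
Proof.
elim=> {w w'} [//|w w' _ E a|w w' w'' _ E _ E' a|u u' v v' _ E _ E' a|x b a|s t st a].
- by rewrite E.
- by rewrite E E'.
- by rewrite !word_act_cat E E'.
- by case: b => /=; rewrite ?fK ?f'K.
- by rewrite !word_act_gen; apply: f_rel.
Qed.

Definition presented_act (g : presented R) : A -> A :=
  word_act (presented_repr g).

HB.instance Definition _ g :=
  GRing.isZmodMorphism.Build A A (presented_act g)
    (@word_act_is_zmod_morphism (presented_repr g)).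

Lemma presented_act1 a : presented_act 1%g a = a.
Proof. exact: (word_act_equiv (presented_repr_pi _ [::])). Qed.

Lemma presented_actM g h a :
  presented_act (g * h)%g a = presented_act g (presented_act h a).
Proof. by rewrite /presented_act -word_act_cat; apply/word_act_equiv/presented_repr_pi. Qed.

Definition presented_gmodule : gmodule (presented R) :=
  GModule presented_act1 presented_actM.

Lemma presented_gmodule_gen x a :
  gact presented_gmodule (presented_gen R x) a = f x a.
Proof. exact: (word_act_equiv (presented_repr_pi _ [:: (x, true)])). Qed.

End PresentedAction.

Section BraidAction.
Variables (K : fieldType) (V : lmodType K).
Implicit Types (T : {linear tensor V V -> tensor V V}) (X Y Z : lmodType K).

Lemma braid_left_comp T X t :
  braid_left T X t = assocr V V X (tensor_idr X T (assocl V V X t)).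
Proof. by []. Qed.

Lemma braid_leftE T X v w x :
  braid_left T X (v ⊗ (w ⊗ x)) = assocr V V X (T (v ⊗ w) ⊗ x).
Proof. by rewrite braid_left_comp assoclE tensor_idrE. Qed.

Lemma tensor_ext2 X Y Z (A : lmodType K)
    (f g : {linear tensor X (tensor Y Z) -> A}) :
  (forall x y z, f (x ⊗ (y ⊗ z)) = g (x ⊗ (y ⊗ z))) -> f =1 g.
Proof.
move=> fg; apply: tensor_eq => x t.
pose h (k : {linear tensor X (tensor Y Z) -> A}) :
  {linear tensor Y Z -> A} := k \o pure_tensor _ _ x.
exact: (@tensor_eq _ _ _ _ (h f) (h g) (fg x) t).
Qed.

Lemma assoclK X Y Z : cancel (assocl X Y Z) (assocr X Y Z).
Proof.
have E : assocr X Y Z \o assocl X Y Z =1 idfun.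
  by apply: tensor_ext2 => x y z /=; rewrite assoclE assocrE.
exact: E.
Qed.

Lemma assocrK X Y Z : cancel (assocr X Y Z) (assocl X Y Z).
Proof.
have E : assocl X Y Z \o assocr X Y Z =1 idfun.
  apply: tensor_eq => t z.
  pose h : {linear tensor X Y -> tensor (tensor X Y) Z} :=
    assocl X Y Z \o assocr X Y Z \o pure_tensorr z.
  apply: (@tensor_eq _ _ _ _ h (pure_tensorr z)) => x y.
  by rewrite /h /= /pure_tensorr assocrE assoclE.
exact: E.
Qed.

Lemma braid_leftK T T' X : cancel T T' -> cancel (braid_left T X) (braid_left T' X).
Proof.
move=> TK t.
rewrite !braid_left_comp assocrK.
have E : tensor_idr X T' \o tensor_idr X T =1 idfun.
  by apply: tensor_eq => u x /=; rewrite !tensor_idrE TK.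
by rewrite [tensor_idr X T' _]E assoclK.
Qed.

Lemma tensor_idlK X Y (g : {linear X -> Y}) (g' : {linear Y -> X}) :
  cancel g g' -> cancel (tensor_idl V g) (tensor_idl V g').
Proof.
move=> gK; have E : tensor_idl V g' \o tensor_idl V g =1 idfun.
  by apply: tensor_eq => v x /=; rewrite !tensor_idlE gK.
exact: E.
Qed.

Lemma braid_atK T T' n i : cancel T T' -> cancel (braid_at T n i) (braid_at T' n i).
Proof.
move=> TK; elim: n i => [|n IH] [|i] //=; last exact: tensor_idlK.
by case: n {IH} => [|n] //; apply: braid_leftK.
Qed.

Lemma braid_left_natural T X Y (g : {linear X -> Y}) t :
  braid_left T Y (tensor_idl V (tensor_idl V g) t) =
  tensor_idl V (tensor_idl V g) (braid_left T X t).
Proof.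
have E : braid_left T Y \o tensor_idl V (tensor_idl V g) =1
         tensor_idl V (tensor_idl V g) \o braid_left T X.
  apply: tensor_ext2 => v w x /=.
  rewrite !tensor_idlE !assoclE !tensor_idrE.
  pose h1 : {linear tensor V V -> _} := assocr V V Y \o pure_tensorr (g x).
  pose h2 : {linear tensor V V -> _} :=
    tensor_idl V (tensor_idl V g) \o (assocr V V X \o pure_tensorr x).
  apply: (@tensor_eq _ _ _ _ h1 h2) => v' w'.
  by rewrite /h1 /h2 /= /pure_tensorr !assocrE !tensor_idlE.
exact: E.
Qed.

Lemma braid_at_far T n i j t : (i.+1 < j)%N ->
  braid_at T n j (braid_at T n i t) = braid_at T n i (braid_at T n j t).
Proof.
elim: n i j t => [//|n IH] [|i] [|[|j]] // t lt_ij.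
  case: n IH t => [|[|n]] IH t //=.
    exact/esym/braid_left_natural.
  exact/esym/braid_left_natural.
rewrite /=.
set f := braid_at T n j.+1; set g := braid_at T n i.
have E : tensor_idl V f \o tensor_idl V g =1 tensor_idl V g \o tensor_idl V f.
  by apply: tensor_eq => v x /=; rewrite !tensor_idlE IH.
exact: E.
Qed.

Section BraidRelation.
Variable T : {linear tensor V V -> tensor V V}.
Hypothesis T_braid :
  tensor_idl V T \o braid_left T V \o tensor_idl V T
  =1 braid_left T V \o tensor_idl V T \o braid_left T V.

Lemma braid_left_braid X t :
  braid_left T (tensor V X)
    (tensor_idl V (braid_left T X) (braid_left T (tensor V X) t)) =
  tensor_idl V (braid_left T X)
    (braid_left T (tensor V X) (tensor_idl V (braid_left T X) t)).
Proof.
pose s1 := braid_left T (tensor V X); pose s2 := tensor_idl V (braid_left T X).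
pose a1 := braid_left T V; pose a2 := tensor_idl V T.
pose J x : {linear tensor V (tensor V V) -> tensor V (tensor V (tensor V X))} :=
  tensor_idl V (tensor_idl V (pure_tensorr x)).
have J1 x z : s1 (J x z) = J x (a1 z) by apply: braid_left_natural.
have J2 x z : s2 (J x z) = J x (a2 z).
  have JE v r : J x (v ⊗ r) = v ⊗ assocr V V X (r ⊗ x).
    rewrite /J tensor_idlE.
    have E : tensor_idl V (pure_tensorr x) =1 assocr V V X \o pure_tensorr x.
      by apply: tensor_eq => p q; rewrite tensor_idlE /= /pure_tensorr assocrE.
    by rewrite E.
  have E : s2 \o J x =1 J x \o a2.
    apply: tensor_ext2 => u v w.
    rewrite -[LHS]/(s2 (J x (u ⊗ (v ⊗ w)))) -[RHS]/(J x (a2 (u ⊗ (v ⊗ w)))).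
    by rewrite /a2 tensor_idlE !JE assocrE /s2 tensor_idlE braid_leftE.
  exact: E.
have E : s1 \o s2 \o s1 =1 s2 \o s1 \o s2.
  apply: tensor_eq => u r.
  pose h (k : {linear tensor V (tensor V (tensor V X)) ->
                      tensor V (tensor V (tensor V X))}) :
    {linear tensor V (tensor V X) -> _} := k \o pure_tensorl u.
  apply: (@tensor_ext2 _ _ _ _ (h (s1 \o s2 \o s1)) (h (s2 \o s1 \o s2))).
  move=> v w x; set p := u ⊗ (v ⊗ (w ⊗ x)).
  rewrite -[LHS]/(s1 (s2 (s1 p))) -[RHS]/(s2 (s1 (s2 p))).
  have -> : p = J x (u ⊗ (v ⊗ w)) by rewrite /J !tensor_idlE.
  by rewrite !(J1, J2) -[a1 _]/((a1 \o a2 \o a1) _) -T_braid.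
exact: E.
Qed.

Lemma braid_at_braid n i t : (i.+2 < n)%N ->
  braid_at T n i (braid_at T n i.+1 (braid_at T n i t)) =
  braid_at T n i.+1 (braid_at T n i (braid_at T n i.+1 t)).
Proof.
elim: n i t => [//|n IH] [|i] t lt_in.
  by case: n IH t lt_in => [|[|n]] // IH t _; apply: braid_left_braid.
rewrite /=; set f := braid_at T n i; set g := braid_at T n i.+1.
have E : tensor_idl V f \o tensor_idl V g \o tensor_idl V f =1
         tensor_idl V g \o tensor_idl V f \o tensor_idl V g.
  by apply: tensor_eq => v x /=; rewrite !tensor_idlE IH.
exact: E.
Qed.

End BraidRelation.
End BraidAction.

Section BraidModule.
Variables (K : fieldType) (V : braidedVectorSpace K) (n : nat).

Lemma braid_module_rel (s t : seq 'I_n.-1) : braid_relation s t ->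
  forall a : tensor_power V n,
    foldr (fun i : 'I_n.-1 => braid_at (@braiding K V) n i) a s =
    foldr (fun i : 'I_n.-1 => braid_at (@braiding K V) n i) a t.
Proof.
case=> i j ij a /=; first exact: braid_at_far.
rewrite ij; apply: (braid_at_braid (@braid_equation K V)).
by have := ltn_ord j; rewrite ij ltn_predRL.
Qed.

(* V^{⊗ n}, with sigma_{i+1} acting as id^{⊗ i} ⊗ T ⊗ id^{⊗ (n - i - 2)}. *)
Definition braid_module : gmodule (braid_group n) :=
  presented_gmodule
    (fun i : 'I_n.-1 => @braid_atK K V _ _ n i (@braidingK K V))
    (fun i : 'I_n.-1 => @braid_atK K V _ _ n i (@braiding_invK K V))
    braid_module_rel.

Lemma braid_module_sigma (i : 'I_n.-1) (a : tensor_power V n) :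
  gact braid_module (sigma i) a = braid_at (@braiding K V) n i a.
Proof. exact: presented_gmodule_gen. Qed.

End BraidModule.

(* Main.v *)
(* The complex [S(N)] of a module [N] over the braid group [B_n], computing
   [H_i(B_n, N)], has in degree [q] one copy of [N] for each set of [q]
   generators, i.e. for each composition of [n] into [n - q] parts; its
   differential splits a part in two through a signed sum of shuffles.  For the
   induced module [Z[B_n] (x) N] it is exact in positive degrees: Garside theory
   embeds the positive monoid in [B_n], and the leading part of the differential
   for the filtration by word length is a sum of boundaries of full simplices,
   one for each positive braid [x], on the set of generators dividing [x].
   Dimension shifting along the induced module then compares [S(N)] with the bar
   complex.

   For [N = V^n], filtering compositions by their first part gives subquotients
   [V^(p+1) (x) S(V^(n-p-1))] shifted by [p].  By induction on [i], those with
   [1 <= p <= i] are exact in degree [i] when [n > (d + 2) i], so a cycle of degree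
   [i] is homologous to one living on compositions starting with a part equal to
   [1].  Repeating this [d + 1] times, the cycle becomes a sum of products of
   elements of [V^(d+1)] with cycles of [S(V^(n-d-1))]; the former are boundaries
   because [H_0(B_(d+1), V^(d+1)) = 0], hence so are the products. *)
Require Import Defs.
From HB Require Import structures.
From mathcomp Require Import all_boot all_order all_algebra.
From mathcomp Require Import zify finmap boolp classical_sets.
From mathcomp.multinomials Require Import monalg.
From Stdlib Require Import Setoid Morphisms.

Set Implicit Arguments.
Unset Strict Implicit.
Unset Printing Implicit Defensive.

Import GRing.Theory.

Local Open Scope ring_scope.

(** * The Salvetti complex *)

(** The slope [d + 2] is the price of one step of the induction on the degree. Clearing a part of
    [p + 1] strands that comes after [k <= d] single strands removes [k + p + 1] strands and lowers
    the degree by [p]; the worst exchange, [k = d] and [p = 1], spends [d + 2] strands on one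
    degree. The bar complex does not decompose along compositions, hence the detour through a small
    explicit complex. Its acyclicity on induced modules has to come from the presentation alone:
    since braids are classes of words, cancellation in the positive monoid and its embedding must be
    established before the length of positive words can serve as a filtration. Only one direction of
    the comparison is used: exactness of the small complex implies that of the bar complex. Chains
    are functions on all bitseqs rather than elements of graded pieces, so that length and degree
    appear as side conditions and not in types. *)

Fixpoint lead (s : bitseq) : nat := if s is true :: s' then (lead s').+1 else 0.

Lemma lead_size s : (lead s <= size s)%N.
Proof. by elim: s => [|[] s IH]. Qed.

(** The operator [t_i t_(i+1) ... t_(i+k-1)]: one strand crosses [k] neighbours. *)
Definition op_path (N : zmodType) (t : nat -> {additive N -> N})
    (i k : nat) (x : N) : N :=
  foldr (fun j => t j) x (iota i k).

(* The shuffles of [a] and [b] strands starting at strand [o], according to which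
   block the last strand belongs to; here [t i] stands for [- sigma_i]. *)
Fixpoint shuffle_rec (N : zmodType) (t : nat -> {additive N -> N})
    (o a : nat) : nat -> N -> N :=
  if a is a'.+1 then
    fix shuffle_a b x :=
      if b is b'.+1 then
        shuffle_a b' x + op_path t (o + a') b (shuffle_rec t o a' b x)
      else x
  else fun _ x => x.

(* Locked, since unification would unfold it to a sum. *)
HB.lock Definition shuffle (N : zmodType) (t : nat -> {additive N -> N}) :=
  shuffle_rec t.

Section Shuffle.
Variables (N : zmodType) (t : nat -> {additive N -> N}).
Notation op_path := (op_path t).
Notation shuffle := (shuffle t).

(* A set of generators of [B_(k+1)] is a bitseq of size [k], whose runs of [true]
   are the parts of the composition, decreased by [1].  A chain is its coefficient
   function on all bitseqs, and its boundary at [s] only involves the coefficients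
   at the bitseqs obtained from [s] by turning a [false] into a [true], that is, by
   merging two consecutive parts.  The current part starts at strand [o] and [a] of
   its generators have been read. *)
Fixpoint salvetti (o a : nat) (f : bitseq -> N) (s : bitseq) : N :=
  match s with
  | [::] => 0
  | true :: s' => - salvetti o a.+1 (fun u => f (true :: u)) s'
  | false :: s' =>
      shuffle o a.+1 (lead s').+1 (f (true :: s'))
      + salvetti (o + a.+1) 0 (fun u => f (false :: u)) s'
  end.

Lemma shuffle0l o b x : shuffle o 0 b x = x.
Proof. by rewrite unlock. Qed.

Lemma shuffle0 o a x : shuffle o a 0 x = x.
Proof. by rewrite unlock; case: a. Qed.

Lemma shuffleS o a b x :
  shuffle o a.+1 b.+1 x =
  shuffle o a.+1 b x + op_path (o + a) b.+1 (shuffle o a b.+1 x).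
Proof. by rewrite unlock. Qed.

Lemma op_pathB i k : zmod_morphism (op_path i k).
Proof.
by move=> x y; rewrite /op_path; elim: (iota i k) => [|j r IH] //=;
  rewrite IH raddfB.
Qed.

HB.instance Definition _ i k :=
  GRing.isZmodMorphism.Build N N (op_path i k) (op_pathB i k).

Lemma shuffleB o a b : zmod_morphism (shuffle o a b).
Proof.
elim: a b => [|a IHa] b x y; first by rewrite !shuffle0l.
elim: b => [|b IHb]; first by rewrite !shuffle0.
by rewrite !shuffleS IHb IHa raddfB opprD addrACA.
Qed.

HB.instance Definition _ o a b :=
  GRing.isZmodMorphism.Build N N (shuffle o a b) (shuffleB o a b).

(** This is what makes arbitrary functions usable as chains: values in other degrees or lengths
    never enter. *)
Lemma eq_in_salvetti o a f g s :
  (forall u, size u = size s -> count id u = (count id s).+1 -> f u = g u) ->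
  salvetti o a f s = salvetti o a g s.
Proof.
elim: s o a f g => [|[] s IH] o a f g fg //=.
  congr (- _); apply: IH => u us uc; apply: fg => //=; first by rewrite us.
  by rewrite uc.
rewrite fg //=; congr (_ + _); apply: IH => u us uc.
by apply: fg => //=; rewrite us.
Qed.

Lemma eq_salvetti o a f g s : f =1 g -> salvetti o a f s = salvetti o a g s.
Proof. by move=> fg; apply: eq_in_salvetti => u _ _. Qed.

Lemma salvettiB o a f g s :
  salvetti o a (fun u => f u - g u) s = salvetti o a f s - salvetti o a g s.
Proof.
elim: s o a f g => [|[] s IH] o a f g /=; first by rewrite subr0.
  by rewrite IH opprD.
by rewrite IH raddfB /= opprD addrACA.
Qed.

Lemma salvetti0 o a s : salvetti o a (fun=> 0) s = 0.
Proof. by have := salvettiB o a (fun=> 0) (fun=> 0) s; rewrite !subrr. Qed.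

Lemma salvettiN o a f s : salvetti o a (fun u => - f u) s = - salvetti o a f s.
Proof.
rewrite -[RHS]add0r -(salvetti0 o a s) -salvettiB.
by apply: eq_salvetti => u; rewrite sub0r.
Qed.

Lemma salvettiD o a f g s :
  salvetti o a (fun u => f u + g u) s = salvetti o a f s + salvetti o a g s.
Proof.
rewrite -[X in _ + X]opprK -salvettiN -salvettiB.
by apply: eq_salvetti => u; rewrite opprK.
Qed.

End Shuffle.

Section Naturality.
Variables (N N' : zmodType) (phi : {additive N -> N'}).
Variables (t : nat -> {additive N -> N}) (t' : nat -> {additive N' -> N'}).

Lemma op_path_natural i k i' k' x :
  (forall j x, (j < k)%N -> phi (t (i + j) x) = t' (i' + j) (phi x)) ->
  k' = k -> phi (op_path t i k x) = op_path t' i' k' (phi x).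
Proof.
move=> H ->; rewrite /op_path.
elim: k i i' H => [|k IH] i i' H //=.
rewrite -{1}[i]addn0 H // addn0; congr (t' _ _); apply: IH => j y jk.
by rewrite !addSnnS; apply: H.
Qed.

(** Besides module maps, [phi] will be an [op_path]; with [o] and [o'] equal or not, this yields the
    commutation and shift rules without further inductions. *)
Lemma shuffle_natural o o' a b x :
  (forall j x, (j.+1 < a + b)%N -> phi (t (o + j) x) = t' (o' + j) (phi x)) ->
  phi (shuffle t o a b x) = shuffle t' o' a b (phi x).
Proof.
elim: a b x => [|a IHa] b x H; first by rewrite !shuffle0l.
elim: b H => [|b IHb] H; first by rewrite !shuffle0.
rewrite !shuffleS raddfD IHb; last by move=> j y jk; apply: H; lia.
congr (_ + _).
rewrite (@op_path_natural _ _ (o' + a) b.+1) // => [|j y jb].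
  by rewrite IHa // => j y jb; apply: H; lia.
by rewrite -!addnA H //; lia.
Qed.

Lemma salvetti_natural o o' a f s :
  (forall j x, (j < a + size s)%N -> phi (t (o + j) x) = t' (o' + j) (phi x)) ->
  phi (salvetti t o a f s) = salvetti t' o' a (fun u => phi (f u)) s.
Proof.
elim: s o o' a f => [|[] s IH] o o' a f H //=; first exact: raddf0.
  rewrite raddfN /=; congr (- _); apply: IH => j x js.
  by apply: H; rewrite /= addnS.
rewrite raddfD; congr (_ + _).
  apply: shuffle_natural => j x jk; apply: H.
  by move: (lead_size s) => /=; lia.
by apply: IH => j x js; rewrite -!addnA; apply: H => /=; lia.
Qed.

End Naturality.

(** * The differential squares to zero *)

Section BraidShuffle.
Variables (N : zmodType) (t : nat -> {additive N -> N}) (K : nat).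
Hypothesis t_far : forall i j x, (i.+1 < j)%N -> t j (t i x) = t i (t j x).
Hypothesis t_braid : forall i x, (i.+1 < K)%N ->
  t i (t i.+1 (t i x)) = t i.+1 (t i (t i.+1 x)).

Lemma op_pathS i k x : op_path t i k.+1 x = t i (op_path t i.+1 k x).
Proof. by []. Qed.

Lemma op_path_cat i k l x :
  op_path t i (k + l) x = op_path t i k (op_path t (i + k) l x).
Proof. by rewrite /op_path iotaD foldr_cat. Qed.

Lemma op_path_far i k j x : (i + k < j)%N || (j.+1 < i)%N ->
  t j (op_path t i k x) = op_path t i k (t j x).
Proof.
move=> H; apply: op_path_natural => // l y lk.
by case/orP: H => H; [apply: t_far|symmetry; apply: t_far]; lia.
Qed.

(** The braid relation is used once, when the path reaches [j]; all other crossings commute with the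
    moving generator. *)
Lemma op_path_shift i k j x : (i + k <= K)%N -> (i <= j)%N ->
  (j.+1 < i + k)%N ->
  t j.+1 (op_path t i k x) = op_path t i k (t j x).
Proof.
elim: k i => [|k IH] i ikK ij jk; first by lia.
case: (ltngtP i j) => [lt_ij|//|eq_ij]; last first.
- subst j; case: k IH ikK jk => [|k] _ ikK jk; first by lia.
  rewrite !op_pathS -t_braid; last by lia.
  by rewrite op_path_far //; lia.
- by lia.
rewrite !op_pathS -IH; try lia.
by rewrite t_far //; lia.
Qed.

Lemma shuffle_path_far o a b i k x : (o + (a + b) <= i)%N ->
  shuffle t o a b (op_path t i k x) = op_path t i k (shuffle t o a b x).
Proof.
move=> le_i; apply/esym/(shuffle_natural (phi := op_path t i k)) => j y jk.
by rewrite /= op_path_far //; lia.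
Qed.

Lemma shuffle_path_shift o a b x : (o + (a + b) <= K)%N ->
  shuffle t o.+1 a b (op_path t o (a + b) x) =
  op_path t o (a + b) (shuffle t o a b x).
Proof.
move=> leK; apply/esym/(shuffle_natural (phi := op_path t o (a + b))) => j y jk.
by rewrite /= addSn op_path_shift //; lia.
Qed.

(** Both sides are the sum over the shuffles of three blocks. *)
Lemma shuffle_coassoc o a b c x : (o + (a + b + c) <= K.+1)%N ->
  shuffle t o a b (shuffle t o (a + b) c x) =
  shuffle t (o + a) b c (shuffle t o a (b + c) x).
Proof.
have [m] := ubnP (a + b + c)%N; elim: m a b c x => // m IH a b c x lm leK.
case: a lm leK => [|a] lm leK; first by rewrite addn0 !shuffle0l.
case: b lm leK => [|b] lm leK.
  by rewrite addn0 shuffle0l shuffle0 add0n.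
case: c lm leK => [|c] lm leK; first by rewrite !shuffle0 !addn0.
(* The last strand belongs to block [c], [b] or [a]; the term [L1] below is the first of these three
   contributions. *)
rewrite addSn (shuffleS t o (a + b.+1)) raddfD /=.
rewrite -addSn IH; try lia.
set L1 := shuffle t (o + a.+1) b.+1 c _.
rewrite shuffleS !shuffle_path_far; try lia.
set y := shuffle t o (a + b.+1) c.+1 x.
have -> : shuffle t o a.+1 b y =
          shuffle t (o + a.+1) b c.+1 (shuffle t o a.+1 (b + c.+1) x).
  by rewrite /y -addSnnS IH //; lia.
have -> : shuffle t o a b.+1 y =
          shuffle t (o + a) b.+1 c.+1 (shuffle t o a (b.+1 + c.+1) x).
  by rewrite /y IH //; lia.
rewrite [(b.+1 + c.+1)%N]addnS (shuffleS t o a (b.+1 + c)) raddfD /=.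
rewrite [X in _ = X + _]shuffleS -addrA -addSnnS.
rewrite [(o + a.+1)%N]addnS -[(b.+1 + c).+1]addnS shuffle_path_shift; last lia.
rewrite op_path_cat (_ : (o + a + b.+1 = o + (a.+1 + b))%N); last lia.
rewrite (_ : ((o + a).+1 + b = o + (a.+1 + b))%N); last lia.
by rewrite /L1 [(o + a.+1)%N]addnS (addSnnS b c).
Qed.

Lemma shuffle_salvetti_far o a c i b F s : (o + (a + c) <= i)%N ->
  salvetti t i b (fun u => shuffle t o a c (F u)) s =
  shuffle t o a c (salvetti t i b F s).
Proof.
move=> le_i; apply/esym/(salvetti_natural (phi := shuffle t o a c)) => j x jk.
apply/esym/(shuffle_natural (phi := t (i + j))) => l y lk.
by rewrite t_far //; lia.
Qed.

(** Splitting off a first block commutes with later splits: by coassociativity inside the same run,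
    by far commutation beyond it. In [salvettiK] this makes the two orders of splitting cancel,
    their signs being opposite. *)
Lemma salvetti_shuffle o a c F s : (o + (a + c) + size s <= K)%N ->
  salvetti t (o + a) c (fun u => shuffle t o a (c + lead u).+1 (F u)) s =
  shuffle t o a (c + lead s).+1 (salvetti t o (a + c) F s).
Proof.
elim: s c F => [|[] s IH] c F leK /=; first by rewrite raddf0.
  rewrite raddfN /= -[(a + c).+1]addnS -[(c + _.+1)%N]addSnnS -IH;
    last by move: leK => /=; lia.
  by congr (- _); apply: eq_salvetti => u; rewrite addSnnS.
rewrite addn0 raddfD /=; congr (_ + _).
  have := @shuffle_coassoc o a c.+1 (lead s).+1 (F (true :: s)).
  rewrite [(a + c.+1)%N]addnS addSn => -> //.
  by have := lead_size s; move: leK => /=; lia.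
by rewrite -addnA -addnS shuffle_salvetti_far //; lia.
Qed.

Lemma salvettiK o a f s : (o + a + size s <= K)%N ->
  salvetti t o a (salvetti t o a f) s = 0.
Proof.
elim: s o a f => [|[] s IH] o a f leK //=.
  rewrite salvettiN opprK; apply: IH; move: leK => /=; lia.
rewrite salvettiD IH ?addr0; last by move: leK => /=; lia.
rewrite raddfN /= addrC; apply/eqP; rewrite subr_eq0; apply/eqP.
have := @salvetti_shuffle o a.+1 0 (fun u => f (true :: u)) s.
by rewrite add0n addn0 => -> //; move: leK => /=; lia.
Qed.

End BraidShuffle.

(** * Positive braid words *)

Definition far : rel nat := fun i j => (i.+1 < j)%N || (j.+1 < i)%N.
Definition adj : rel nat := fun i j => (i.+1 == j) || (j.+1 == i).

Inductive pequiv_step : seq nat -> seq nat -> Prop :=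
| PFar i j v : far i j -> pequiv_step [:: i, j & v] [:: j, i & v]
| PBraid i j v : adj i j -> pequiv_step [:: i, j, i & v] [:: j, i, j & v]
| PCons i u v : pequiv_step u v -> pequiv_step (i :: u) (i :: v).

Inductive pequiv : seq nat -> seq nat -> Prop :=
| PRefl w : pequiv w w
| PStep w w' w'' : pequiv_step w w' -> pequiv w' w'' -> pequiv w w''.

Notation "u ≡ v" := (pequiv u v) (at level 70, no associativity).

#[local] Hint Resolve PRefl : core.

Lemma farC i j : far i j = far j i.
Proof. by rewrite /far orbC. Qed.

Lemma adjC i j : adj i j = adj j i.
Proof. by rewrite /adj orbC. Qed.

Lemma pequiv_step_sym u v : pequiv_step u v -> pequiv_step v u.
Proof.
elim=> {u v} [i j v ij|i j v ij|i u v _ IH].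
- by apply: PFar; rewrite farC.
- by apply: PBraid; rewrite adjC.
- exact: PCons.
Qed.

Lemma pequiv_trans u v w : u ≡ v -> v ≡ w -> u ≡ w.
Proof. by elim=> {u v} [//|u v v' uv _ IH] /IH; apply: PStep. Qed.

Lemma pequiv_sym u v : u ≡ v -> v ≡ u.
Proof.
elim=> {u v} [w|u v w /pequiv_step_sym vu _ IH]; first exact: PRefl.
by apply: pequiv_trans IH _; apply: PStep vu (PRefl _).
Qed.

#[export] Instance pequiv_equivalence : Equivalence pequiv.
Proof. by split=> [u|u v|u v w];
  [exact: PRefl|exact: pequiv_sym|exact: pequiv_trans]. Qed.

Lemma pequiv_cons i u v : u ≡ v -> i :: u ≡ i :: v.
Proof.
elim=> {u v} [w|u v w uv _ IH]; first exact: PRefl.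
exact: PStep (PCons i uv) IH.
Qed.

#[export] Instance pequiv_cons_morphism (i : nat) :
  Proper (pequiv ==> pequiv) (cons i).
Proof. by move=> u v; apply: pequiv_cons. Qed.

Lemma pequiv_catl w u v : u ≡ v -> w ++ u ≡ w ++ v.
Proof. by move=> uv; elim: w => [//|i w IH]; apply: pequiv_cons. Qed.

Lemma pequiv_catr w u v : u ≡ v -> u ++ w ≡ v ++ w.
Proof.
elim=> {u v} [u|u v v' uv _ IH]; first exact: PRefl.
apply: PStep IH; elim: uv => {u v v'} *;
  [exact: PFar|exact: PBraid|exact: PCons].
Qed.

#[export] Instance pequiv_cat_morphism :
  Proper (pequiv ==> pequiv ==> pequiv) (@cat nat).
Proof.
by move=> u u' uu' v v' vv'; apply:
  pequiv_trans (pequiv_catr _ uu') (pequiv_catl _ vv').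
Qed.

Lemma pequiv_far i j v : far i j -> [:: i, j & v] ≡ [:: j, i & v].
Proof. by move=> ij; apply: PStep (PFar _ ij) (PRefl _). Qed.

Lemma pequiv_braid i j v : adj i j -> [:: i, j, i & v] ≡ [:: j, i, j & v].
Proof. by move=> ij; apply: PStep (PBraid _ ij) (PRefl _). Qed.

Lemma pequiv_size u v : u ≡ v -> size u = size v.
Proof.
elim=> {u v} [//|u v w uv _ <-].
by elim: uv => {u v w} //= i u v _ ->.
Qed.

Lemma pequiv_mem u v : u ≡ v -> u =i v.
Proof.
elim=> {u v} [//|u v w uv _ IH] x; rewrite -{}IH.
elim: uv => {u v w} [i j v _|i j v _|i u v _ IH]; rewrite !inE ?IH //.
  by rewrite orbCA.
by do 2!case: (_ == _).
Qed.

(* [i :: complement i j] is the least common multiple of [i] and [j]. *)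
Definition complement (i j : nat) : seq nat :=
  if i == j then [::] else if adj i j then [:: j; i] else [:: j].

(** Garside's key property: words starting with [i] and [j] pass through the least common multiple
    of these letters. The case [i = j] is left cancellation. *)
Definition reduces (w w' : seq nat) : Prop :=
  if (w, w') is (i :: a, j :: b) then
    exists c, a ≡ complement i j ++ c /\ b ≡ complement j i ++ c
  else w = w'.

Lemma complement_refl i : complement i i = [::].
Proof. by rewrite /complement eqxx. Qed.

Lemma complement_far i j : far i j -> complement i j = [:: j].
Proof.
by rewrite /complement => ij; rewrite !ifF //; move: ij; rewrite /far /adj; lia.
Qed.

Lemma complement_farr i j : far i j -> complement j i = [:: i].
Proof. by rewrite farC; apply: complement_far. Qed.

Lemma complement_adj i j : adj i j -> complement i j = [:: j; i].
Proof.
rewrite /complement => ij; rewrite ij ifF //; move: ij; rewrite /adj; lia.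
Qed.

Lemma complement_adjr i j : adj i j -> complement j i = [:: i; j].
Proof. by rewrite adjC; apply: complement_adj. Qed.

Lemma far_adjP i j : [\/ i = j, far i j | adj i j].
Proof.
rewrite /far /adj; case: (ltngtP i j) => ij; last by constructor 1.
  by case: (ltngtP i.+1 j) => ij'; [constructor 2|lia|constructor 3]; lia.
by case: (ltngtP j.+1 i) => ij'; [constructor 2|lia|constructor 3]; lia.
Qed.

Lemma pequiv_step_reduces w w' : pequiv_step w w' -> reduces w w'.
Proof.
case=> {w w'} [i j v ij|i j v ij|i u v uv] /=.
- by exists v; rewrite complement_far ?complement_farr.
- by exists v; rewrite complement_adj ?complement_adjr.
- exists v; rewrite complement_refl; split=> //.
  exact: PStep uv (PRefl _).
Qed.

(* Garside's argument: given [i :: a], [k :: c] and [j :: b] equivalent, words of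
   smaller size are compared to fill in the cube spanned by [i], [j] and [k]. *)
Section ReducesTrans.
Variable l : nat.
Hypothesis IH : forall u v, (size u < l)%N -> u ≡ v -> reduces u v.

Let red_eq i a b : i :: a ≡ i :: b -> ((size a).+1 < l)%N -> a ≡ b.
Proof.
by move=> e al; have := @IH (i :: a) _ al e;
  rewrite /reduces complement_refl => -[c [-> ->]].
Qed.

Let red_far i j a b : far i j -> i :: a ≡ j :: b -> ((size a).+1 < l)%N ->
  exists c, a ≡ j :: c /\ b ≡ i :: c.
Proof.
move=> ij e al; have := @IH (i :: a) _ al e; rewrite /reduces => -[c];
  rewrite complement_far // complement_farr //.
by exists c.
Qed.

Let red_adj i j a b : adj i j -> i :: a ≡ j :: b -> ((size a).+1 < l)%N ->
  exists c, a ≡ [:: j, i & c] /\ b ≡ [:: i, j & c].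
Proof.
move=> ij e al; have := @IH (i :: a) _ al e; rewrite /reduces => -[c];
  rewrite complement_adj // complement_adjr //.
by exists c.
Qed.

Lemma reduces_trans w w' w'' : (size w <= l)%N -> size w = size w' ->
  reduces w w' -> reduces w' w'' -> reduces w w''.
Proof.
case: w => [|i a] //; first by move=> _ _ <-.
case: w' => [|k c]; first by move=> _ _ ->.
case: w'' => [|j b] //=.
move=> al [ac] [u [au cu]] [v [cv bv]].
have uv : complement k i ++ u ≡ complement k j ++ v by rewrite -cu -cv.
have ul : (size (complement k i) + size u < l)%N.
  by rewrite -size_cat -(pequiv_size cu) -ac.
have vl : (size (complement k j) + size v < l)%N.
  by rewrite -size_cat -(pequiv_size uv) size_cat.
clear al ac; suff : exists c', complement i k ++ u ≡ complement i j ++ c' /\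
    complement j k ++ v ≡ complement j i ++ c'.
  by case=> c'; rewrite -au -bv; exists c'.
clear a b c au cu cv bv; move: uv ul vl.
have [->|ik|ik] := far_adjP i k.
- rewrite complement_refl /= => uv ul vl.
  by exists v; rewrite uv.
- rewrite (complement_far ik) (complement_farr ik).
  have [->|jk|jk] := far_adjP j k.
  + rewrite complement_refl /= => uv _ _; exists u.
    by rewrite -uv (complement_far ik) (complement_farr ik).
  + rewrite (complement_far jk) (complement_farr jk) /=.
    have [->|ij|ij] := far_adjP i j.
    * rewrite complement_refl /= => uv ul vl.
      by exists (k :: v); rewrite (red_eq uv ul).
    * move=> uv ul vl; have [c [r1 r2]] := red_far ij uv ul.
      exists (k :: c); rewrite r1 r2 complement_far ?complement_farr //=.
      by split; apply: pequiv_far; rewrite farC.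
    * move=> uv ul vl; have [c [r1 r2]] := red_adj ij uv ul.
      exists (k :: c); rewrite r1 r2 complement_adj ?complement_adjr //=.
      have [ki kj] : far k i /\ far k j by rewrite farC ik farC jk.
      rewrite (pequiv_far _ kj) (pequiv_far _ ki) (pequiv_far (j ::
        c) ki) (pequiv_far c kj).
      by [].
  + rewrite (complement_adj jk) (complement_adjr jk) /=.
    have [ij|ij|ij] := far_adjP i j.
    * by exfalso; move: ik jk; rewrite ij /far /adj; lia.
    * move=> uv ul vl; have [c1 [r1 e1]] := red_far ij uv ul.
      have ki : far k i by rewrite farC.
      have [c2 [r2 r3]] := red_far ki e1 (ltnW vl).
      exists [:: k, j & c2]; rewrite r1 r2 r3 complement_far ?complement_farr
        //=.
      rewrite (pequiv_far c2 (i := j) (j := i)) 1?farC //.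
      rewrite (pequiv_far (j :: c2) ki) (@pequiv_braid j k) //; split=> //.
    * move=> uv ul vl; have [c1 [r1 e1]] := red_adj ij uv ul.
      have ki : far k i by rewrite farC.
      have [c2 [r2 e2]] := red_far ki e1 (ltnW vl).
      have c1l : (size (j :: c1) < l)%N.
        by have := pequiv_size e1; move: vl => /=; lia.
      have [c3 [r3 r4]] := red_adj jk e2 c1l.
      exists [:: k, j, i & c3]; rewrite r1 r2 r3 r4 complement_adj
        ?complement_adjr //=.
      have kj : adj k j by rewrite adjC.
      split.
        rewrite (pequiv_far (j :: c3) ik) (pequiv_braid [:: i, j & c3] kj).
        by rewrite (pequiv_braid c3 (i := j) (j :=
          i)) 1?adjC // (pequiv_far [:: j, i & c3] ki).
      rewrite (pequiv_braid (k :: c3) (i := j) (j := i)) 1?adjC //.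
      rewrite (pequiv_far _ ki) (pequiv_far c3 ik).
      by rewrite (pequiv_braid _ kj).
- rewrite (complement_adj ik) (complement_adjr ik).
  have ki : adj k i by rewrite adjC.
  have [->|jk|jk] := far_adjP j k.
  + rewrite complement_refl /= => uv _ _; exists u.
    by rewrite -uv (complement_adj ik) (complement_adjr ik).
  + rewrite (complement_far jk) (complement_farr jk) /=.
    have kj : far k j by rewrite farC.
    have [ij|ij|ij] := far_adjP i j.
    * by exfalso; move: ik jk; rewrite ij /far /adj; lia.
    * move=> uv ul vl; have [c1 [e1 r1]] := red_far ij uv ul.
      have [c2 [r2 r3]] := red_far kj e1 (ltnW ul).
      exists [:: k, i & c2]; rewrite r1 r2 r3 complement_far ?complement_farr
        //=.
      rewrite (pequiv_far c2 ij) (pequiv_far _ kj); split=> //.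
      exact: pequiv_braid.
    * move=> uv ul vl; have [c1 [e1 r1]] := red_adj ij uv ul.
      have [c2 [r2 e2]] := red_far kj e1 (ltnW ul).
      have c1l : (size (i :: c1) < l)%N.
        by have := pequiv_size e1; move: ul => /=; lia.
      have [c3 [r3 r4]] := red_adj ik e2 c1l.
      exists [:: k, i, j & c3]; rewrite r1 r2 r3 r4 complement_adj
        ?complement_adjr //=.
      have ji : adj j i by rewrite adjC.
      split.
        rewrite (pequiv_braid (k :: c3) ij) (pequiv_far c3 jk) (pequiv_far _
          kj).
        by rewrite (pequiv_braid _ ki).
      rewrite (pequiv_far (i :: c3) jk) (pequiv_braid [:: j, i & c3] ki).
      by rewrite (pequiv_braid c3 ij) (pequiv_far [:: i, j & c3] kj).
  + rewrite (complement_adj jk) (complement_adjr jk) /=.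
    have kj : adj k j by rewrite adjC.
    have [ij|ij|ij] := far_adjP i j.
    * rewrite ij complement_refl /= -ij => uv ul vl.
      have uv' := red_eq (red_eq uv ul) (ltnW ul).
      by exists [:: k, i & u]; rewrite uv'.
    * move=> uv ul vl; have [c1 [e1 e2]] := red_far ij uv ul.
      have [c2 [r1 e3]] := red_adj kj e1 (ltnW ul).
      have [c3 [r2 e4]] := red_adj ki e2 (ltnW vl).
      have := pequiv_trans (pequiv_sym e3) e4 => e5.
      have c2l : ((size (j :: c2)).+1 < l)%N.
        by have := pequiv_size e3; have := pequiv_size e1; move: ul => /=; lia.
      have [c4 [r3 r4]] := red_far (eq_trans (farC j i) ij) (red_eq e5 c2l)
        (ltnW c2l).
      (* With [i] and [j] on the two sides of [k], the cube closes at the half twist on four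
         strands, of length six: [i], [j] and these four letters. *)
      exists [:: k, j, i, k & c4]; rewrite r1 r2 r3 r4 complement_far
        ?complement_farr //=.
      have ji : far j i by rewrite farC.
      split.
        rewrite (pequiv_far _ ij) (pequiv_braid _ ik) (pequiv_braid _ kj) //.
      rewrite (pequiv_far _ ji) (pequiv_braid _ jk) (pequiv_braid _ ki)
        (pequiv_far _ ij) //.
    * by exfalso; move: ik jk ij; rewrite /adj; lia.
Qed.
End ReducesTrans.

(** Induction on the length supplies the hypothesis of [reduces_trans]; within one length, the
    derivation is followed step by step. *)
Lemma pequiv_reduces u v : u ≡ v -> reduces u v.
Proof.
have [l] := ubnP (size u); elim: l u v => // l IH u v ul uv.
elim: uv ul => {u v} [[|i a]|u v w uv vw IHw] ul //.
  by exists a; rewrite complement_refl.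
have e : size u = size v by apply: pequiv_size; apply: PStep uv (PRefl _).
apply: (reduces_trans (l := l) _ _ e (pequiv_step_reduces uv)) => //.
by apply: IHw; rewrite -e.
Qed.

Lemma pequiv_cons_inj i a b : i :: a ≡ i :: b -> a ≡ b.
Proof. by move/pequiv_reduces;
  rewrite /reduces complement_refl => -[c [-> ->]]. Qed.

Lemma pequiv_cat_inj w a b : w ++ a ≡ w ++ b -> a ≡ b.
Proof. by elim: w => [|i w IH] //= /pequiv_cons_inj. Qed.

Lemma pequiv_cons_far i j a b : far i j -> i :: a ≡ j :: b ->
  exists c, a ≡ j :: c /\ b ≡ i :: c.
Proof.
by move=> ij /pequiv_reduces; rewrite /reduces complement_far //
  complement_farr.
Qed.

Lemma pequiv_cons_adj i j a b : adj i j -> i :: a ≡ j :: b ->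
  exists c, a ≡ [:: j, i & c] /\ b ≡ [:: i, j & c].
Proof.
by move=> ij /pequiv_reduces; rewrite /reduces complement_adj //
  complement_adjr.
Qed.

(** * Left divisibility and half twists as least common multiples *)

Definition ldvd (u w : seq nat) : Prop := exists c, w ≡ u ++ c.

Lemma ldvd_pequiv u w w' : w ≡ w' -> ldvd u w -> ldvd u w'.
Proof. by move=> ww' [c e]; exists c; rewrite -ww'. Qed.

Lemma pequiv_comm_far u v : allrel far u v -> u ++ v ≡ v ++ u.
Proof.
elim: u => [|i u IH]; first by rewrite cats0.
rewrite allrel_consl => /andP[iv uv] /=; rewrite (IH uv).
elim: v iv {IH uv} => [|j v IH] //= /andP[ij iv].
by rewrite (pequiv_far _ ij) IH.
Qed.

Lemma ldvd_far_cat j u y : all (far j) u -> ldvd [:: j] (u ++ y) ->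
  ldvd [:: j] y.
Proof.
elim: u => [|i u IH] //= /andP[ji ju] [c e]; apply: IH => //.
rewrite farC in ji.
by have [d [e1 _]] := pequiv_cons_far ji e; exists d.
Qed.

(* The half twist on the [a] strands starting at [o]. *)
Fixpoint delta (o a : nat) : seq nat :=
  if a is a'.+1 then iota o a' ++ delta o a' else [::].

Lemma mem_delta o a : all (fun i => (o <= i)%N && (i.+1 < o + a)%N) (delta o a).
Proof.
elim: a => [|a IH] //=; rewrite all_cat; apply/andP; split.
  by apply/allP => i; rewrite mem_iota; lia.
by apply: sub_all IH => i; lia.
Qed.

Lemma far_delta o a v : all (fun i => (i.+1 < o)%N || (o + a <= i)%N) v ->
  allrel far (delta o a) v.
Proof.
move=> /allP vP; apply/allrelP => i j /(allP (mem_delta o a)) + /vP.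
by rewrite /far; lia.
Qed.

(** The mirrored recursion has the smaller half twist on the left, where [ldvd_delta] can strip
    it. *)
Lemma deltaSr o a : delta o a.+1 ≡ delta o a ++ rev (iota o a).
Proof.
elim: a => [|a IH] //.
transitivity (iota o a.+1 ++ (delta o a ++ rev (iota o a))).
  by rewrite -IH.
rewrite -[delta o a.+1]/(iota o a ++ delta o a) -addn1 iotaD rev_cat /= -!catA.
have /pequiv_comm_far/(pequiv_catr (rev (iota o a))) :
  allrel far (delta o a) [:: (o + a)%N].
  by apply: far_delta; rewrite /= leqnn orbT.
by rewrite -!catA /= => ->.
Qed.

(** Letters far from [p] are moved across it one by one; the last one, [p.+1], is adjacent and
    forces the additional letter [p]. *)
Lemma ldvd_descend p k z : ldvd (rev (iota p.+1 k.+1)) (p :: z) ->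
  ldvd (rev (iota p.+1 k.+1) ++ [:: p]) z.
Proof.
elim: k z => [|k IH] z [c e].
  have [|d [e1 _]] := pequiv_cons_adj (i := p) (j := p.+1) _ e.
    by rewrite /adj eqxx.
  by exists d.
move: e; rewrite -[k.+2]addn1 iotaD rev_cat /= => e.
have [|d [e1 e2]] := pequiv_cons_far (i := p) (j := (p.+1 + k.+1)%N) _ e.
  by rewrite /far; lia.
have [|v e3] := IH d; first by exists c; rewrite -e2.
by exists v; rewrite e1 e3.
Qed.

Lemma ldvd_descend_rev o c k y :
  ldvd (rev (iota (o + c) k.+1)) (rev (iota o c) ++ y) ->
  ldvd (rev (iota o (c + k.+1))) y.
Proof.
elim: c k y => [|c IH] k y; first by rewrite addn0.
have -> : rev (iota o c.+1) = (o + c)%N :: rev (iota o c).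
  by rewrite -addn1 iotaD rev_cat.
rewrite addnS => /ldvd_descend; rewrite cats1 -rev_cons => /(IH k.+1).
by rewrite addSnnS.
Qed.

Lemma ldvd_cat u v w : w ≡ u ++ v -> forall x, ldvd x v -> ldvd (u ++ x) w.
Proof. by move=> e x [c ec]; exists c; rewrite e ec catA. Qed.

(** The new generator [o + a] is far from [delta o a], so it divides what follows this factor;
    [ldvd_descend_rev] then prolongs it to the whole descent by which the two half twists differ. *)
Lemma ldvd_delta o a w : (forall j, (o <= j)%N -> (j < o + a)%N ->
  ldvd [:: j] w) ->
  ldvd (delta o a.+1) w.
Proof.
elim: a => [|a IH] H; first by exists w.
have [|y e] := IH; first by move=> j oj ja; apply: H => //; lia.
have : ldvd [:: (o + a)%N] (delta o a.+1 ++ y).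
  by apply: ldvd_pequiv e _; apply: H; lia.
move=> /(ldvd_pequiv (pequiv_catr y (deltaSr o a))); rewrite -catA.
move=> /ldvd_far_cat H1.
have /H1 {}H1 : all (far (o + a)) (delta o a).
  by apply: sub_all (mem_delta o a) => i; rewrite /far; lia.
have /(ldvd_cat e) [c ec] := @ldvd_descend_rev o a 0 y H1.
by exists c; rewrite ec addn1 (deltaSr o a.+1).
Qed.

(* The half twist of the parabolic submonoid given by [s], i.e. the least common
   multiple of its generators, with the conventions of [salvetti]. *)
Fixpoint delta_of (o a : nat) (s : bitseq) : seq nat :=
  match s with
  | [::] => delta o a.+1
  | true :: s' => delta_of o a.+1 s'
  | false :: s' => delta o a.+1 ++ delta_of (o + a.+1) 0 s'
  end.

Lemma ldvd_delta_of o a s w :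
  (forall j, (o <= j)%N -> (j < o + a)%N -> ldvd [:: j] w) ->
  (forall j, nth false s j -> ldvd [:: (o + a + j)%N] w) ->
  ldvd (delta_of o a s) w.
Proof.
elim: s o a w => [|[] s IH] o a w H1 H2 /=; first exact: ldvd_delta.
  apply: IH => [j oj ja|j sj]; last by have := H2 j.+1 sj; rewrite !addnS addSn.
  have [ja'|aj] := ltnP j (o + a)%N; first exact: H1.
  by have := H2 0 isT; rewrite addn0; have -> : j = (o + a)%N by lia.
have [y e] := ldvd_delta H1; apply: (ldvd_cat e).
apply: IH => [j|j sj]; first by lia.
have := H2 j.+1 sj => /(ldvd_pequiv e)/ldvd_far_cat; rewrite addn0 !addnS addSn.
apply; apply: sub_all (mem_delta o a.+1) => i; rewrite /far; lia.
Qed.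

(* The longest shuffle. *)
Fixpoint top_shuffle (o a b : nat) : seq nat :=
  if a is a'.+1 then iota (o + a') b ++ top_shuffle o a' b else [::].

Lemma size_top_shuffle o a b : size (top_shuffle o a b) = (a * b)%N.
Proof. by elim: a => [|a IH] //=; rewrite size_cat size_iota IH mulSn. Qed.

Lemma mem_top_shuffle o a b :
  all (fun i => (o <= i)%N && (i.+1 < o + (a + b))%N) (top_shuffle o a b).
Proof.
elim: a => [|a IH] //=; rewrite all_cat; apply/andP; split.
  by apply/allP => i; rewrite mem_iota; lia.
by apply: sub_all IH => i; lia.
Qed.

(** The counterpart of [op_path_shift] for words. *)
Lemma pequiv_iota_shift i k v : all (fun j => (i <= j)%N &&
  (j.+1 < i + k)%N) v ->
  map S v ++ iota i k ≡ iota i k ++ v.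
Proof.
elim: v => [|j v IH] /=; first by rewrite cats0.
move=> /andP[/andP[ij jk] /IH ->].
suff E : j.+1 :: iota i k ≡ iota i k ++ [:: j].
  by rewrite -[j.+1 :: _]/((j.+1 :: iota i k) ++ v) E -catA.
have -> : (k = (j - i) + (2 + (i + k - j.+2)))%N by lia.
rewrite !iotaD /= (_ : (i + (j - i) = j)%N) ?subnKC //.
set p := iota i (j - i); set r := iota _ _.
have cp : allrel far [:: j.+1] p.
  by apply/allrelP => x y; rewrite inE => /eqP -> ; rewrite mem_iota /far; lia.
have cr : allrel far [:: j] r.
  by apply/allrelP => x y; rewrite inE => /eqP -> ; rewrite mem_iota /far; lia.
have /(pequiv_catr [:: j, j.+1 & r]) := pequiv_comm_far cp;
  rewrite -catA /= => ->.
rewrite -!catA; apply: pequiv_catl.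
have jj : adj j.+1 j by rewrite /adj eqxx orbT.
by rewrite /= (pequiv_braid _ jj); do 2!apply: pequiv_cons;
  apply: (pequiv_comm_far cr).
Qed.

Lemma map_delta o a : map S (delta o a) = delta o.+1 a.
Proof.
elim: a => [|a IH] //=; rewrite map_cat IH; congr (_ ++ _).
by rewrite (iotaDl 1 o a).
Qed.

Lemma delta_top o a b :
  delta o a ++ delta (o + a) b ++ top_shuffle o a b ≡ delta o (a + b).
Proof.
elim: a => [|a IH] /=; first by rewrite addn0 cats0.
rewrite iotaD -!catA -IH; apply: pequiv_catl.
have : delta (o + a.+1) b ++ iota (o + a) b ≡ iota (o + a) b ++ delta (o + a) b.
  rewrite addnS -map_delta; apply: pequiv_iota_shift.
  by apply: sub_all (mem_delta (o + a) b) => i; lia.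
move/(pequiv_catr (top_shuffle o a b)); rewrite -!catA => ->.
have : delta o a ++ iota (o + a) b ≡ iota (o + a) b ++ delta o a.
  apply/pequiv_comm_far/far_delta/allP => i; rewrite mem_iota; lia.
by move/(pequiv_catr (delta (o + a) b ++ top_shuffle o a b)); rewrite -!catA.
Qed.

Lemma mem_delta_of o a s :
  all (fun i => (o <= i)%N && (i < o + a + size s)%N) (delta_of o a s).
Proof.
elim: s o a => [|[] s IH] o a /=.
- by apply: sub_all (mem_delta o a.+1) => i; lia.
- by apply: sub_all (IH o a.+1) => i; lia.
- rewrite all_cat; apply/andP; split.
    by apply: sub_all (mem_delta o a.+1) => i; lia.
  by apply: sub_all (IH (o + a.+1) 0) => i; lia.
Qed.

Lemma delta_of_top o a c s :
  delta o a ++ delta_of (o + a) c s ++ top_shuffle o a (c + lead s).+1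
  ≡ delta_of o (a + c) s.
Proof.
elim: s c => [|[] s IH] c /=; first by rewrite addn0 delta_top addnS.
  by rewrite -[(c + _.+1)%N]addSnnS -[(a + c).+1]addnS IH.
rewrite addn0 -catA -[(a + c).+1]addnS -addnA.
set R := delta_of _ 0 s.
have : top_shuffle o a c.+1 ++ R ≡ R ++ top_shuffle o a c.+1.
  apply/pequiv_comm_far/allrelP => i j /(allP (mem_top_shuffle o a c.+1)).
  by move=> + /(allP (mem_delta_of _ 0 s)); rewrite /far; lia.
move/pequiv_sym/(pequiv_catl (delta (o + a) c.+1))/(pequiv_catl (delta o a)) =>
  ->.
rewrite -[iota o _ ++ _]/(delta o (a + c).+1) -addnS -!catA.
by have /(pequiv_catr R) := delta_top o a c.+1; rewrite -!catA.
Qed.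

(** Merging two parts multiplies the half twist by the longest shuffle. Hence the longest shuffle in
    the differential preserves the product of half twist and coefficient. *)
Lemma delta_of_cons o a s :
  delta_of o a (false :: s) ++ top_shuffle o a.+1 (lead s).+1
  ≡ delta_of o a (true :: s).
Proof.
by have := delta_of_top o a.+1 0 s; rewrite add0n addn0 catA.
Qed.

Lemma ldvd_gen_delta o a j : (o <= j)%N -> (j < o + a)%N ->
  ldvd [:: j] (delta o a.+1).
Proof.
elim: a o => [|a IH] o oj ja; first by lia.
case: (ltngtP o j) => [lt_oj|//|->]; last first.
- by exists (iota j.+1 a ++ delta j a.+1).
- by lia.
have [||c e] := IH o.+1; [lia..|].
exists (c ++ top_shuffle o 1 a.+1).
by rewrite -[a.+2]add1n -(delta_top o 1) addn1 e.
Qed.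

Lemma ldvd_gen_delta_of o a s j : 
  (o <= j)%N -> (j < o + a)%N || nth false s (j - (o + a)) ->
  ldvd [:: j] (delta_of o a s).
Proof.
elim: s o a => [|[] s IH] o a oj /=; rewrite ?nth_nil ?orbF.
- exact: ldvd_gen_delta.
- move=> H; apply: IH => //; apply/orP.
  case: (ltngtP j (o + a)%N) H => ja //= H; [left; lia| |left; lia].
  by right; have := H; have -> : (j - (o + a) = (j - (o + a.+1)).+1)%N by lia.
- case: (ltnP j (o + a)%N) => [ja _|aj /= H].
    have [c e] := ldvd_gen_delta oj ja.
    exists (c ++ delta_of (o + a.+1) 0 s); exact: (pequiv_catr _ e).
  have lt_j : (o + a < j)%N.
    by case: ltngtP aj H => // -> _; rewrite subnn.
  have [||c e] := IH (o + a.+1)%N 0; first by lia.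
    move: H; have -> : (j - (o + a) = (j - (o + a.+1 + 0)).+1)%N by lia.
    by rewrite /= => ->; rewrite orbT.
  have cj : delta o a.+1 ++ [:: j] ≡ [:: j] ++ delta o a.+1.
    by apply/pequiv_comm_far/far_delta; rewrite /= andbT; apply/orP; right; lia.
  exists (delta o a.+1 ++ c).
  by rewrite e catA; apply: (pequiv_catr c cj).
Qed.

(* The full twist on [k.+1] strands, as a product of Jucys-Murphy elements. *)
Fixpoint full_twist (k : nat) : seq nat :=
  if k is k'.+1 then full_twist k' ++ rev (iota 0 k) ++ iota 0 k else [::].

Lemma mem_full_twist k : all (ltn^~ k) (full_twist k).
Proof.
elim: k => [|k IH] //=.
rewrite !all_cat -[(0 :: iota 1 k)]/(iota 0 k.+1) all_rev andbb; apply/andP;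
  split.
  by apply: sub_all IH => i /=; lia.
by apply/allP => i; rewrite mem_iota /=; lia.
Qed.

Lemma full_twistS k :
  full_twist k.+1 = full_twist k ++ rev (iota 0 k.+1) ++ iota 0 k.+1.
Proof. by []. Qed.

Lemma pequiv_rev u v : u ≡ v -> rev u ≡ rev v.
Proof.
elim=> {u v} [//|u v w uv _ <-].
elim: uv => {u v w} [i j v ij|i j v ij|i u v _ IH].
- by rewrite !rev_cons -!cats1 -!catA /=; apply/pequiv_catl/pequiv_far;
  rewrite farC.
- by rewrite !rev_cons -!cats1 -!catA /=; apply/pequiv_catl/pequiv_braid.
- by rewrite !rev_cons -!cats1; apply: pequiv_catr.
Qed.

(** The descending and the ascending factor shift the letter in opposite directions. *)
Lemma comm_jucys_murphy k j : (j < k)%N ->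
  j :: rev (iota 0 k.+1) ++ iota 0 k.+1 ≡ rev (iota 0 k.+1) ++ iota 0 k.+1 ++
    [:: j].
Proof.
move=> jk; have e : [:: j.+1] ++ iota 0 k.+1 ≡ iota 0 k.+1 ++ [:: j].
  by apply: (@pequiv_iota_shift 0 k.+1 [:: j]) => /=; lia.
have e' : rev (iota 0 k.+1) ++ [:: j.+1] ≡ [:: j] ++ rev (iota 0 k.+1).
  by have := pequiv_rev e; rewrite !rev_cat.
by rewrite -e catA e' -catA.
Qed.

Lemma comm_cat u v w : w ++ u ≡ u ++ w -> w ++ v ≡ v ++ w ->
  w ++ (u ++ v) ≡ (u ++ v) ++ w.
Proof. by move=> cu cv; rewrite catA cu -!catA cv. Qed.

Lemma comm_all u w : (forall j, j \in w -> [:: j] ++ u ≡ u ++ [:: j]) ->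
  w ++ u ≡ u ++ w.
Proof.
elim: w => [|j w IH] H; first by rewrite cats0.
rewrite -cat1s -catA IH => [|i iw]; last by apply: H; rewrite inE iw orbT.
by rewrite catA H ?mem_head // -catA.
Qed.

Lemma full_twist_comm k j : (j < k)%N ->
  [:: j] ++ full_twist k ≡ full_twist k ++ [:: j].
Proof.
elim: k => [|k IH] // jk; rewrite full_twistS.
move: jk; rewrite ltnS leq_eqVlt => /orP[/eqP ->|jk]; last first.
  by apply: comm_cat; [exact: IH|rewrite -catA; apply: comm_jucys_murphy].
case: k {IH} => [|k] //.
set A := rev (iota 0 k.+1) ++ iota 0 k.+1.
have eA : rev (iota 0 k.+2) ++ iota 0 k.+2 = [:: k.+1] ++ A ++ [:: k.+1].
  by rewrite -(addn1 k.+1) iotaD rev_cat -!catA.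
(* With [s] the letter [k.+1], the consecutive Jucys-Murphy elements [A] and [s A s] commute; hence
   [s] commutes with their product. *)
have cA : A ++ [:: k.+1] ++ A ++ [:: k.+1] ≡ [:: k.+1] ++ A ++ [:: k.+1] ++ A.
  have : A ++ ([:: k.+1] ++ A ++ [:: k.+1]) ≡ ([:: k.+1] ++ A ++ [::
    k.+1]) ++ A.
    apply: comm_all => i; rewrite -eA mem_cat mem_rev orbb mem_iota => ik.
    by rewrite -catA; apply: comm_jucys_murphy; lia.
  by rewrite -!catA.
rewrite full_twistS eA -/A -catA; apply: comm_cat.
  apply/pequiv_comm_far; rewrite allrel1l.
  by apply: sub_all (mem_full_twist k) => i /=; rewrite /far; lia.
by have := pequiv_sym (pequiv_catr [:: k.+1] cA); rewrite -!catA.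
Qed.

Lemma full_twist_commw k w : all (ltn^~ k) w ->
  w ++ full_twist k ≡ full_twist k ++ w.
Proof. by move=> /allP wk; apply: comm_all => j /wk;
  apply: full_twist_comm. Qed.

Lemma ldvd_full_twist k j : (j < k)%N -> ldvd [:: j] (full_twist k).
Proof.
elim: k => [|k IH] //; rewrite ltnS leq_eqVlt => /orP[/eqP ->|jk]; last first.
  have [c e] := IH jk; rewrite full_twistS.
  by exists (c ++ rev (iota 0 k.+1) ++ iota 0 k.+1); rewrite e.
set A := rev (iota 0 k.+1) ++ iota 0 k.+1.
have /pequiv_sym cA : A ++ full_twist k ≡ full_twist k ++ A.
  apply/pequiv_sym/comm_all => j' /(allP (mem_full_twist k)) jk.
  by rewrite -catA; apply: comm_jucys_murphy.
exists (rev (iota 0 k) ++ iota 0 k.+1 ++ full_twist k).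
rewrite full_twistS -/A (pequiv_trans cA (PRefl _)) /A.
by rewrite -{1}[k.+1]addn1 iotaD rev_cat /= -catA.
Qed.

(** * The positive monoid in the braid group *)

Section PositiveBraids.
Variable n : nat.
Local Notation G := (braid_group n).
Local Notation K := n.-1.
Local Notation ok := (all (ltn^~ K)).

(** Out-of-range letters stand for the unit. Far commutation then holds for all indices, while the
    braid relation keeps a bound, as in the hypotheses on [t] above. *)
Definition sgen (i : nat) : G := if insub i is Some j then sigma j else 1%g.

Definition braid_of (w : seq nat) : G :=
  foldr (fun i g => (sgen i * g)%g) 1%g w.

Lemma braid_of_cat u v : braid_of (u ++ v) = (braid_of u * braid_of v)%g.
Proof. by elim: u => [|i u IH] /=; rewrite ?mul1g // IH mulgA. Qed.

Lemma sgenE (i : 'I_K) : sgen i = sigma i.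
Proof. by rewrite /sgen valK. Qed.

Lemma sgen_out i : (K <= i)%N -> sgen i = 1%g.
Proof. by move=> Ki; rewrite /sgen insubF // ltnNge Ki. Qed.

Lemma presented_pi_mul w w' :
  presented_pi (@braid_relation n) (w ++ w') =
  (presented_pi (@braid_relation n) w * presented_pi (@braid_relation n) w' :
    G)%g.
Proof. by rewrite [RHS]presented_mul_pi. Qed.

Lemma presented_pi_gen s :
  presented_pi (@braid_relation n) (gen_word s) = braid_of (map val s).
Proof.
elim: s => [|i s IH] //.
by rewrite /= sgenE -IH -presented_pi_mul.
Qed.

Lemma ok_ord w : ok w -> exists s : seq 'I_K, w = map val s.
Proof.
move=> /allP wK; exists (pmap insub w); rewrite pmap_filter; last exact: insubK.
by apply/esym/all_filterP/allP => i /wK iK; rewrite insubT.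
Qed.

Lemma sgen_far i j : far i j -> (sgen i * sgen j = sgen j * sgen i)%g.
Proof.
wlog ij : i j / (i.+1 < j)%N.
  by move=> H /orP[|] ij; [|symmetry]; apply: H => //; rewrite /far ij.
move=> _; have [Kj|jK] := leqP K j; first by rewrite (sgen_out Kj) mul1g mulg1.
have iK : (i < K)%N by lia.
have /presented_piP := WordRel (@BraidComm n (Ordinal jK) (Ordinal iK) ij).
by rewrite !presented_pi_gen /= !mulg1.
Qed.

Lemma sgen_braid i : (i.+1 < K)%N ->
  (sgen i * (sgen i.+1 * sgen i) = sgen i.+1 * (sgen i * sgen i.+1))%g.
Proof.
move=> iK; have iK' := ltnW iK.
have /presented_piP :=
  WordRel (@BraidBraid n (Ordinal iK') (Ordinal iK) (erefl _)).
by rewrite !presented_pi_gen /= !mulg1.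
Qed.

Lemma braid_of_pequiv u v : u ≡ v -> ok u -> braid_of u = braid_of v.
Proof.
elim=> {u v} [//|u v w uv _ IH uK]; rewrite -IH; last first.
  have e : u =i v by apply/pequiv_mem/(PStep uv).
  by move/allP: uK => uK; apply/allP => x; rewrite -e; apply: uK.
elim: uv uK => {u v w IH} [i j v ij _|i j v ij|i u v _ IH] /=.
- by rewrite !mulgA sgen_far.
- move=> /and4P[iK jK _ _]; rewrite !mulgA; congr (_ * _)%g; rewrite -!mulgA.
  by case/orP: ij iK jK => /eqP <- iK jK; rewrite sgen_braid.
- by move=> /andP[_ /IH ->].
Qed.

Lemma exists_sgen_complement (i : 'I_K) : exists c, full_twist K ≡ val i :: c.
Proof. exact: ldvd_full_twist (ltn_ord i). Qed.

(** As the full twist is central, the inverse of a generator is this positive word divided by the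
    full twist. *)
Definition sgen_complement (i : 'I_K) : seq nat :=
  sval (cid (exists_sgen_complement i)).

Lemma sgen_complementE i : full_twist K ≡ val i :: sgen_complement i.
Proof. by rewrite /sgen_complement; case: cid. Qed.

Lemma pequiv_ok u v : u ≡ v -> ok u = ok v.
Proof. by move/pequiv_mem/eq_all_r. Qed.

Lemma ok_full_twist : ok (full_twist K).
Proof. exact: mem_full_twist. Qed.

Lemma ok_sgen_complement i : ok (sgen_complement i).
Proof. by have := ok_full_twist;
  rewrite (pequiv_ok (sgen_complementE i)) => /andP[]. Qed.

Definition twist_pow (m : nat) : seq nat := flatten (nseq m (full_twist K)).

Lemma twist_powD m p : twist_pow (m + p) = twist_pow m ++ twist_pow p.
Proof. by rewrite /twist_pow nseqD flatten_cat. Qed.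

Lemma twist_powS m : twist_pow m.+1 = full_twist K ++ twist_pow m.
Proof. by []. Qed.

Lemma ok_twist_pow m : ok (twist_pow m).
Proof. by elim: m => [|m IH] //; rewrite twist_powS all_cat ok_full_twist. Qed.

Lemma twist_pow_comm m w : ok w -> w ++ twist_pow m ≡ twist_pow m ++ w.
Proof.
move=> wK; elim: m => [|m IH]; first by rewrite cats0.
by rewrite twist_powS; apply: comm_cat => //; apply: full_twist_commw.
Qed.

Definition numer (w : word 'I_K) : seq nat :=
  flatten [seq if p.2 then [:: val p.1] else sgen_complement p.1 | p <- w].

Definition denom (w : word 'I_K) : nat := count (fun p => ~~ p.2) w.

Lemma numer_cat u v : numer (u ++ v) = numer u ++ numer v.
Proof. by rewrite /numer map_cat flatten_cat. Qed.

Lemma ok_numer w : ok (numer w).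
Proof.
elim: w => [|[x []] w IH] //=; first by rewrite ltn_ord.
by rewrite /numer /= all_cat ok_sgen_complement.
Qed.

(* The fraction [numer w / full_twist ^ denom w] only depends on the braid. *)
Lemma numer_equiv w w' : word_equiv (@braid_relation n) w w' ->
  numer w ++ twist_pow (denom w') ≡ numer w' ++ twist_pow (denom w).
Proof.
elim=> {w w'} [w|w w' _|w w' w'' _ IH1 _ IH2|u u' v v' _ IH1 _ IH2|x b|s t st].
- by [].
- exact: pequiv_sym.
(* Transitivity of equality of fractions: multiply by the middle denominator, then cancel it. *)
- apply: (pequiv_cat_inj (w := twist_pow (denom w'))).
  rewrite -!twist_pow_comm ?all_cat ?ok_numer ?ok_twist_pow // -!catA.
  rewrite (twist_pow_comm _ (ok_twist_pow (denom w''))).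
  rewrite (twist_pow_comm _ (ok_twist_pow (denom w))) !catA IH1 -IH2 -!catA.
  by apply/pequiv_catl/twist_pow_comm/ok_twist_pow.
- rewrite !numer_cat /denom !count_cat -!/(denom _).
  rewrite addnC twist_powD [in X in _ ≡ X]addnC twist_powD.
  have swap X Y m p : ok Y -> (X ++ Y) ++ twist_pow m ++ twist_pow p ≡
      (X ++ twist_pow p) ++ (Y ++ twist_pow m).
    move=> Yok; rewrite -!catA; apply: pequiv_catl; rewrite catA.
    by apply: twist_pow_comm; rewrite all_cat Yok ok_twist_pow.
  by rewrite !swap ?ok_numer // IH1 IH2.
(* The complement also works on the other side, by centrality and cancellation. *)
- suff H y : sgen_complement y ++ [:: val y] ≡ full_twist K.
    case: b; rewrite /numer /= !cats0 /twist_pow /= !cats0; last exact: H.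
    exact/pequiv_sym/sgen_complementE.
  apply: (pequiv_cons_inj (i := val y)).
  apply: (pequiv_trans (v := full_twist K ++ [:: val y])).
    exact: (pequiv_catr _ (pequiv_sym (sgen_complementE y))).
  exact: (pequiv_sym (full_twist_comm (ltn_ord y))).
- have numer_gen r : numer (gen_word r) = map val r.
    by elim: r => //= i r <-.
  have denom_gen (r : seq 'I_K) : denom (gen_word r) = 0 by elim: r.
  rewrite !numer_gen !denom_gen !cats0.
  case: st => i j ij /=; first by apply: pequiv_far; rewrite /far ij orbT.
  by rewrite ij; apply: pequiv_braid; rewrite /adj eqxx.
Qed.

(** Positive words have denominator zero, so equality of fractions is equivalence of words. *)
Lemma braid_of_inj u v : ok u -> ok v -> braid_of u = braid_of v -> u ≡ v.
Proof.
move=> /ok_ord[s ->] /ok_ord[s' ->]; rewrite -!presented_pi_gen.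
move=> /presented_piP/numer_equiv.
have numer_gen r : numer (gen_word r) = map val r by elim: r => //= i r <-.
have denom_gen (r : seq 'I_K) : denom (gen_word r) = 0 by elim: r.
by rewrite !numer_gen !denom_gen !cats0.
Qed.

(** Each inverse letter of a word for [g] costs one full twist, brought next to it by centrality. *)
Lemma braid_fraction (g : G) : exists m w,
  ok w /\ (g * braid_of (twist_pow m) = braid_of w)%g.
Proof.
rewrite -[g]presented_reprK; elim:
  (presented_repr g) => [|[x b] w [m [u [uK e]]]].
  by exists 0, [::]; rewrite mulg1.
have E m' : (presented_pi (@braid_relation n) ((x, b) :: w) * m')%g =
  (presented_pi (@braid_relation n) [:: (x, b)] *
   (presented_pi (@braid_relation n) w * m') : G)%g.
  by rewrite mulgA -presented_pi_mul.
case: b E => E.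
  exists m, (val x :: u); rewrite E e /= ltn_ord uK; split=> //.
  by rewrite sgenE.
exists m.+1, (sgen_complement x ++ u); rewrite all_cat ok_sgen_complement uK.
split=> //; rewrite E twist_powS.
rewrite (braid_of_pequiv (twist_pow_comm m ok_full_twist)); last first.
  by rewrite all_cat ok_twist_pow ok_full_twist.
rewrite braid_of_cat (mulgA (presented_pi _ w)) e -braid_of_cat.
rewrite (braid_of_pequiv (full_twist_commw uK)); last first.
  by rewrite all_cat uK ok_full_twist.
rewrite braid_of_cat (braid_of_pequiv (sgen_complementE x) ok_full_twist) /=.
rewrite sgenE braid_of_cat !mulgA -presented_pi_mul.
suff -> : presented_pi (@braid_relation n) ([:: (x, false)] ++ [:: (x, true)]) =
  1%g :> G by rewrite mul1g.
exact/presented_piP/(WordCancel _ x false).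
Qed.

End PositiveBraids.

(** * Exactness for free modules *)

Section Flip.
Variable N : zmodType.
Implicit Types (b : bool) (x : N).

Definition flip b x : N := if b then - x else x.

Lemma flip_addb b b' x : flip b (flip b' x) = flip (b (+) b') x.
Proof. by case: b b' => [] [] //=; rewrite /flip opprK. Qed.

Lemma flipK b : involutive (flip b).
Proof. by move=> x; rewrite flip_addb addbb. Qed.

Lemma flipN b x : flip b (- x) = - flip b x.
Proof. by case: b. Qed.

Lemma flip0 b : flip b 0 = 0 :> N.
Proof. by case: b; rewrite /= ?oppr0. Qed.

Lemma flipD b x y : flip b (x + y) = flip b x + flip b y.
Proof. by case: b; rewrite //= opprD. Qed.

Lemma flip_neq0 b x : (flip b x != 0) = (x != 0).
Proof. by case: b; rewrite //= oppr_eq0. Qed.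

(* As for [salvetti], the boundary at a face [s] sums over the faces obtained from
   [s] by adding a vertex. *)
Fixpoint simplex_boundary (F : bitseq -> N) (s : bitseq) : N :=
  match s with
  | [::] => 0
  | true :: s' => - simplex_boundary (fun u => F (true :: u)) s'
  | false :: s' => F (true :: s') + simplex_boundary (fun u => F (false ::
    u)) s'
  end.

(** The cone from the vertex [j], signed by the parity of the number of vertices before [j]. *)
Fixpoint simplex_contract (j : nat) (F : bitseq -> N) (s : bitseq) : N :=
  match s, j with
  | [::], _ => 0
  | b :: s', 0 => if b then F (false :: s') else 0
  | b :: s', j'.+1 => flip b (simplex_contract j' (fun u => F (b :: u)) s')
  end.

Lemma eq_in_simplex_boundary F F' s :
  (forall u, size u = size s -> F u = F' u) ->
  simplex_boundary F s = simplex_boundary F' s.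
Proof.
elim: s F F' => [|[] s IH] F F' FF' //=.
  by congr (- _); apply: IH => u us; apply: FF'; rewrite /= us.
rewrite FF' //; congr (_ + _); apply: IH => u us; apply: FF'; rewrite /= us //.
Qed.

Lemma simplex_boundary0 s : simplex_boundary (fun=> 0) s = 0.
Proof. by elim: s => [|[] s IH] //=; rewrite IH ?oppr0 ?addr0. Qed.

Lemma simplex_boundary_flip b F s :
  simplex_boundary (fun u => flip b (F u)) s = flip b (simplex_boundary F s).
Proof.
elim: s F => [|[] s IH] F /=; first by rewrite flip0.
  by rewrite IH flipN.
by rewrite IH flipD.
Qed.

Lemma simplex_contractN j F s :
  simplex_contract j (fun u => - F u) s = - simplex_contract j F s.
Proof.
elim: s j F => [|b s IH] [|j] F //=; rewrite ?oppr0 //.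
  by case: b; rewrite ?oppr0.
by rewrite IH flipN.
Qed.

Lemma simplex_contractD j F F' s :
  simplex_contract j (fun u => F u + F' u) s =
  simplex_contract j F s + simplex_contract j F' s.
Proof.
elim: s j F F' => [|b s IH] [|j] F F' //=; rewrite ?addr0 //.
  by case: b; rewrite ?addr0.
by rewrite IH flipD.
Qed.

Lemma simplex_contractK j F s : (j < size s)%N ->
  simplex_boundary (simplex_contract j F) s
  + simplex_contract j (simplex_boundary F) s = F s.
Proof.
elim: s j F => [|b s IH] [|j] F //=.
  move=> _; case: b => /=; last by rewrite simplex_boundary0 !addr0.
  rewrite (eq_in_simplex_boundary (F' := fun u => F (false :: u))) //.
  by rewrite addrCA addNr addr0.
rewrite ltnS => js; case: b => /=.
  by rewrite (simplex_boundary_flip true) simplex_contractN !opprK IH.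
by rewrite simplex_contractD addrACA addNr add0r IH.
Qed.

Lemma simplex_contractE j F s : exists b, simplex_contract j F s =
  if nth false s j then flip b (F (set_nth false s j false)) else 0.
Proof.
elim: s j F => [|b s IH] [|j] F /=; try by exists false.
have [b' ->] := IH j (fun u => F (b :: u)); exists (b (+) b').
by case: ifP => _; rewrite ?flip_addb ?flip0.
Qed.

End Flip.

Lemma malg_eq (I : choiceType) (M A : zmodType)
    (f f' : {additive {malg M[I]} -> A}) :
  (forall k x, f << x *g k >> = f' << x *g k >>) -> f =1 f'.
Proof.
by move=> ff' c; rewrite [c]monalgE !raddf_sum; apply: eq_bigr => k _;
  exact: ff'.
Qed.

Lemma mem_bitseqs k (s : bitseq) : size s = k ->
  s \in [seq val u | u : k.-tuple bool].
Proof.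
move=> sk; apply/mapP; exists (Tuple (introT eqP sk)) => //.
by rewrite mem_enum.
Qed.

Lemma count0_nseq (s : bitseq) : count id s = 0 -> s = nseq (size s) false.
Proof.
move=> /eqP; rewrite -leqn0 leqNgt -has_count => /hasPn sF.
by apply/all_pred1P/allP => b /sF; case: b.
Qed.

(** * Induced modules and their translations *)

Section Translation.
Variables (G : groupType) (N : zmodType).
Implicit Types (g h : G) (c : {malg N[G]}).

Definition ltrans g c : {malg N[G]} :=
  malg_ext (fun h x => << x *g (g * h)%g >>) c.
(** Right translations commute with the action, hence with the differential; they will move supports
    into the positive monoid. *)
Definition rtrans g c : {malg N[G]} :=
  malg_ext (fun h x => << x *g (h * g)%g >>) c.

Lemma ltransB g : zmod_morphism (ltrans g).
Proof. by apply: malg_ext_is_zmod_morphism => h x y; rewrite monalgUB. Qed.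

Lemma rtransB g : zmod_morphism (rtrans g).
Proof. by apply: malg_ext_is_zmod_morphism => h x y; rewrite monalgUB. Qed.

HB.instance Definition _ g :=
  GRing.isZmodMorphism.Build _ _ (ltrans g) (ltransB g).
HB.instance Definition _ g :=
  GRing.isZmodMorphism.Build _ _ (rtrans g) (rtransB g).

Lemma ltransU g h x : ltrans g << x *g h >> = << x *g (g * h)%g >>.
Proof. by apply: malg_extU => k y z; rewrite monalgUB. Qed.

Lemma rtransU g h x : rtrans g << x *g h >> = << x *g (h * g)%g >>.
Proof. by apply: malg_extU => k y z; rewrite monalgUB. Qed.

Lemma mcoeff_ltrans g c h : (ltrans g c)@_h = c@_(g^-1 * h)%g.
Proof.
have E : mcoeff h \o ltrans g =1 mcoeff (g^-1 * h)%g.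
  apply: malg_eq => k x /=; rewrite ltransU !mcoeffU.
  by rewrite -(can2_eq (mulKg g) (mulVKg g)).
exact: E.
Qed.

Lemma mcoeff_rtrans g c h : (rtrans g c)@_h = c@_(h * g^-1)%g.
Proof.
have E : mcoeff h \o rtrans g =1 mcoeff (h * g^-1)%g.
  apply: malg_eq => k x /=; rewrite rtransU !mcoeffU.
  by rewrite -(can2_eq (mulgK g) (mulgVK g)).
exact: E.
Qed.

Lemma ltrans1 c : ltrans 1%g c = c.
Proof. by apply/malgP => h; rewrite mcoeff_ltrans invg1 mul1g. Qed.

Lemma ltransM g h c : ltrans (g * h)%g c = ltrans g (ltrans h c).
Proof. by apply/malgP => k; rewrite !mcoeff_ltrans invgM mulgA. Qed.

Lemma rtrans_ltrans g h c : rtrans g (ltrans h c) = ltrans h (rtrans g c).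
Proof. by apply/malgP => k; rewrite !(mcoeff_ltrans, mcoeff_rtrans) mulgA. Qed.

Lemma rtransK g : cancel (rtrans g) (rtrans g^-1%g).
Proof.
by move=> c; apply/malgP => h; rewrite !mcoeff_rtrans invgK mulgK.
Qed.

Definition free_gmodule : gmodule G := GModule ltrans1 ltransM.

End Translation.
Arguments delta : simpl never.

Lemma delta_of_false o a s :
  delta_of o a (false :: s) = delta o a.+1 ++ delta_of (o + a.+1) 0 s.
Proof. by []. Qed.

Section BraidOperators.
Variables (n : nat) (M : gmodule (braid_group n)).

Definition braid_op (i : nat) (x : M) : M := - gact M (sgen n i) x.

Lemma braid_opB i : zmod_morphism (braid_op i).
Proof. by move=> x y; rewrite /braid_op raddfB opprD. Qed.

HB.instance Definition _ i :=
  GRing.isZmodMorphism.Build M M (braid_op i) (braid_opB i).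

Lemma braid_op_far i j x : (i.+1 < j)%N ->
  braid_op j (braid_op i x) = braid_op i (braid_op j x).
Proof.
move=> ij; rewrite /braid_op !raddfN !opprK -!gactM sgen_far //.
by rewrite /far ij orbT.
Qed.

Lemma braid_op_braid i x : (i.+1 < n.-1)%N ->
  braid_op i (braid_op i.+1 (braid_op i x)) =
  braid_op i.+1 (braid_op i (braid_op i.+1 x)).
Proof.
have E j k l : braid_op j (braid_op k (braid_op l x)) =
    - gact M (sgen n j * (sgen n k * sgen n l))%g x.
  by rewrite /braid_op !gactM (raddfN (gact M (sgen n k))) opprK.
by move=> iK; rewrite !E sgen_braid.
Qed.

End BraidOperators.

Section FreeModule.
Variables (n : nat) (N : zmodType).
Local Notation G := (braid_group n).
Local Notation K := n.-1.
Local Notation ok := (all (ltn^~ K)).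
Local Notation E := (free_gmodule G N).
Local Notation op := (@braid_op n E).
Local Notation br := (braid_of n).

(** The weight filtration: [D] will be the length of the half twist of a bitseq. All positive words
    for [h] have the same length, so the choice of [w] is harmless. *)
Definition light (L D : nat) (h : G) : Prop :=
  exists w, [/\ ok w, br w = h & (size w + D < L)%N].

Lemma light_mono L L' D D' h : (L + D' <= L' + D)%N -> light L D h ->
  light L' D' h.
Proof. by move=> le [w [wK e wL]]; exists w; split=> //; lia. Qed.

Lemma light_mul L D u h : ok u -> light L (size u + D) h ->
  light L D (br u * h)%g.
Proof.
move=> uK [w [wK e wL]]; exists (u ++ w).
by rewrite all_cat uK wK braid_of_cat e size_cat; split=> //; lia.
Qed.

Lemma mcoeff_op i c h : (op i c)@_h = - c@_((sgen n i)^-1 * h)%g.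
Proof. by rewrite mcoeffN mcoeff_ltrans. Qed.

Lemma mcoeff_op_path i k c h :
  (op_path op i k c)@_h = flip (odd k) c@_((br (iota i k))^-1 * h)%g.
Proof.
elim: k i h => [|k IH] i h; first by rewrite /= invg1 mul1g.
by rewrite op_pathS mcoeff_op IH /= invgM mulgA -(flip_addb true).
Qed.

Lemma ok_iota i k : (i + k <= K)%N -> ok (iota i k).
Proof. by move=> ikK; apply/allP => j; rewrite mem_iota /=; lia. Qed.

(** No shuffle has more than [a * b] crossings. *)
Lemma shuffle_light o a b c L D : (o + (a + b) <= K.+1)%N ->
  (forall h, c@_h != 0 -> light L (D + a * b) h) ->
  forall h, (shuffle op o a b c)@_h != 0 -> light L D h.
Proof.
elim: a b c D => [|a IHa] b c D leK cP h; first by rewrite shuffle0l => /cP;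
  rewrite addn0.
elim: b D leK cP h => [|b IHb] D leK cP h.
  by rewrite shuffle0 => /cP; rewrite muln0 addn0.
rewrite shuffleS mcoeffD => H.
have [e|ne] := eqVneq ((shuffle op o a.+1 b c)@_h) 0; last first.
  by apply: IHb ne => [|k /cP]; [lia|apply: light_mono; lia].
move: H; rewrite e add0r mcoeff_op_path flip_neq0 => H.
rewrite -[h](mulVKg (br (iota (o + a) b.+1))).
apply: light_mul; first by apply: ok_iota; lia.
apply: IHa H => [|k /cP]; first by lia.
by apply: light_mono; rewrite size_iota; lia.
Qed.

(** Only one shuffle has [a * b] crossings; the others land in weight below [L]. *)
Lemma shuffle_top o a b c L D h : (o + (a + b) <= K.+1)%N ->
  (forall h, c@_h != 0 -> light L.+1 (D + a * b) h) -> ~ light L D h ->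
  (shuffle op o a b c)@_h =
  flip (odd (a * b)) c@_((br (top_shuffle o a b))^-1 * h)%g.
Proof.
elim: a D h => [|a IHa] D h leK cP hL.
  by rewrite shuffle0l /= invg1 mul1g.
case: b IHa leK cP => [|b] IHa leK cP.
  by rewrite shuffle0 muln0 /=; elim: a {IHa leK cP} => [|a IHa] //=;
     rewrite invg1 mul1g.
rewrite shuffleS mcoeffD (_ : (shuffle op o a.+1 b c)@_h = 0) ?add0r;
  last first.
  apply/eqP; apply: contra_notT hL => H.
  apply: shuffle_light H => [|k /cP]; first by lia.
  by apply: light_mono; lia.
rewrite mcoeff_op_path (IHa (size (iota (o + a) b.+1) + D)%N); first last.
- by apply: contra_not hL => /light_mul; rewrite mulVKg; apply; apply: ok_iota;
  lia.
- by move=> k /cP; apply: light_mono; rewrite size_iota; lia.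
- by lia.
by rewrite flip_addb mulSn oddD mulgA -invgM -braid_of_cat.
Qed.

Lemma size_delta_of_cons o a s :
  (size (delta_of o a (false :: s)) + a.+1 * (lead s).+1 =
   size (delta_of o a (true :: s)))%N.
Proof. by rewrite -(pequiv_size (delta_of_cons o a s)) size_cat
  size_top_shuffle. Qed.

Local Notation dl o a u := (size (delta_of o a u)).
Local Notation br_delta o a u := (br (delta_of o a u)).

(* Placing the coefficient [y] of a bitseq [u] at the weight [delta_of u * y], the
   part of heaviest weight of the differential preserves the weight, and becomes a
   simplicial boundary after the sign twist by the length of [delta_of]. *)
Lemma salvetti_top o a f s x L C : (o + a + size s <= K)%N ->
  (forall u, size u = size s ->
    forall h, (f u)@_h != 0 -> light L.+1 (C + dl o a u) h) ->
  ~ light L (C + dl o a s) ((br_delta o a s)^-1 * x)%g ->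
  (salvetti op o a f s)@_((br_delta o a s)^-1 * x)%g =
  flip (odd (dl o a s)) (simplex_boundary
    (fun u => flip (odd (dl o a u)) (f u)@_((br_delta o a u)^-1 * x)%g) s).
Proof.
elim: s o a f x C => [|[] s IH] o a f x C leK fP hL /=.
- by rewrite mcoeff0 flip0.
- rewrite mcoeffN (IH _ _ _ _ C) ?flipN //; first by move: leK => /=; lia.
  by move=> u us; apply: (fP (true :: u)); rewrite /= us.
set d := delta o a.+1 in hL *; rewrite mcoeffD.
have lK := lead_size s.
rewrite (shuffle_top (L := L) (D := C + dl o a (false :: s))) //; first last.
- move=> h fh; rewrite -addnA size_delta_of_cons.
  exact: (fP (true :: s) (erefl _) h fh).
- by move: leK => /=; lia.
rewrite mulgA -invgM -braid_of_cat -/(delta_of o a (false :: s)).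
rewrite (braid_of_pequiv (delta_of_cons o a s)); last first.
  rewrite all_cat; apply/andP; split.
    apply: sub_all (mem_delta_of o a (false :: s)) => i /=.
    by move: leK => /=; lia.
  apply: sub_all (mem_top_shuffle o a.+1 (lead s).+1) => i /=.
  by move: leK => /=; lia.
(* [C] accumulates the lengths of the half twists of the parts already passed. *)
rewrite braid_of_cat invgM -mulgA (IH _ _ _ _ (C + size d)%N); first last.
- by move: hL; rewrite size_cat addnA braid_of_cat invgM -mulgA.
- move=> u us h fh; have us' : size (false :: u) = (size s).+1 by rewrite /= us.
  by have := fP _ us' h fh; rewrite delta_of_false size_cat addnA.
- by move: leK => /=; lia.
rewrite flipD; congr (_ + _).
  rewrite -[dl o a.+1 s]/(dl o a (true ::
    s)) flip_addb -size_delta_of_cons oddD.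
  by rewrite addbA addbb addFb.
rewrite -/d; set F := fun u => flip _ _.
rewrite [in RHS](eq_in_simplex_boundary (F' :=
  fun u => flip (odd (size d)) (F u))).
  rewrite simplex_boundary_flip flip_addb delta_of_false size_cat oddD.
  by rewrite -/d [odd _ (+) odd (dl _ _ _)]addbC -addbA addbb addbF.
move=> u _; rewrite /F flip_addb size_cat oddD braid_of_cat invgM mulgA.
by [].
Qed.

Local Notation d := (salvetti op 0 0).
Local Notation "'δ' u" := (delta_of 0 0 u) (at level 2, u at level 1).

Lemma ok_delta_of s : size s = K -> ok (δ s).
Proof.
move=> sK; apply: sub_all (mem_delta_of 0 0 s) => i /=.
by rewrite sK; lia.
Qed.

Lemma count_set_nth (s : bitseq) j : nth false s j ->
  (count id (set_nth false s j false)).+1 = count id s.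
Proof. by elim: s j => [|b s IH] [|j] //= => [->//|/IH <-]; rewrite addnS. Qed.

Lemma size_set_nth_in (s : bitseq) j : nth false s j ->
  size (set_nth false s j false) = size s.
Proof.
move=> sj; rewrite size_set_nth; apply/maxn_idPr.
by rewrite ltnNge; apply: contraL sj => sj; rewrite nth_default.
Qed.

(** Lengths of positive words are additive and well defined on braids, so the quotient of [W] by the
    half twist cannot be represented by a shorter positive word. *)
Lemma light_heavy W s : ok W -> size s = K ->
  ~ light (size W) (size (δ s)) ((br (δ s))^-1 * br W)%g.
Proof.
move=> Wok sK [w [wK e wW]].
have /pequiv_size : W ≡ δ s ++ w.
  apply: (braid_of_inj (n := n)) => //; first by rewrite all_cat ok_delta_of.
  by rewrite braid_of_cat e mulVKg.
by rewrite size_cat; lia.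
Qed.

(* The faces of weight [x] are the sets of generators dividing [x], since such sets
   have their least common multiple dividing [x]; this simplex is contractible. *)
Lemma top_boundary q f L x :
  (0 < q)%N ->
  (forall s, size s = K -> forall h, (f s)@_h != 0 ->
    light L.+1 (size (δ s)) h) ->
  (forall s, size s = K -> (count id s).+1 = q -> d f s = 0) ->
  exists H : bitseq -> N,
    (forall s, size s = K -> H s != 0 ->
       light L.+1 (size (δ s)) ((br (δ s))^-1 * x)%g) /\
    (forall s, size s = K -> count id s = q ->
       ~ light L (size (δ s)) ((br (δ s))^-1 * x)%g ->
       flip (odd (size (δ s))) (f s)@_((br (δ s))^-1 * x)%g =
       simplex_boundary H s).
Proof.
move=> q0 fL df.
pose F s := flip (odd (size (δ s))) (f s)@_((br (δ s))^-1 * x)%g.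
have [[s0 [s0K s0q s0F s0L]]|noheavy] := pselect (exists s, [/\ size s = K,
    count id s = q, F s != 0 & ~ light L (size (δ s)) ((br (δ s))^-1 * x)%g]);
    last first.
  exists (fun=> 0); split=> [s _|s sK sq sL]; first by rewrite eqxx.
  rewrite simplex_boundary0; apply/eqP; apply: contra_notT noheavy => sF.
  by exists s.
have [w0 [w0K e0 w0L]] : light L.+1 (size (δ s0)) ((br (δ s0))^-1 * x)%g.
  by apply: fL => //; move: s0F; rewrite flip_neq0.
pose W := δ s0 ++ w0.
have eW : br W = x by rewrite braid_of_cat e0 mulVKg.
have Wok : ok W by rewrite all_cat ok_delta_of.
have sizeW : size W = L.
  apply/eqP; rewrite eqn_leq; apply/andP; split; first by rewrite size_cat; lia.
  rewrite leqNgt; apply/negP => WL; apply: s0L; exists w0; split=> //.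
  by move: WL; rewrite size_cat addnC.
have heavy s : size s = K -> ~ light L (size (δ s)) ((br (δ s))^-1 * x)%g.
  by rewrite -sizeW -eW; apply: light_heavy.
(* As [0 < q], the face [s0] has a vertex [j]. It divides [x], hence is a vertex of the simplex of
   [x], which is contracted onto it. *)
have [j s0j] : exists j, nth false s0 j.
  move: q0; rewrite -s0q -has_count => /(nth_find false) sj.
  by exists (find id s0).
have jK : (j < K)%N.
  by rewrite ltnNge; apply: contraL s0j => sj; rewrite nth_default ?s0K.
have jW : ldvd [:: j] W.
  have [|c e] := @ldvd_gen_delta_of 0 0 s0 j isT;
    first by rewrite addn0 subn0 s0j.
  by exists (c ++ w0); rewrite /W e.
exists (simplex_contract j F); split=> [s sK|s sK sq sL].
  have [b ->] := simplex_contractE j F s; case: ifP => sj; last by rewrite eqxx.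
  rewrite flip_neq0 flip_neq0; set s' := set_nth _ _ _ _ => fs'.
  have s'K : size s' = K by rewrite size_set_nth_in.
  have [w [wK e wL]] := fL s' s'K _ fs'.
  have eW' : W ≡ δ s' ++ w.
    apply: (braid_of_inj (n := n)) => //; first by rewrite all_cat ok_delta_of.
    by rewrite braid_of_cat e mulVKg.
  (* Vertices of [s] are [j] or vertices of [s']; all divide [W], hence so does their least common
     multiple, and the cone stays in the simplex. *)
  have [|i si|c ec] := @ldvd_delta_of 0 0 s W; first by move=> i; lia.
    have [->|ij] := eqVneq i j; first exact: jW.
    have [|c ec] := @ldvd_gen_delta_of 0 0 s' i isT.
      by rewrite addn0 subn0 nth_set_nth /= (negPf ij).
    by exists (c ++ w); rewrite eW' ec.
  have cW := pequiv_size ec; exists c; split.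
  - by have := pequiv_ok n ec; rewrite Wok all_cat => /esym/andP[].
  - have := braid_of_pequiv ec Wok; rewrite eW braid_of_cat => ->.
    by rewrite mulKg.
  - by move: cW; rewrite size_cat sizeW; lia.
rewrite -[LHS]/(F s) -(@simplex_contractK _ j F s) ?sK //.
have [b ->] := simplex_contractE j (simplex_boundary F) s.
case: ifP => sj; last by rewrite addr0.
set s' := set_nth _ _ _ _.
have s'K : size s' = K by rewrite size_set_nth_in.
(* The other half of the contraction identity vanishes: [s'] has degree [q - 1], where [d f = 0],
   and the leading part of [d f] is the boundary of [F]. *)
suff -> : simplex_boundary F s' = 0 by rewrite flip0 addr0.
apply: (can_inj (flipK (odd (size (δ s'))))); rewrite flip0.
rewrite -(@salvetti_top 0 0 f s' x L 0) ?s'K ?add0n //.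
- by rewrite df ?mcoeff0 // count_set_nth.
- exact: heavy.
Qed.

(** Induction on the weight bound: a chain [g] assembled from the contractions removes the part of
    weight [L] from [f]. *)
Lemma free_salvetti_exact_light q f L : (0 < q)%N ->
  (forall s, size s = K -> forall h, (f s)@_h != 0 -> light L (size (δ s)) h) ->
  (forall s, size s = K -> (count id s).+1 = q -> d f s = 0) ->
  exists g, forall s, size s = K -> count id s = q -> f s = d g s.
Proof.
move=> q0; elim: L f => [|L IH] f fL df.
  exists (fun=> 0) => s sK sq; rewrite salvetti0; apply/malgP => h.
  rewrite mcoeff0; apply/eqP; apply/negPn/negP => /(fL s sK)[w []].
  by rewrite ltn0.
have /choice[H HP] := fun x => @top_boundary q f L x q0 fL df.
pose T := [seq val t | t : K.-tuple bool].
have TP s : size s = K -> s \in T by exact: mem_bitseqs.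
(* Values of [g] have finite support, so only the finitely many products occurring in [f] are
   treated. *)
pose X := undup [seq (br (δ s) * h)%g | s <- T, h <- msupp (f s)].
have XP s h : size s = K -> (f s)@_h != 0 -> (br (δ s) * h)%g \in X.
  move=> sK fh; rewrite mem_undup; apply/allpairsPdep; exists s, h.
  by rewrite TP // -mcoeff_neq0.
pose g u : {malg N[G]} := \sum_(x <- X)
  << flip (odd (size (δ u))) (H x u) *g ((br (δ u))^-1 * x)%g >>.
have gE u x : (g u)@_((br (δ u))^-1 * x)%g =
    if x \in X then flip (odd (size (δ u))) (H x u) else 0.
  rewrite raddf_sum /=.
  under eq_bigr => y _ do rewrite mcoeffU (inj_eq (mulgI _)) mulrb.
  case: ifP => xX.
    rewrite (bigD1_seq x) ?undup_uniq //= eqxx big1 ?addr0 // => y.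
    by move=> /negPf ->.
  rewrite big_seq big1 // => y yX.
  by case: eqP => // yx; rewrite yx xX in yX.
have gL s : size s = K -> forall h, (g s)@_h != 0 -> light L.+1 (size (δ s)) h.
  move=> sK h; rewrite -[h](mulKg (br (δ s))) gE.
  case: ifP => [_|_]; last by rewrite eqxx.
  rewrite flip_neq0; exact: (HP _).1.
have dd s : size s = K -> d (d g) s = 0.
  move=> sK.
  have := @salvettiK _ op K (@braid_op_far n E) (@braid_op_braid n E) 0 0 g s.
  by apply; rewrite sK.
(* The weight hypothesis ranges over all bitseqs, but the weight of [f - d g] is only controlled in
   degree [q]. *)
pose f' s := if count id s == q then f s - d g s else 0.
have [s sK h|s sK sq|g' g'P] := IH f'.
- rewrite /f'; case: ifP => [/eqP sq|_]; last by rewrite mcoeff0 eqxx.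
  move=> fh; apply: contrapT => hL; case/negP: fh; apply/eqP.
  rewrite -[h](mulKg (br (δ s))) in hL *; set x := (br (δ s) * h)%g in hL *.
  rewrite mcoeffB (@salvetti_top 0 0 g s x L 0) ?sK ?add0n //.
  have [xX|xX] := boolP (x \in X).
    rewrite (eq_in_simplex_boundary (F' := H x)) => [|u _]; last first.
      by rewrite gE xX flipK.
    by rewrite -(HP x).2 // flipK subrr.
  rewrite (eq_in_simplex_boundary (F' := fun=> 0)) => [|u _]; last first.
    by rewrite gE (negPf xX) flip0.
  rewrite simplex_boundary0 flip0 subr0; apply/eqP; apply: contraNT xX => fx.
  by have := XP s _ sK fx; rewrite mulVKg.
- transitivity (d (fun u => f u - d g u) s).
    by apply: eq_in_salvetti => u us uc; rewrite /f' uc sq eqxx.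
  by rewrite salvettiB dd // df // subr0.
exists (fun s => g s + g' s) => s sK sq.
by rewrite salvettiD -g'P // /f' sq eqxx addrC subrK.
Qed.

(** One power of the full twist clears the denominators of finitely many braids. *)
Lemma light_bound (T : eqType) (r : seq T) (D : T -> nat) (h : T -> G) :
  exists L m, forall p, p \in r -> light L (D p) (h p * br (twist_pow n m))%g.
Proof.
elim: r => [|p r [L [m H]]]; first by exists 0, 0.
have [m' [w [wK e]]] := braid_fraction (h p).
have twist_mono k L' D' g : light L' D' g ->
    light (L' + size (twist_pow n k)) D' (g * br (twist_pow n k))%g.
  move=> [v [vK <- vL]]; exists (v ++ twist_pow n k).
  by rewrite all_cat vK ok_twist_pow braid_of_cat size_cat; split=> //; lia.
exists (maxn (size w + D p).+1 L + size (twist_pow n m) + size (twist_pow n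
  m'))%N.
exists (m + m')%N => p'; rewrite inE => /predU1P[->|/H].
  rewrite [(m + m')%N]addnC twist_powD braid_of_cat mulgA e.
  have [] // := twist_mono m (size w + D p).+1 (D p) (br w).
    by exists w; split=> //; lia.
  by move=> v [vK ev vL]; exists v; split=> //; lia.
rewrite twist_powD braid_of_cat mulgA => /(twist_mono m'); apply: light_mono;
  lia.
Qed.

(** Right translation by a power of the full twist makes the finite support of [f] positive;
    translating the solution back is harmless. *)
Theorem free_salvetti_exact q (f : bitseq -> E) : (0 < q)%N ->
  (forall s, size s = K -> (count id s).+1 = q -> d f s = 0) ->
  exists g, forall s, size s = K -> count id s = q -> f s = d g s.
Proof.
move=> q0 df.
pose T := [seq val t | t : K.-tuple bool].
have TP s : size s = K -> s \in T by exact: mem_bitseqs.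
have [L [m Lm]] := light_bound [seq (s, h) | s <- T, h <- msupp (f s)]
  (fun p => size (δ p.1)) snd.
set z := br (twist_pow n m) in Lm.
have dz y g s : d (fun u => rtrans y (g u)) s = rtrans y (d g s).
  apply/esym/(salvetti_natural (phi := rtrans y)) => j c _.
  by rewrite /= /braid_op raddfN /= rtrans_ltrans.
have [//|s sK h|s sK sq|g gP] :=
  @free_salvetti_exact_light q (fun s => rtrans z (f s)) L.
- rewrite mcoeff_rtrans => fh.
  have /Lm /= : (s, (h * z^-1)%g) \in [seq (s, h) | s <- T, h <- msupp (f s)].
    by apply/allpairsPdep; exists s, (h * z^-1)%g; rewrite TP // -mcoeff_neq0.
  by rewrite mulgVK.
- by rewrite dz df ?raddf0.
exists (fun s => rtrans z^-1%g (g s)) => s sK sq.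
by rewrite dz -gP // rtransK.
Qed.
End FreeModule.

(** * Comparison with the bar complex *)

Section MalgMap.
Variables (I : choiceType) (M M' : zmodType) (phi : {additive M -> M'}).

Definition malg_map (c : {malg M[I]}) : {malg M'[I]} :=
  malg_ext (fun k m => << phi m *g k >>) c.

Lemma malg_mapB : zmod_morphism malg_map.
Proof. by apply: malg_ext_is_zmod_morphism => k x y;
  rewrite raddfB monalgUB. Qed.

HB.instance Definition _ :=
  GRing.isZmodMorphism.Build {malg M[I]} {malg M'[I]} malg_map malg_mapB.

Lemma malg_mapU k m : malg_map << m *g k >> = << phi m *g k >>.
Proof. by apply: malg_extU => l x y; rewrite raddfB monalgUB. Qed.

Lemma mcoeff_malg_map k c : (malg_map c)@_k = phi c@_k.
Proof.
rewrite [c]monalgE !raddf_sum /=; apply: eq_bigr => l _.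
by rewrite malg_mapU !mcoeffU raddfMn.
Qed.

End MalgMap.

Section MalgMalg.
Variables (I J : choiceType) (N A : zmodType).
Implicit Types f : {additive {malg {malg N[J]}[I]} -> A}.

Definition malg_single (k : I) (e : {malg N[J]}) : {malg {malg N[J]}[I]} :=
  << e *g k >>.

Lemma malg_singleB k : zmod_morphism (malg_single k).
Proof. by move=> x y; rewrite /malg_single monalgUB. Qed.

HB.instance Definition _ k :=
  GRing.isZmodMorphism.Build _ _ (malg_single k) (malg_singleB k).

Lemma malg_malg_eq f f' :
  (forall k l x, f << << x *g l >> *g k >> = f' << << x *g l >> *g k >>) ->
  f =1 f'.
Proof.
move=> ff'; apply: malg_eq => k e.
have E : f \o malg_single k =1 f' \o malg_single k.
  by apply: malg_eq => l x; exact: ff'.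
exact: E.
Qed.

End MalgMalg.

Lemma malg_map_lift (I : choiceType) (M M' : zmodType) (phi : {additive M ->
  M'})
    (c : {malg M'[I]}) :
  (forall k, exists m, phi m = c@_k) -> exists c', malg_map phi c' = c.
Proof.
move=> /choice[f fP]; exists (\sum_(k <- msupp c) << f k *g k >>).
rewrite [RHS]monalgE raddf_sum; apply: eq_bigr => k _ /=.
by rewrite malg_mapU fP.
Qed.

Section BarMap.
Variables (G : groupType) (M M' : gmodule G) (phi : {additive M -> M'}).
Hypothesis phiG : forall g m, phi (gact M g m) = gact M' g (phi m).

Definition bar_map i : bar_chain M i -> bar_chain M' i :=
  @malg_map {ffun 'I_i -> G} M M' phi.
HB.instance Definition _ i := GRing.Additive.on (@bar_map i).

Lemma bar_map_boundary i (c : bar_chain M i.+1) :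
  bar_map (bar_boundary c) = bar_boundary (bar_map c).
Proof.
have E : @bar_map i \o @bar_boundary G M i =1 @bar_boundary G M' i \o @bar_map
  i.+1.
  apply: malg_eq => t m /=; rewrite /bar_map malg_mapU !bar_boundaryU raddf_sum.
  apply: eq_bigr => j _ /=; rewrite (raddfMz (malg_map phi)) /= malg_mapU.
  suff -> : phi (bar_coef j t m) = bar_coef j t (phi m) by [].
  by rewrite /bar_coef; case: ifP => // _; rewrite phiG.
exact: E.
Qed.

End BarMap.

Definition bar_exact (G : groupType) (M : gmodule G) (i : nat) : Prop :=
  forall c : bar_chain M i, is_bar_cycle c ->
    exists b : bar_chain M i.+1, bar_boundary b = c.

Section FreeBar.
Variables (G : groupType) (N : zmodType).
Local Notation E := (free_gmodule G N).

Definition ffun_rcons i (t : {ffun 'I_i -> G}) (h : G) : {ffun 'I_i.+1 -> G} :=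
  [ffun k => if unlift ord_max k is Some k' then t k' else h].

Lemma ffun_rcons_lt i (t : {ffun 'I_i -> G}) h (k : 'I_i.+1) (k' : 'I_i) :
  val k = val k' -> ffun_rcons t h k = t k'.
Proof.
move=> e; rewrite ffunE; have -> : k = lift ord_max k'.
  by apply: val_inj; rewrite /= /bump leqNgt ltn_ord add0n.
by rewrite liftK.
Qed.

Lemma ffun_rcons_max i (t : {ffun 'I_i -> G}) h (k : 'I_i.+1) :
  val k = i -> ffun_rcons t h k = h.
Proof.
by move=> e; rewrite ffunE; have -> : k = ord_max by [exact: val_inj];
  rewrite unlift_none.
Qed.

Lemma bar_face_rcons_max i (t : {ffun 'I_i -> G}) h :
  bar_face ord_max (ffun_rcons t h) = t.
Proof.
apply/ffunP => k; rewrite ffunE /= ltnS ltn_ord.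
exact: ffun_rcons_lt.
Qed.

Lemma bar_face_rcons_pre i (t : {ffun 'I_i.+1 -> G}) h (j : 'I_i.+3) :
  val j = i.+1 -> bar_face j (ffun_rcons t h) =
  ffun_rcons (bar_face ord_max t) (t ord_max * h)%g.
Proof.
move=> ej; apply/ffunP => k; rewrite ffunE /= ej !ltnS eqSS.
have := ltn_ord k; rewrite ltnS leq_eqVlt => /orP[/eqP ki|ki].
  rewrite ki ltnn eqxx [RHS]ffun_rcons_max // (@ffun_rcons_lt _ t h _ ord_max)
    //.
  by rewrite ffun_rcons_max //= /bump /= add1n ki.
rewrite ki (@ffun_rcons_lt i (bar_face ord_max t) _ _ (Ordinal ki)) //
  [RHS]ffunE /=.
by rewrite !ltnS ki; apply: ffun_rcons_lt.
Qed.

Lemma bar_face_rcons i (t : {ffun 'I_i.+1 ->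
  G}) h (j : 'I_i.+3) (j' : 'I_i.+2) :
  val j = val j' -> (j' < i.+1)%N ->
  bar_face j (ffun_rcons t h) = ffun_rcons (bar_face j' t) h.
Proof.
move=> ej ji; apply/ffunP => k; rewrite ffunE /= ej.
have := ltn_ord k; rewrite ltnS leq_eqVlt => /orP[/eqP ki|ki].
  rewrite [RHS]ffun_rcons_max // ki ltnNge ltnW //= (gtn_eqF ji).
  by rewrite ffun_rcons_max //= /bump /= add1n ki.
rewrite (@ffun_rcons_lt i (bar_face j' t) _ _ (Ordinal ki)) // [RHS]ffunE /=.
rewrite (@ffun_rcons_lt _ t h _ (widen_ord (leqnSn i) (Ordinal ki))) //.
by rewrite (@ffun_rcons_lt _ t h _ (lift ord0 (Ordinal ki))).
Qed.

(* [[g_1|...|g_i] (x) (h (x) x)] is sent to [[g_1|...|g_i|h] (x) (1 (x) x)]. *)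
Definition bar_homotopy i : bar_chain E i -> bar_chain E i.+1 :=
  malg_ext (fun (t : {ffun 'I_i -> G}) (e : E) =>
    malg_ext (fun h x => << (<< x *g 1%g >> : E) *g ffun_rcons t h >>) e).

Let inner_additive i (t : {ffun 'I_i -> G}) h :
  zmod_morphism (fun x : N =>
    << (<< x *g 1%g >> : E) *g ffun_rcons t h >> : bar_chain E i.+1).
Proof. by move=> x y; rewrite monalgUB monalgUB. Qed.

Let outer_additive i (t : {ffun 'I_i -> G}) :
  zmod_morphism (malg_ext (fun h x =>
    << (<< x *g 1%g >> : E) *g ffun_rcons t h >> : bar_chain E i.+1)).
Proof. exact: malg_ext_is_zmod_morphism (inner_additive t). Qed.

Lemma bar_homotopyB i : zmod_morphism (@bar_homotopy i).
Proof. exact: malg_ext_is_zmod_morphism (@outer_additive i). Qed.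

HB.instance Definition _ i :=
  GRing.isZmodMorphism.Build (bar_chain E i) (bar_chain E i.+1)
    (@bar_homotopy i) (@bar_homotopyB i).

Lemma bar_homotopyU i (t : {ffun 'I_i -> G}) h x :
  bar_homotopy << (<< x *g h >> : E) *g t >> =
  << (<< x *g 1%g >> : E) *g ffun_rcons t h >>.
Proof.
by rewrite /bar_homotopy (malg_extU (@outer_additive i)) (malg_extU
  (inner_additive t)).
Qed.

(** The last face drops the appended [h] and lets it act, giving back [c]; the other faces are those
    of [c] followed by appending. *)
Lemma bar_homotopyP i (c : bar_chain E i.+1) :
  bar_boundary (bar_homotopy c) =
  bar_homotopy (bar_boundary c) + c *~ (-1) ^+ i.+2.
Proof.
pose R (c : bar_chain E i.+1) :=
  bar_homotopy (bar_boundary c) + c *~ (-1) ^+ i.+2.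
have RB : zmod_morphism R.
  by move=> x y; rewrite /R !raddfB /= mulrzBl opprD addrACA.
pose RM := GRing.isZmodMorphism.Build _ _ R RB.
pose Ra : {additive bar_chain E i.+1 -> bar_chain E i.+1} := HB.pack R RM.
have H : @bar_boundary G E i.+1 \o @bar_homotopy i.+1 =1 Ra.
  apply: malg_malg_eq => t h x /=; rewrite /R bar_homotopyU !bar_boundaryU.
  have E1 : bar_coef ord_max (ffun_rcons t h) (<< x *g 1%g >> : E) =
    << x *g h >>.
    by rewrite /bar_coef eqxx ffun_rcons_max //= ltransU mulg1.
  have E2 (j : 'I_i.+2) (jj := widen_ord (leqnSn i.+2) j) :
      << bar_coef jj (ffun_rcons t h) (<< x *g 1%g >> : E)
         *g bar_face jj (ffun_rcons t h) >> =
      bar_homotopy << bar_coef j t (<< x *g h >> : E) *g bar_face j t >>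
      :> bar_chain E i.+1.
    rewrite {1}/bar_coef ifF; last by apply/eqP => /(congr1 val) /=;
      have := ltn_ord j; lia.
    have [ji|ji] := ltnP j i.+1.
      rewrite (@bar_face_rcons _ t h jj j) // /bar_coef ifF ?bar_homotopyU //.
      by apply/eqP => ej; rewrite ej ltnn in ji.
    have -> : j = ord_max by apply: val_inj => /=; have := ltn_ord j; lia.
    rewrite bar_face_rcons_pre; last by rewrite /=; have := ltn_ord j; lia.
    by rewrite /bar_coef eqxx /= ltransU bar_homotopyU.
  rewrite big_ord_recr /= bar_face_rcons_max E1; congr (_ + _).
  rewrite raddf_sum; apply: eq_bigr => j _.
  by rewrite raddfMz /= E2.
exact: H.
Qed.

Lemma free_bar_exact i : bar_exact E i.+1.
Proof.
move=> c /eqP dc; exists (bar_homotopy c *~ (-1) ^+ i.+2).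
rewrite raddfMz /= bar_homotopyP dc raddf0 add0r -mulrzA -exprD.
by rewrite -signr_odd oddD addbb expr0 mulr1z.
Qed.

End FreeBar.

(** * Dimension shifting along the augmentation *)

Section KernelModule.
Variables (G : groupType) (A B : gmodule G) (phi : {additive A -> B}).
Hypothesis phiG : forall g x, phi (gact A g x) = gact B g (phi x).

Definition in_kernel (x : A) : bool := phi x == 0.

Lemma in_kernel_zmod : zmod_closed in_kernel.
Proof.
split=> [|x y]; rewrite !unfold_in /in_kernel; first by rewrite raddf0.
by move=> /eqP Ex /eqP Ey; rewrite raddfB /= Ex Ey subr0.
Qed.

HB.instance Definition _ := GRing.isZmodClosed.Build A in_kernel in_kernel_zmod.

Definition kernel : Type := {x : A | in_kernel x}.

HB.instance Definition _ := SubType.on kernel.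
HB.instance Definition _ := Choice.on kernel.
HB.instance Definition _ := [SubChoice_isSubZmodule of kernel by <:].

Lemma kernelP (x : kernel) : phi (val x) = 0.
Proof. exact/eqP/(valP x). Qed.

Lemma kernel_act_subproof g (x : kernel) : in_kernel (gact A g (val x)).
Proof. by rewrite /in_kernel phiG kernelP raddf0. Qed.

Definition kernel_act g (x : kernel) : kernel :=
  exist _ (gact A g (val x)) (kernel_act_subproof g x).

Lemma kernel_actB g : zmod_morphism (kernel_act g).
Proof. by move=> x y; apply: val_inj; rewrite /= !raddfB. Qed.

HB.instance Definition _ g :=
  GRing.isZmodMorphism.Build kernel kernel (kernel_act g) (kernel_actB g).

Lemma kernel_act1 x : kernel_act 1%g x = x.
Proof. by apply: val_inj; rewrite /= gact1. Qed.

Lemma kernel_actM g h x : kernel_act (g * h)%g x =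
  kernel_act g (kernel_act h x).
Proof. by apply: val_inj; rewrite /= gactM. Qed.

Definition kernel_gmodule : gmodule G := GModule kernel_act1 kernel_actM.

Definition kernel_val (x : kernel_gmodule) : A := val x.

Lemma kernel_valB : zmod_morphism kernel_val.
Proof. by move=> x y; exact: raddfB. Qed.

HB.instance Definition _ :=
  GRing.isZmodMorphism.Build kernel_gmodule A kernel_val kernel_valB.

Lemma kernel_val_act g x :
  kernel_val (gact kernel_gmodule g x) = gact A g (kernel_val x).
Proof. by []. Qed.

Lemma kernel_val_inj : injective kernel_val.
Proof. exact: val_inj. Qed.

Lemma kernel_lift (x : A) : phi x = 0 -> exists y, kernel_val y = x.
Proof. by move=> /eqP px; exists (exist _ x px). Qed.

Lemma phi_kernel_val x : phi (kernel_val x) = 0.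
Proof. exact: kernelP. Qed.

End KernelModule.

Section Augmentation.
Variables (G : groupType) (M : gmodule G).
Local Notation E := (free_gmodule G M).

Definition augment (e : E) : M := malg_ext (fun h x => gact M h x) e.

Lemma augmentB : zmod_morphism augment.
Proof. by apply: malg_ext_is_zmod_morphism => h x y; rewrite raddfB. Qed.

HB.instance Definition _ := GRing.isZmodMorphism.Build E M augment augmentB.

Lemma augmentU h x : augment << x *g h >> = gact M h x.
Proof. by apply: malg_extU => k y z; rewrite raddfB. Qed.

Lemma augment_act g e : augment (gact E g e) = gact M g (augment e).
Proof.
have H : augment \o gact E g =1 gact M g \o augment.
  by apply: malg_eq => h x /=; rewrite ltransU !augmentU gactM.
exact: H.
Qed.

Lemma augment_surj x : exists e, augment e = x.
Proof. by exists << x *g 1%g >>; rewrite augmentU gact1. Qed.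

End Augmentation.

(** For [q = 0] the cycle condition is empty, as in [is_bar_cycle]: every chain has to bound. *)
Definition salvetti_exact (N : zmodType) (t : nat -> {additive N ->
  N}) (K q : nat) :=
  forall f : bitseq -> N,
    (forall s, size s = K -> (count id s).+1 = q -> salvetti t 0 0 f s = 0) ->
    exists g, forall s, size s = K -> count id s = q ->
      f s = salvetti t 0 0 g s.

Section Comparison.
Variable n : nat.
Local Notation G := (braid_group n).
Local Notation K := n.-1.
Implicit Types M : gmodule G.

Lemma braid_op_equiv M M' (phi : {additive M -> M'}) :
  (forall g m, phi (gact M g m) = gact M' g (phi m)) ->
  forall f s,
  phi (salvetti (@braid_op n M) 0 0 f s) =
  salvetti (@braid_op n M') 0 0 (fun u => phi (f u)) s.
Proof.
move=> phiG f s; apply: (salvetti_natural (phi := phi)) => j x _.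
by rewrite /= /braid_op raddfN /= phiG.
Qed.

Lemma braid_salvettiK M f s : size s = K ->
  salvetti (@braid_op n M) 0 0 (salvetti (@braid_op n M) 0 0 f) s = 0.
Proof.
move=> sK.
have := @salvettiK _ _ K (@braid_op_far n M) (@braid_op_braid n M) 0 0 f s.
by apply; rewrite sK.
Qed.

(* In the sequence [0 -> N -> E -> M -> 0] the module [E] is acyclic for both
   complexes, which shifts exactness for [M] to exactness for [N]. *)
Section KernelOfAugmentation.
Variable M : gmodule G.
Local Notation E := (free_gmodule G M).
Local Notation N := (kernel_gmodule (@augment_act G M)).
Local Notation iota_N := (@kernel_val _ _ _ _ (@augment_act G M)).

(** The image of [g] in [M] is a cycle, hence bounds, and a lift of the bounding chain corrects [g]
    into [N]. Since [g] is given, degree 0 is covered, where [E] need not be exact. *)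
Lemma kernel_salvetti_bounds q (f : bitseq -> N) (g : bitseq -> E) :
  salvetti_exact (@braid_op n M) K q.+1 ->
  (forall s, size s = K -> count id s = q ->
     iota_N (f s) = salvetti (@braid_op n E) 0 0 g s) ->
  exists g', forall s, size s = K -> count id s = q ->
     f s = salvetti (@braid_op n N) 0 0 g' s.
Proof.
move=> exM fg.
have [s sK [sq]|h hP] := exM (fun u => augment (g u)).
  rewrite -(braid_op_equiv (@augment_act G M)) -fg //.
  exact: phi_kernel_val.
have /choice[h' h'P] := fun u => augment_surj (h u).
pose g1 u := g u - salvetti (@braid_op n E) 0 0 h' u.
have /choice[g' g'P] : forall u, exists y, size u = K -> count id u = q.+1 ->
    iota_N y = g1 u.
  move=> u; have [[uK uq]|no] := pselect (size u = K /\ count id u = q.+1);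
    last first.
    by exists 0 => uK uq; case: no.
  have [|y yP] := @kernel_lift _ _ _ _ (@augment_act G M) (g1 u);
    last by exists y.
  rewrite raddfB /= hP // (braid_op_equiv (@augment_act G M)).
  apply/eqP; rewrite subr_eq0; apply/eqP.
  by apply: eq_salvetti => v; exact: esym (h'P v).
exists g' => s sK sq; apply: (@kernel_val_inj _ _ _ _ (@augment_act G M)).
rewrite (braid_op_equiv (@kernel_val_act _ _ _ _ (@augment_act G M))).
rewrite (@eq_in_salvetti _ _ 0 0 _ g1) => [|u us uc]; last first.
  by apply: g'P; rewrite ?us // uc sq.
by rewrite salvettiB braid_salvettiK // subr0 fg.
Qed.

Lemma kernel_salvetti_exact q :
  salvetti_exact (@braid_op n M) K q.+2 ->
    salvetti_exact (@braid_op n N) K q.+1.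
Proof.
move=> exM f df.
have [//|s sK sq|g gP] := @free_salvetti_exact n M q.+1 (fun u => iota_N (f u)).
  rewrite -(braid_op_equiv (@kernel_val_act _ _ _ _ (@augment_act G M))) df //.
exact: (kernel_salvetti_bounds exM gP).
Qed.

(** Asking [c] to bound in [E] is kept as a premise for the same reason: for [i = 0] it is not
    automatic. *)
Lemma kernel_bar_bounds i :
  (forall c : bar_chain N i, is_bar_cycle c ->
     (exists b, bar_boundary b = bar_map iota_N c) ->
     exists b, bar_boundary b = c) ->
  bar_exact M i.+1.
Proof.
move=> H c /eqP dc.
have [c1 c1P] : exists c1 : bar_chain E i.+1, bar_map (@augment G M) c1 = c.
  by apply: malg_map_lift => t; exact: augment_surj.
have [y yP] : exists y : bar_chain N i, bar_map iota_N y = bar_boundary c1.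
  apply: malg_map_lift => t; apply: kernel_lift.
  rewrite -[LHS]mcoeff_malg_map -[malg_map _ _]/(bar_map (@augment G M) _).
  by rewrite (bar_map_boundary (@augment_act G M)) c1P dc mcoeff0.
have map_inj j : injective (@bar_map _ _ _ iota_N j).
  move=> a b /malgP ab; apply/malgP => t.
  apply: (@kernel_val_inj _ _ _ _ (@augment_act G M)).
  by have := ab t; rewrite !mcoeff_malg_map.
have natN := @kernel_val_act _ _ _ _ (@augment_act G M).
have [||e eP] := H y.
- case: i c dc c1 c1P y yP {H} => [//|i] c dc c1 c1P y yP.
  apply/eqP/map_inj; rewrite (bar_map_boundary natN) yP bar_boundary_boundary.
  by rewrite raddf0.
- by exists c1.
have [|b bP] := @free_bar_exact G M i (c1 - bar_map iota_N e).
  by apply/eqP; rewrite raddfB /= -yP -(bar_map_boundary natN) eP subrr.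
exists (bar_map (@augment G M) b).
rewrite -(bar_map_boundary (@augment_act G M)) bP raddfB /= c1P.
suff -> : bar_map (@augment G M) (bar_map iota_N e) = 0 by rewrite subr0.
apply/malgP => t; rewrite mcoeff0 !mcoeff_malg_map; exact: phi_kernel_val.
Qed.

End KernelOfAugmentation.

(** * Degree zero: coinvariants in both complexes *)

Section Degree0.
Variable M : gmodule G.

Lemma sgen_relation_salvetti (m : M) (i : nat) : (i < K)%N ->
  exists g, m - gact M (sgen n i) m =
    salvetti (@braid_op n M) 0 0 g (nseq K false).
Proof.
suff H k o : (i < k)%N -> exists g,
    m + @braid_op n M (o + i) m = salvetti (@braid_op n M) o 0 g (nseq k false).
  by move=> iK; have [g gP] := H _ 0 iK; exists g; rewrite -gP.
elim: k i o => [|k IH] [|i] o ik //=.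
  exists (fun u => if head false u then m else 0) => /=.
  rewrite salvetti0 addr0.
  have -> : lead (nseq k false) = 0 by case: k {IH ik}.
  by rewrite shuffleS shuffle0l shuffle0 /= addn0.
have [g gP] := IH i o.+1 ik.
exists (fun u => if head false u then 0 else g (behead u)) => /=.
by rewrite raddf0 add0r addn1 -gP addSnnS.
Qed.

(** The relation for [g] telescopes along a word for [g]; an inverse letter gives the relation of
    its generator at another vector, up to sign. *)
Lemma coinvariant_salvetti (m : M) : coinvariant_relation m ->
  exists g, m = salvetti (@braid_op n M) 0 0 g (nseq K false).
Proof.
pose P (x : M) := exists g, x = salvetti (@braid_op n M) 0 0 g (nseq K false).
have P0 : P 0 by exists (fun=> 0); rewrite salvetti0.
have PB x y : P x -> P y -> P (x - y).
  by move=> [g ->] [g' ->]; exists (fun u => g u - g' u); rewrite salvettiB.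
have PN x y : P (x - y) -> P (y - x).
  by move=> xy; rewrite -opprB -sub0r; apply: PB.
elim=> {m} [//|m m' _ Pm _ Pm'|g m]; first exact: PB.
rewrite -[g]presented_reprK; elim: (presented_repr g) => [|[x b] w IH] in m *.
  by rewrite -[presented_pi _ [::]]/(1%g : G) gact1 subrr.
rewrite -cat1s presented_pi_mul gactM; set m' := gact M _ m.
set y := gact M _ m'; have -> : y - m = (y - m') - (m - m').
  by rewrite opprB addrA subrK.
apply: PB; last exact/PN/IH.
have Pgen z : P (z - gact M (sgen n x) z).
  exact: sgen_relation_salvetti (ltn_ord x).
rewrite /y; case: b {y}; first by rewrite -[presented_pi _ _]/(sigma x) -sgenE;
  apply: PN.
set y := gact M _ m'; have -> : m' = gact M (sgen n x) y; last exact: Pgen.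
rewrite /y -gactM sgenE -[sigma x]/(presented_pi (@braid_relation n) [:: (x,
  true)]).
rewrite -presented_pi_mul (_ : presented_pi _ _ = 1%g) ?gact1 //.
exact/presented_piP/(WordCancel _ x true).
Qed.

Lemma salvetti_coinvariant (g : bitseq -> M) :
  coinvariant_relation (salvetti (@braid_op n M) 0 0 g (nseq K false)).
Proof.
have C0 : coinvariant_relation (0 : M) by exact: CoinvRel0.
have CN (m : M) : coinvariant_relation m -> coinvariant_relation (- m).
  by move=> Cm; rewrite -sub0r; exact: CoinvRelB C0 Cm.
suff H k o f : coinvariant_relation (salvetti (@braid_op n M) o 0 f (nseq k
  false)).
  exact: H.
elim: k o f => [|k IH] o f //=.
rewrite -[X in _ + X]opprK; apply: CoinvRelB; last exact/CN/IH.
have -> : lead (nseq k false) = 0 by case: k {IH}.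
rewrite shuffleS shuffle0l shuffle0 /= addn0 /braid_op.
by rewrite -opprB; apply/CN/CoinvRelG.
Qed.

Let pt : {ffun 'I_0 -> G} := [ffun=> 1%g].

Let ptE (t : {ffun 'I_0 -> G}) : t = pt.
Proof. by apply/ffunP => -[]. Qed.

Lemma bar_boundary1 (t : {ffun 'I_1 -> G}) (m : M) :
  bar_boundary (<< m *g t >> : bar_chain M 1) =
  << m - gact M (t ord_max) m *g pt >>.
Proof.
rewrite bar_boundaryU !big_ord_recl big_ord0 addr0 !(ptE (bar_face _ _)).
by rewrite /bar_coef /= expr0 expr1 mulr1z mulrN1z monalgUB.
Qed.

Lemma bar0_salvetti (c : bar_chain M 0) :
  (exists b, bar_boundary b = c) <->
  (exists g, c@_pt = salvetti (@braid_op n M) 0 0 g (nseq K false)).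
Proof.
have cE : c = << c@_pt *g pt >> by apply/malgP => t; rewrite (ptE t) mcoeffUU.
split=> [[b <-]|[g Eg]].
  apply: coinvariant_salvetti; rewrite [b]monalgE !raddf_sum /=.
  elim/big_ind: _ => [||t _]; first exact: CoinvRel0.
    move=> x y Cx Cy; rewrite -[y]opprK; apply: CoinvRelB => //.
    by rewrite -sub0r; apply: CoinvRelB => //; exact: CoinvRel0.
  rewrite bar_boundary1 mcoeffUU -opprB -sub0r.
  by apply: CoinvRelB; [exact: CoinvRel0|exact: CoinvRelG].
rewrite cE Eg; elim: (salvetti_coinvariant g) => [|m m' _ [b Eb] _ [b' Eb']|h
  m].
- by exists 0; rewrite raddf0 monalgU0.
- by exists (b - b'); rewrite raddfB /= Eb Eb' -monalgUB.
- exists << - m *g [ffun=> h] >>.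
  by rewrite bar_boundary1 ffunE raddfN opprK addrC.
Qed.

End Degree0.

(** Induction over all modules at once, passing to the kernel of the augmentation. Degree 1 is
    separate: it leads to degree 0 of the kernel, where only chains bounding in the free module are
    known to bound. *)
Lemma salvetti_bar_exact i M :
  salvetti_exact (@braid_op n M) K i -> bar_exact M i.
Proof.
have nseqP s : size s = K -> count id s = 0 -> s = nseq K false.
  by move=> <-; exact: count0_nseq.
have c0 : count id (nseq K false) = 0 by rewrite count_nseq.
elim: i M => [|i IH] M exM.
  move=> c _; apply/bar0_salvetti.
  have [s|g gP] := exM (fun=> c@_[ffun=> 1%g]); first by [].
  by exists g; rewrite -gP ?size_nseq.
apply: kernel_bar_bounds; case: i IH exM => [|i] IH exM c dc [b bP].
  apply/bar0_salvetti.
  have /bar0_salvetti[g gP] := ex_intro (fun b => bar_boundary b = _) b bP.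
  have [s sK s0|g' g'P] :=
    @kernel_salvetti_bounds M 0 (fun=> c@_[ffun=> 1%g]) g exM.
    by rewrite (nseqP s sK s0) -gP mcoeff_malg_map.
  by exists g'; rewrite -g'P ?size_nseq.
apply: IH dc; exact: kernel_salvetti_exact.
Qed.

End Comparison.

(** * Tensor products *)

Section Functionals.
Variables (K : fieldType) (V : lmodType K).

(** Membership of 0 is not demanded, so that the empty union qualifies for Zorn's lemma; a maximal
    set contains 0 anyway. *)
Let closed (A : set V) : Prop := forall a x y, A x -> A y -> A (a *: x + y).

(** A subspace maximal among those avoiding [v] is a complement of the line of [v], and [psi] is the
    coordinate along this line. *)
Lemma exists_functional (v : V) : v != 0 -> exists psi : {linear V ->
  K^o}, psi v = 1.
Proof.
move=> v0; pose P (A : set V) := closed A /\ ~ A v.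
have [F FP Ftot|A [[Acl Av] Amax]] := @Zorn_bigcup V P.
  split=> [a x y [X FX Xx] [Y FY Yy]|[X FX Xv]]; last by case: (FP _ FX).
  have [XY|YX] := Ftot _ _ FX FY.
    by exists Y => //; apply: (FP _ FY).1 => //; apply: XY.
  by exists X => //; apply: (FP _ FX).1 => //; apply: YX.
have A0 : A 0.
  apply: contrapT => nA0; have Ae x : ~ A x.
    by move=> Ax; apply: nA0; have := Acl (-1) x x Ax Ax;
      rewrite scaleN1r addNr.
  apply: (Amax (fun x : V => x = 0)).
    by split=> [x /Ae//|/(_ 0 erefl)/Ae].
  split=> [a x y -> ->|/eqP]; first by rewrite scaler0 addr0.
  by rewrite (negPf v0).
have AZ a x : A x -> A (a *: x) by move=> Ax; rewrite -[_ *: x]addr0;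
  apply: Acl.
have AD x y : A x -> A y -> A (x + y) by move=> Ax Ay; rewrite -[x]scale1r;
  apply: Acl.
have AN x : A x -> A (- x) by move=> Ax; rewrite -scaleN1r; apply: AZ.
have ex u : exists a : K^o, A (u - a *: v).
  have [Au|nAu] := pselect (A u); first by exists 0; rewrite scale0r subr0.
  pose B : set V := fun x => exists a y, A y /\ x = a *: u + y.
  have Bcl : closed B.
    move=> a _ _ [b [y [Ay ->]]] [c [z [Az ->]]].
    exists (a * b + c), (a *: y + z); split; first exact: Acl.
    by rewrite scalerDr scalerA addrACA -scalerDl.
  have [a [y [Ay vE]]] : B v.
    apply: contrapT => nBv; apply: (Amax B) => //; split=> [x Ax|/(_ u) BA].
      by exists 0, x; rewrite scale0r add0r.
    by apply/nAu/BA; exists 1, 0; rewrite scale1r addr0.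
  have a0 : a != 0.
    by apply/eqP => a0; apply: Av; rewrite vE a0 scale0r add0r.
  exists a^-1; rewrite vE scalerDr scalerA mulVf // scale1r opprD addrA subrr
    sub0r.
  exact/AN/AZ.
have /choice[psi psiP] := ex.
have uniq u a : A (u - a *: v) -> psi u = a.
  move=> Aua; apply/eqP; rewrite -subr_eq0; apply/negPn/negP => nz; apply: Av.
  rewrite -[v](scalerK nz); apply: AZ; rewrite scalerBl.
  have := AD _ _ Aua (AN _ (psiP u)).
  by rewrite opprB addrC addrA subrK.
have psi_lin : linear (psi : V -> K^o).
  move=> a x y; apply: uniq.
  rewrite scalerDl -scalerA opprD addrACA -scalerBr; exact: Acl.
pose psiM := GRing.isLinear.Build K V K^o _ (psi : V -> K^o) psi_lin.
pose psiL : {linear V -> K^o} := HB.pack (psi : V -> K^o) psiM.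
by exists psiL; apply: uniq; rewrite scale1r subrr.
Qed.

End Functionals.

Section TensorDecomposition.
Variables (K : fieldType) (V : lmodType K).
Implicit Types (W : lmodType K) (es : seq (V * {linear V -> K^o})).

Definition expand es (x : V) : V := \sum_(p <- es) (p.2 x : K) *: p.1.

Lemma expand_is_linear es : linear (expand es).
Proof.
move=> a x y; rewrite /expand scaler_sumr -big_split; apply: eq_bigr => p _ /=.
by rewrite linearP scalerDl scalerA.
Qed.

HB.instance Definition _ es := GRing.isLinear.Build K V V _ (expand es)
  (expand_is_linear es).

(** A finite-rank projection whose image contains [vs], in place of a basis of [V]. Idempotence
    drives the induction: the new functional vanishes on the previous image. *)
Lemma exists_expand (vs : seq V) :
  exists es, (forall x, expand es (expand es x) = expand es x) /\
    (forall v, v \in vs -> expand es v = v).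
Proof.
elim: vs => [|v vs [es [idem fix_vs]]].
  by exists [::]; split=> // x; rewrite /expand !big_nil.
have [v0|v1] := eqVneq (v - expand es v) 0.
  exists es; split=> // u; rewrite inE => /predU1P[->|/fix_vs//].
  exact/esym/subr0_eq.
set v' := v - expand es v in v1.
have [psi0 psi0v] := exists_functional v1.
pose psi (x : V) : K^o := psi0 (x - expand es x).
have psi_lin : linear psi.
  by move=> a x y; rewrite /psi linearP opprD addrACA -scalerBr linearP.
pose psiM := GRing.isLinear.Build K V K^o _ psi psi_lin.
pose psiL : {linear V -> K^o} := HB.pack psi psiM.
have expandE x : expand ((v', psiL) :: es) x = (psi x : K) *: v' + expand es x.
  by rewrite /expand big_cons.
have ev' : expand es v' = 0 by rewrite /v' linearB /= idem subrr.
have psiv' : psi v' = 1 by rewrite /psi ev' subr0.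
have psie x : psi (expand es x) = 0 by rewrite /psi idem subrr linear0.
exists ((v', psiL) :: es); split=> [x|u].
  rewrite !expandE linearP /= ev' scaler0 add0r idem; congr (_ *: _ + _).
  by rewrite psi_lin psiv' psie addr0; exact: mulr1.
rewrite inE expandE => /predU1P[->|uvs]; last first.
  by rewrite /psi fix_vs // subrr linear0 scale0r add0r.
by rewrite /psi psi0v scale1r subrK.
Qed.

Section Contract.
Variables (W : lmodType K) (psi : {linear V -> K^o}).

Definition contract_pure (v : V) (y : W) : W := (psi v : K) *: y.

Lemma contract_pure_is_bilinear :
  (forall w, linear (contract_pure^~ w)) * (forall u, linear (contract_pure u)).
Proof.
split=> [w a u u'|u a w w'] /=; rewrite /contract_pure.
  by rewrite linearP scalerDl scalerA.
by rewrite scalerDr !scalerA mulrC.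
Qed.

HB.instance Definition _ :=
  bilinear_isBilinear.Build K V W W *:%R *:%R contract_pure
    contract_pure_is_bilinear.

Definition contract : {linear tensor V W -> W} := tensor_lift contract_pure.

Lemma contractE v y : contract (v ⊗ y) = (psi v : K) *: y.
Proof. exact: (tensor_liftE contract_pure). Qed.

End Contract.

Lemma contract_natural W W' psi (g : {linear W -> W'}) t :
  contract W' psi (tensor_idl V g t) = g (contract W psi t).
Proof.
have E : contract W' psi \o tensor_idl V g =1 g \o contract W psi.
  by apply: tensor_eq => v y /=; rewrite tensor_idlE !contractE linearZ.
exact: E.
Qed.

(** One family [es] serves all the tensors, so that the coefficients of a chain are obtained by
    applying fixed linear maps to it. *)
Lemma tensor_expand W (ts : seq (tensor V W)) :
  exists es, forall t, t \in ts ->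
    t = \sum_(p <- es) p.1 ⊗ contract W p.2 t.
Proof.
suff [vs vsP] : exists vs : seq V, forall es, (forall v, v \in vs ->
  expand es v = v) ->
    forall t, t \in ts -> t = \sum_(p <- es) p.1 ⊗ contract W p.2 t.
  by have [es [_ esP]] := exists_expand vs; exists es; apply: vsP.
elim: ts => [|t ts [vs vsP]]; first by exists [::].
suff [vs' vs'P] : exists vs : seq V, forall es,
    (forall v, v \in vs -> expand es v = v) ->
      t = \sum_(p <- es) p.1 ⊗ contract W p.2 t.
  exists (vs' ++ vs) => es esP t'; rewrite inE => /predU1P[->|t'ts].
    by apply: vs'P => v vv; apply: esP; rewrite mem_cat vv.
  by apply: vsP t'ts => v vv; apply: esP; rewrite mem_cat vv orbT.
elim/tensor_ind: t => [|a x y [vx xP] [vy yP]|v y].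
- exists [::] => es _; rewrite big1 // => p _.
  by rewrite linear0; exact: (linear0 (pure_tensorl p.1)).
- exists (vx ++ vy) => es esP.
  rewrite {1}(xP es) => [|v vv]; last by apply: esP; rewrite mem_cat vv.
  rewrite {1}(yP es) => [|v vv]; last by apply: esP; rewrite mem_cat vv orbT.
  rewrite scaler_sumr -big_split; apply: eq_bigr => p _ /=.
  rewrite linearP; exact: esym (linearP (pure_tensorl p.1) _ _ _).
exists [:: v] => es esP; rewrite -{1}(esP v) ?mem_head //.
rewrite -[LHS]/(pure_tensorr y (expand es v)) linear_sum;
  apply: eq_bigr => p _ /=.
rewrite contractE linearZ.
by rewrite -[RHS]/(pure_tensorl p.1 _) linearZ.
Qed.

Definition neg_op W (t : nat -> {linear W ->
  W}) (i : nat) (x : W) : W := - t i x.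

Lemma neg_opB W (t : nat -> {linear W -> W}) i : zmod_morphism (neg_op t i).
Proof. by move=> x y; rewrite /neg_op linearB opprD. Qed.

HB.instance Definition _ W (t : nat -> {linear W -> W}) i :=
  GRing.isZmodMorphism.Build W W (neg_op t i) (neg_opB t i).

Lemma contract_salvetti W (t : nat -> {linear W -> W}) psi f s :
  contract W psi (salvetti (neg_op (fun i => tensor_idl V (t i))) 0 0 f s) =
  salvetti (neg_op t) 0 0 (fun u => contract W psi (f u)) s.
Proof.
apply: (salvetti_natural (phi := contract W psi)) => j x _.
by rewrite /= /neg_op raddfN /= contract_natural.
Qed.

Lemma pure_salvetti W (t : nat -> {linear W -> W}) v f s :
  v ⊗ salvetti (neg_op t) 0 0 f s =
  salvetti (neg_op (fun i => tensor_idl V (t i))) 0 0 (fun u => v ⊗ f u) s.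
Proof.
apply: (salvetti_natural (phi := pure_tensorl v)) => j x _.
by rewrite /= /neg_op raddfN /= tensor_idlE.
Qed.

(** The coefficients are contractions of [f]; contractions commute with the differential and so
    preserve cycles. *)
Lemma tensor_salvetti_cycle W (t : nat -> {linear W -> W}) k q
    (f : bitseq -> tensor V W) :
  (forall s, size s = k -> (count id s).+1 = q ->
     salvetti (neg_op (fun i => tensor_idl V (t i))) 0 0 f s = 0) ->
  exists (es : seq (V * (bitseq -> W))),
    (forall p, List.In p es -> forall s, size s = k -> (count id s).+1 = q ->
       salvetti (neg_op t) 0 0 p.2 s = 0) /\
    (forall s, size s = k -> f s = \sum_(p <- es) p.1 ⊗ p.2 s).
Proof.
move=> df.
have [es esP] := tensor_expand [seq f (val u) | u : k.-tuple bool].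
exists [seq (p.1, fun s => contract W p.2 (f s)) | p <- es]; split.
  move=> p /List.in_map_iff[[e psi] [<- _]] s sk sq /=.
  by rewrite -contract_salvetti df // linear0.
move=> s sk; rewrite big_map /= {1}(esP (f s)) //.
have /mapP[u uP ->] := mem_bitseqs sk.
by apply/mapP; exists u.
Qed.

Lemma tensor_salvetti_exact W (t : nat -> {linear W -> W}) k q :
  salvetti_exact (neg_op t) k q ->
  salvetti_exact (neg_op (fun i => tensor_idl V (t i))) k q.
Proof.
move=> ex f /tensor_salvetti_cycle[es [es0 fE]].
have {es0} [g gP] : exists g, forall s, size s = k -> count id s = q ->
    \sum_(p <- es) p.1 ⊗ p.2 s =
    salvetti (neg_op (fun i => tensor_idl V (t i))) 0 0 g s.
  elim: es {fE} es0 => [|p es IH] es0.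
    by exists (fun=> 0) => s _ _; rewrite big_nil salvetti0.
  have [|g gP] := IH; first by move=> p' p'es; apply: es0; right.
  have [h hP] := ex p.2 (es0 p (or_introl (erefl _))).
  exists (fun u => p.1 ⊗ h u + g u) => s sk sq.
  by rewrite big_cons salvettiD -gP // -pure_salvetti hP.
by exists g => s sk sq; rewrite fE // gP.
Qed.

End TensorDecomposition.

(** * Tensor powers of a braided vector space *)

Lemma flip_negb (N : zmodType) b (x : N) : flip (~~ b) x = - flip b x.
Proof. by case: b; rewrite /flip ?opprK. Qed.

Lemma lead_count s : (lead s <= count id s)%N.
Proof. by elim: s => [|[] s IH]. Qed.

Lemma leadP r s : (r <= lead s)%N -> s = nseq r true ++ drop r s.
Proof.
by elim: r s => [|r IH] [|[] s] //= rs; rewrite {1}(IH s).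
Qed.

Lemma lead_nseq r s : lead (nseq r true ++ s) = (r + lead s)%N.
Proof. by elim: r => [|r IH] //=; rewrite IH. Qed.

Lemma lead_ltP r s : (lead s < r)%N -> (lead s < size s)%N ->
  s = rcons (nseq (lead s) true) false ++ drop (lead s).+1 s.
Proof.
by elim: s r => [|[] s IH] [|r] //= sr ss; rewrite ?drop0 // -(IH r).
Qed.

Lemma lead_above s u : all2 implb s u -> (lead s <= lead u)%N.
Proof. by elim: s u => [|[] s IH] [|[] u] //=; apply: IH. Qed.

Lemma count_size_nseq (v : bitseq) : count id v = size v ->
  v = nseq (size v) true.
Proof.
move=> /eqP; rewrite -all_count => vT; apply/all_pred1P.
by apply: sub_all vT => b ->.
Qed.

Lemma take_above k s u : all2 implb s u ->
  take k u = nseq k false -> take k s = nseq k false.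
Proof.
elim: k s u => [|k IH] [|b s] [|b' u] //= /andP[bb' su] [e /(IH _ _ su) ->].
by case: b b' bb' e => [] [].
Qed.

(** * Clearing the first parts of a composition *)

Section Prefix.
Variables (N : zmodType) (t : nat -> {additive N -> N}).

Lemma salvetti_eq0_above o a f s :
  (forall u, size u = size s -> all2 implb s u -> f u = 0) ->
  salvetti t o a f s = 0.
Proof.
have refl s' : all2 implb s' s' by elim: s' => [|[]].
elim: s o a f => [|[] s IH] o a f H //=.
  by rewrite IH ?oppr0 // => u us su; apply: H; rewrite /= ?us.
rewrite H ?raddf0 ?add0r //=.
by rewrite IH // => u us su; apply: H; rewrite /= ?us.
Qed.

Lemma salvetti_prefix p s f o a :
  (forall v, size v = (size p).+1 -> v <> rcons p false ->
     count id v = (count id p).+1 -> f (v ++ s) = 0) ->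
  salvetti t o a f (rcons p false ++ s) =
  flip (odd (count id p))
    (salvetti t (o + a + (size p).+1) 0 (fun u => f (rcons p false ++ u)) s).
Proof.
elim: p f o a => [|[] p IH] f o a H /=.
- by rewrite (H [:: true]) // raddf0 add0r addnS addn1.
- rewrite IH => [|v vp vne vc]; last first.
    by apply: (H (true :: v)) => /=; rewrite ?vp ?vc // => -[/vne].
  by rewrite -flip_negb (addnS o) addSnnS.
- rewrite (H (true :: rcons p false)) ?raddf0 ?add0r; first last.
  + by rewrite /= -cats1 count_cat /=; lia.
  + by [].
  + by rewrite /= size_rcons.
  rewrite IH => [|v vp vne vc]; last first.
    by apply: (H (false :: v)) => /=; rewrite ?vp // => -[/vne].
  by rewrite addn0 (addnS o) addSnnS.
Qed.

Lemma salvetti_prefix_false k s f :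
  (forall v, size v = k -> v <> nseq k false -> count id v = 1 ->
    f (v ++ s) = 0) ->
  salvetti t 0 0 f (nseq k false ++ s) =
  salvetti t k 0 (fun u => f (nseq k false ++ u)) s.
Proof.
case: k => [//|k] Hf.
have E : nseq k.+1 false = rcons (nseq k false) false.
  by elim: k {Hf} => //= k {1}->.
rewrite E in Hf *.
by rewrite salvetti_prefix ?size_nseq ?count_nseq.
Qed.

(** The sign is chosen to cancel that of [salvetti_prefix]. *)
Definition extend (p : bitseq) (y : bitseq -> N) (s : bitseq) : N :=
  if take (size p).+1 s == rcons p false
  then flip (odd (count id p)) (y (drop (size p).+1 s)) else 0.

Lemma extendE p y s : extend p y (rcons p false ++ s) =
  flip (odd (count id p)) (y s).
Proof.
by rewrite /extend -(size_rcons p false) take_size_cat // drop_size_cat // eqxx.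
Qed.

Lemma extend_neq p y v u : size v = (size p).+1 -> v <> rcons p false ->
  extend p y (v ++ u) = 0.
Proof. by move=> vp /eqP/negPf vne; rewrite /extend take_size_cat // vne. Qed.

Lemma salvetti_flip o a b f s :
  salvetti t o a (fun u => flip b (f u)) s = flip b (salvetti t o a f s).
Proof. by case: b => //=; rewrite salvettiN. Qed.

Lemma salvetti_extend p y s :
  salvetti t 0 0 (extend p y) (rcons p false ++ s) =
    salvetti t (size p).+1 0 y s.
Proof.
rewrite salvetti_prefix => [|v vp vne vc]; last exact: extend_neq.
rewrite addn0 add0n.
rewrite (eq_salvetti _ _ _ _ (g := fun u => flip (odd (count id p)) (y u))).
  by rewrite salvetti_flip flipK.
by move=> u; apply: extendE.
Qed.

End Prefix.

Section KillHead.
Variables (N : zmodType) (t : nat -> {additive N -> N}) (K q : nat).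
Hypothesis tK : forall f s, size s = K ->
  salvetti t 0 0 (salvetti t 0 0 f) s = 0.
Hypothesis qK : (q < K)%N.
Hypothesis ex : forall p, (0 < p <= q)%N ->
  salvetti_exact (fun i => t (p.+1 + i)) (K - p.+1) (q - p).

(* The chains whose first part has [p.+1] strands form the subquotient controlled
   by [ex p]; these are cleared for decreasing [p]. *)
Lemma kill_head f :
  (forall s, size s = K -> (count id s).+1 = q -> salvetti t 0 0 f s = 0) ->
  exists g, forall s, size s = K -> count id s = q -> head false s ->
    f s = salvetti t 0 0 g s.
Proof.
move=> df.
suff [g gP] : exists g, forall s, size s = K -> count id s = q ->
  (0 < lead s)%N ->
    f s = salvetti t 0 0 g s.
  by exists g => s sK sq sh; apply: gP => //; case: s {sK sq} sh => [|[]].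
have lead_count s : (lead s <= count id s)%N by elim: s => [|[] s IH].
suff H r : (r <= q)%N -> exists g, forall s, size s = K -> count id s = q ->
    (q - r < lead s)%N -> f s = salvetti t 0 0 g s.
  have [g gP] := H q (leqnn q); exists g => s sK sq sl.
  by apply: gP; rewrite ?subnn.
elim: r => [|r IH] rq.
  by exists (fun=> 0) => s sK <-; rewrite subn0 ltnNge lead_count.
have [g gP] := IH (ltnW rq).
set p := (q - r)%N in gP.
have p0 : (0 < p <= q)%N by rewrite /p; lia.
have -> : (q - r.+1 = p.-1)%N by rewrite /p; lia.
pose f1 u := f u - salvetti t 0 0 g u.
have f1_0 s : size s = K -> count id s = q -> (p < lead s)%N -> f1 s = 0.
  by move=> sK sq sp; rewrite /f1 gP // subrr.
pose pre := nseq p true.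
have pre_c : count id pre = p by rewrite count_nseq mul1n.
pose z u := f1 (rcons pre false ++ u).
have shift F s : salvetti (fun i => t (p.+1 + i)) 0 0 F s =
  salvetti t p.+1 0 F s.
  by apply: (salvetti_natural (phi := idfun)) => j x _; rewrite add0n.
have [s sK sq|y yP] := @ex p p0 z.
  rewrite shift; apply: (can_inj (flipK (odd (count id pre)))).
  have [presK presq] : size (rcons pre false ++ s) = K /\
      (count id (rcons pre false ++ s)).+1 = q.
    rewrite size_cat size_rcons size_nseq sK -cats1 !count_cat pre_c /=.
    by move: sq; split; lia.
  have := @salvetti_prefix _ t pre s f1 0 0; rewrite size_nseq => <-.
    by rewrite salvettiB df // tK // subr0 flip0.
  move=> v vp _; rewrite pre_c => vc.
  have vE : v = nseq p.+1 true by rewrite -vp; apply: count_size_nseq;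
    rewrite vp vc.
  apply: f1_0; last by rewrite vE lead_nseq; lia.
    by move: presK; rewrite !size_cat size_rcons size_nseq vp.
  by move: presq; rewrite -cats1 !count_cat pre_c vc /=; lia.
exists (fun u => g u + extend pre y u) => s sK sq sp.
rewrite salvettiD; apply/eqP; rewrite addrC -subr_eq; apply/eqP.
rewrite -/(f1 s).
(* Longer first parts, already cleared, are not disturbed: the boundary at [s] only looks at bitseqs
   above [s], whose initial run is at least as long. *)
have [sp'|sp'] := ltnP p (lead s).
  rewrite f1_0 //; symmetry; apply: salvetti_eq0_above => u us su.
  have pu := leq_trans sp' (lead_above su).
  rewrite (leadP pu) extend_neq ?size_nseq //.
  by move=> /(congr1 (count id)); rewrite count_nseq -cats1 count_cat pre_c /=;
    lia.
have sE : lead s = p by lia.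
have sl : (lead s < size s)%N by rewrite sE sK /p; lia.
have := lead_ltP (ltnSn _) sl; rewrite sE -/pre; set s' := drop _ _ => es.
rewrite es.
have -> := salvetti_extend t pre y s'; rewrite size_nseq -shift -yP //.
  by move: sK; rewrite es size_cat size_rcons size_nseq; lia.
by move: sq; rewrite es -cats1 !count_cat pre_c /=; lia.
Qed.

End KillHead.

Section KillPrefix.
Variables (N : zmodType) (t : nat -> {additive N -> N}) (K q : nat).
Hypothesis tK : forall k f s, (k + size s = K)%N ->
  salvetti t k 0 (salvetti t k 0 f) s = 0.

Lemma salvetti_shift k F s :
  salvetti (fun i => t (k + i)) 0 0 F s = salvetti t k 0 F s.
Proof. by apply: (salvetti_natural (phi := idfun)) => j x _; rewrite add0n. Qed.

(** Once [f] vanishes unless its first [k] bits are [false], its restriction to the remaining bits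
    is a cycle, to which [kill_head] applies. *)
Lemma kill_prefix k f : (k + q <= K)%N ->
  (forall l p, (l < k)%N -> (0 < p <= q)%N ->
     salvetti_exact (fun i => t (l + p.+1 + i)) (K - l - p.+1) (q - p)) ->
  (forall s, size s = K -> (count id s).+1 = q -> salvetti t 0 0 f s = 0) ->
  exists g, forall s, size s = K -> count id s = q ->
    take k s <> nseq k false ->
    f s = salvetti t 0 0 g s.
Proof.
move=> kq ex df; elim: k kq ex => [|k IH] kq ex.
  by exists (fun=> 0) => s _ _; rewrite take0.
have [|l p lk|g gP] := IH; first by lia.
  by apply: ex; lia.
pose f1 u := f u - salvetti t 0 0 g u.
have f1_0 s : size s = K -> count id s = q -> take k s <> nseq k false ->
  f1 s = 0.
  by move=> sK sq sp; rewrite /f1 gP // subrr.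
pose z u := f1 (nseq k false ++ u).
have [f0 s sK|||s sK sq|y yP] :=
  @kill_head N (fun i => t (k + i)) (K - k) q _ _ _ z.
- transitivity (salvetti t k 0 (salvetti t k 0 f0) s); last by apply: tK; lia.
  by rewrite salvetti_shift; apply: eq_salvetti => u; exact: salvetti_shift.
- by lia.
- move=> p pq; have -> : (fun i => t (k + (p.+1 + i))%N) =
  (fun i => t (k + p.+1 + i)%N).
    by apply: funext => i; rewrite addnA.
  exact: ex.
- have sizeK : size (nseq k false ++ s) = K by rewrite size_cat size_nseq sK;
  lia.
  rewrite salvetti_shift -[z]/(fun u => f1 (nseq k false ++ u))
    -salvetti_prefix_false.
    by rewrite salvettiB df ?count_cat ?count_nseq // tK // subr0.
  move=> v vk vne vc; apply: f1_0; last by rewrite take_size_cat.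
    by move: sizeK; rewrite !size_cat size_nseq vk.
  by rewrite count_cat vc add1n.
pose y' s := if take k s == nseq k false then y (drop k s) else 0.
exists (fun u => g u + y' u) => s sK sq sk.
rewrite salvettiD; apply/eqP; rewrite addrC -subr_eq -/(f1 s); apply/eqP.
have [e|/eqP ne] := eqVneq (take k s) (nseq k false); last first.
  rewrite f1_0 //; symmetry; apply: salvetti_eq0_above => u us su.
  by rewrite /y' ifF //; apply: contra_notF ne => /eqP/(take_above su).
have sE : s = nseq k false ++ drop k s by rewrite -e cat_take_drop.
rewrite [in RHS]sE salvetti_prefix_false => [|v vk /eqP/negPf vne vc];
  last first.
  by rewrite /y' take_size_cat // vne.
rewrite {1}sE -/(z _) yP.
- rewrite salvetti_shift; apply: eq_salvetti => u.
  by rewrite /y' take_size_cat ?size_nseq // eqxx drop_size_cat ?size_nseq.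
- by rewrite size_drop sK.
- by move: sq; rewrite {1}sE count_cat count_nseq.
have : (k < size s)%N by rewrite sK; lia.
case ed : (drop k s) => [|b r] ks.
  by have := congr1 size ed; rewrite size_drop /=; lia.
case: b ed => // ed; case: sk; rewrite sE ed.
by elim: (k) => [|k' /= ->]; rewrite //= take0.
Qed.

End KillPrefix.

(** * Products of chains on adjacent blocks of strands *)

Section Product.
Variables (N1 N2 N : zmodType) (B : N1 -> N2 -> N).
Hypothesis Bl : forall y, zmod_morphism (B^~ y).
Hypothesis Br : forall x, zmod_morphism (B x).
Variables (t1 : nat -> {additive N1 -> N1}) (t2 : nat -> {additive N2 -> N2}).
Variable t : nat -> {additive N -> N}.

(** The Leibniz rule: [F] is the product of [Y] and [g], and vanishes on bitseqs merging the two
    blocks. *)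
Lemma salvetti_product o a F Y g v s :
  (forall j x y, (j < a + size v)%N ->
    B (t1 (o + j) x) y = t (o + j) (B x y)) ->
  (forall j x y, B x (t2 j y) = t (o + a + (size v).+1 + j) (B x y)) ->
  (forall w u, size w = size v -> F (w ++ false :: u) = B (Y w) (g u)) ->
  (forall w u, size w = size v -> F (w ++ true :: u) = 0) ->
  salvetti t o a F (v ++ false :: s) =
  B (salvetti t1 o a Y v) (g s)
  + flip (odd (count id v)) (B (Y v) (salvetti t2 0 0 g s)).
Proof.
pose Bly y : {additive N1 -> N} :=
  HB.pack (B^~ y) (GRing.isZmodMorphism.Build _ _ (B^~ y) (Bl y)).
pose Brx x : {additive N2 -> N} :=
  HB.pack (B x) (GRing.isZmodMorphism.Build _ _ (B x) (Br x)).
have B0 y : B 0 y = 0 by exact: (raddf0 (Bly y)).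
have BN x y : B (- x) y = - B x y by exact: (raddfN (Bly y)).
have BD x x' y : B (x + x') y = B x y + B x' y by exact: (raddfD (Bly y)).
elim: v o a F Y => [|[] v IH] o a F Y Ht1 Ht2 HF HF0 /=.
- rewrite (HF0 [::]) // raddf0 add0r B0 add0r.
  rewrite (eq_salvetti _ _ _ _ (g := fun u => Brx (Y [::]) (g u))); last first.
    by move=> u; apply: (HF [::]).
  apply/esym/(salvetti_natural (phi := Brx (Y [::]))) => j x _.
  by rewrite /= Ht2 /=; congr (t _ _); lia.
- rewrite (IH _ _ _ (fun w => Y (true :: w))); first last.
  + by move=> w u wv; apply: (HF0 (true :: w)); rewrite /= wv.
  + by move=> w u wv; apply: (HF (true :: w)); rewrite /= wv.
  + by move=> j x y; rewrite Ht2 /=; congr (t _ _); lia.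
  + by move=> j x y jv; apply: Ht1; move: jv => /=; lia.
  by rewrite BN opprD -flip_negb.
- rewrite (IH _ _ _ (fun w => Y (false :: w))); first last.
  + by move=> w u wv; apply: (HF0 (false :: w)); rewrite /= wv.
  + by move=> w u wv; apply: (HF (false :: w)); rewrite /= wv.
  + by move=> j x y; rewrite Ht2 /= addn0; congr (t _ _); lia.
  + by move=> j x y jv; rewrite -!addnA; apply: Ht1; move: jv => /=; lia.
  rewrite BD addrA; congr (_ + _ + _).
  have -> : lead (v ++ false :: s) = lead v by elim: (v) => [|[] r IHr] //=;
    rewrite IHr.
  rewrite (HF (true :: v)) //; apply/esym/(shuffle_natural (phi := Bly (g s))).
  by move=> j x jv; apply: Ht1; have := lead_size v; move: jv => /=; lia.
Qed.

End Product.

Section PowerCat.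
Variables (K : fieldType) (V : lmodType K).
Variable T : {linear tensor V V -> tensor V V}.

Definition scale_at (W : lmodType K) (y : W) (a : K^o) : W := (a : K) *: y.

Lemma scale_at_is_linear (W : lmodType K) (y : W) : linear (scale_at y).
Proof. by move=> a x x'; rewrite /scale_at scalerDl scalerA. Qed.

HB.instance Definition _ (W : lmodType K) (y : W) :=
  GRing.isLinear.Build K K^o W _ (scale_at y) (scale_at_is_linear y).

Fixpoint power_cat m (y : tensor_power V m) k :
    {linear tensor_power V k -> tensor_power V (k + m)} :=
  match k with
  | 0 => scale_at y
  | k'.+1 => tensor_idl V (power_cat y k')
  end.

Lemma power_catB m k u : zmod_morphism (fun y :
  tensor_power V m => power_cat y k u).
Proof.
move=> y y'; elim: k u => [|k IH] u; first exact: scalerBr.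
apply: (@tensor_eq _ _ _ _ (power_cat (y - y') k.+1)
          (power_cat y k.+1 \- power_cat y' k.+1)) => v w /=.
by rewrite !tensor_idlE IH; exact: (linearB (pure_tensorl v)).
Qed.

Lemma power_cat_braidr m k i (y : tensor_power V m) u :
  power_cat (braid_at T m i y) k u =
    braid_at T (k + m) (k + i) (power_cat y k u).
Proof.
elim: k u => [|k IH] u.
  by rewrite -[RHS]/(braid_at T m i ((u : K) *: y)) linearZ.
apply: (@tensor_eq _ _ _ _ (power_cat (braid_at T m i y) k.+1)
  (tensor_idl V (braid_at T (k + m) (k + i)) \o power_cat y k.+1)) => v w /=.
by rewrite !tensor_idlE IH.
Qed.

Lemma power_cat_braidl m k i (y : tensor_power V m) u : (i.+1 < k)%N ->
  power_cat y k (braid_at T k i u) = braid_at T (k + m) i (power_cat y k u).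
Proof.
elim: k i u => [//|k IH] [|i] u ik.
  by case: k IH u ik => [//|k] _ u _; exact/esym/braid_left_natural.
apply: (@tensor_eq _ _ _ _ (power_cat y k.+1 \o tensor_idl V (braid_at T k i))
  (tensor_idl V (braid_at T (k + m) i) \o power_cat y k.+1)) => v w /=.
by rewrite !tensor_idlE IH.
Qed.

(** [tensor_salvetti_cycle], applied to one factor [V] at a time. *)
Lemma power_cat_decompose m k (l q : nat) (z : bitseq ->
  tensor_power V (k + m)) :
  (forall s, size s = l -> (count id s).+1 = q ->
     salvetti (neg_op (fun i => braid_at T (k + m) (k + i))) 0 0 z s = 0) ->
  exists bs : seq (tensor_power V k * (bitseq -> tensor_power V m)),
    (forall p, List.In p bs -> forall s, size s = l -> (count id s).+1 = q ->
       salvetti (neg_op (braid_at T m)) 0 0 p.2 s = 0) /\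
    (forall s, size s = l -> z s = \sum_(p <- bs) power_cat (p.2 s) k p.1).
Proof.
elim: k z => [|k IH] z dz.
  exists [:: (1, z)]; split=> [p [<-|//] //|s sl].
  by rewrite big_seq1 /= /scale_at scale1r.
have [es [es0 zE]] := tensor_salvetti_cycle dz.
suff [bs [bs0 bsE]] : exists bs : seq (tensor_power V k.+1 * (bitseq ->
  tensor_power V m)),
    (forall p, List.In p bs -> forall s, size s = l -> (count id s).+1 = q ->
       salvetti (neg_op (braid_at T m)) 0 0 p.2 s = 0) /\
    (forall s, size s = l -> \sum_(p <- es) p.1 ⊗ p.2 s =
       \sum_(p <- bs) power_cat (p.2 s) k.+1 p.1).
  by exists bs; split=> // s sl; rewrite zE // bsE.
elim: es es0 {zE} => [|[v f] es IHes] es0.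
  by exists [::]; split=> // s _; rewrite !big_nil.
have [|bs [bs0 bsE]] := IHes; first by move=> p pes; apply: es0; right.
have [bs' [bs'0 fE]] := IH f (es0 (v, f) (or_introl erefl)).
exists ([seq (v ⊗ p.1, p.2) | p <- bs'] ++ bs); split.
  move=> p /(List.in_app_or _ _ _)[/List.in_map_iff[p' [<- /bs'0//]]|/bs0//].
move=> s sl; rewrite big_cons big_cat bsE //= big_map fE //; congr (_ + _).
rewrite -[LHS]/(pure_tensorl v _) linear_sum; apply: eq_bigr => p _ /=.
by rewrite tensor_idlE.
Qed.

End PowerCat.

Lemma eq_salvetti_exact (N : zmodType) (t t' : nat -> {additive N -> N}) K q :
  (forall i x, (i < K)%N -> t i x = t' i x) ->
  salvetti_exact t K q -> salvetti_exact t' K q.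
Proof.
move=> tt' ex f df.
have E F s : size s = K -> salvetti t 0 0 F s = salvetti t' 0 0 F s.
  move=> sK; apply: (salvetti_natural (phi := idfun)) => j x.
  by rewrite !add0n sK => /tt'; apply.
have [s sK sq|g gP] := ex f; first by rewrite E // df.
by exists g => s sK sq; rewrite gP // E.
Qed.

Section BraidedPowers.
Variables (K : fieldType) (V : braidedVectorSpace K).
Local Notation T := (@braiding K V).
Local Notation op n := (neg_op (braid_at T n)).

Lemma power_op_far n i j x : (i.+1 < j)%N ->
  op n j (op n i x) = op n i (op n j x).
Proof. by move=> ij; rewrite /neg_op !linearN braid_at_far. Qed.

Lemma power_op_braid n i x : (i.+1 < n.-1)%N ->
  op n i (op n i.+1 (op n i x)) = op n i.+1 (op n i (op n i.+1 x)).
Proof.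
have E j k l : op n j (op n k (op n l x)) =
    - braid_at T n j (braid_at T n k (braid_at T n l x)).
  by rewrite /neg_op (linearN (braid_at T n k)) opprK.
by move=> iK; rewrite !E (braid_at_braid (@braid_equation K V)) //; lia.
Qed.

Lemma power_op_salvettiK n k f s : (k + size s <= n.-1)%N ->
  salvetti (op n) k 0 (salvetti (op n) k 0 f) s = 0.
Proof.
move=> sK; apply: (@salvettiK _ (op n) n.-1 (@power_op_far n) (@power_op_braid
  n) k 0 f s).
by rewrite addn0.
Qed.

Lemma braid_op_module n i (x : tensor_power V n) : (i < n.-1)%N ->
  @braid_op n (braid_module V n) i x = op n i x.
Proof.
move=> iK; rewrite /braid_op /neg_op -[i]/(val (Ordinal iK)) sgenE.
by congr (- _); exact: braid_module_sigma.
Qed.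

Lemma shifted_salvetti_exact m k q :
  salvetti_exact (op m) m.-1 q ->
  salvetti_exact (fun i => op (k + m) (k + i)) m.-1 q.
Proof.
move=> ex; suff : salvetti_exact (neg_op (fun i => braid_at T (k + m) (k + i)))
  m.-1 q.
  by apply: eq_salvetti_exact.
elim: k => [|k IH]; first by apply: eq_salvetti_exact ex.
exact: tensor_salvetti_exact IH.
Qed.

(* The product of a boundary [u] of degree [0] with a cycle [g] is a boundary: it is
   bounded by the product of [Y] with [g]. *)
Lemma null_product d m q (u : tensor_power V d.+1)
    (Y : bitseq -> tensor_power V d.+1) (g : bitseq -> tensor_power V m) :
  u = salvetti (op d.+1) 0 0 Y (nseq d false) ->
  (forall s, size s = m.-1 -> (count id s).+1 = q ->
    salvetti (op m) 0 0 g s = 0) ->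
  (0 < m)%N ->
  exists h, forall s, size s = (d + m)%N -> count id s = q ->
    salvetti (op (d.+1 + m)) 0 0 h s =
    if take d.+1 s == nseq d.+1 false
    then power_cat (g (drop d.+1 s)) d.+1 u else 0.
Proof.
move=> uY dg m0.
(* Truncated to degree 1, so that both Leibniz terms vanish when the first block has degree at least
   2. *)
pose Y' w := if count id w == 1 then Y w else 0.
pose B x (y : tensor_power V m) := power_cat y d.+1 x.
have B0l y : B 0 y = 0 by exact: (linear0 (power_cat y d.+1)).
have B0r x : B x 0 = 0.
  by have := @power_catB _ _ m d.+1 x 0 0; rewrite !subrr.
(* The first [d] bits are the generators of the first block, bit [d] is the cut between the two
   blocks. *)
pose F s := if nth false s d then 0 else B (Y' (take d s)) (g (drop d.+1 s)).
exists F => s sK sq.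
have [sd|sd] := boolP (nth false s d).
  rewrite ifF; last first.
    apply/eqP => /(congr1 (nth false ^~ d)).
    by rewrite nth_take // sd nth_nseq ltnSn.
  apply: salvetti_eq0_above => v vs sv; rewrite /F ifT //.
  elim: (d) (s) (v) sd sv {sq vs sK} => [|d' IH] [|b r] [|b' r'] //=.
    by move=> -> /andP[].
  by move=> rd /andP[_]; apply: IH.
pose w := take d s; pose s' := drop d.+1 s.
have ds : (d < size s)%N by rewrite sK; lia.
have wd : size w = d by rewrite size_takel // ltnW.
have es : s = w ++ false :: s'.
  by rewrite -{1}(cat_take_drop d s) (drop_nth false ds) (negPf sd).
have s'm : size s' = m.-1 by rewrite size_drop sK; lia.
have -> : salvetti (op (d.+1 + m)) 0 0 F s =
    B (salvetti (op d.+1) 0 0 Y' w) (g s')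
    + flip (odd (count id w)) (B (Y' w) (salvetti (op m) 0 0 g s')).
  rewrite {1}es; apply: (salvetti_product (B := B)).
  - by move=> y; exact: raddfB.
  - by move=> x; exact: power_catB.
  - move=> j x y; rewrite add0n wd add0n => jd.
    by rewrite /B /neg_op linearN power_cat_braidl.
  - move=> j x y; rewrite wd.
    rewrite -[RHS]/(- braid_at T (d.+1 + m) (d.+1 + j) (power_cat y d.+1 x)).
    rewrite -power_cat_braidr; have :=
      @power_catB _ _ m d.+1 x 0 (braid_at T m j y).
    by rewrite !sub0r -/(B x 0) B0r sub0r.
  - move=> v r vw; rewrite wd in vw; rewrite /F nth_cat vw ltnn subnn /=.
    by rewrite take_size_cat // -cat_rcons drop_size_cat // size_rcons vw.
  - move=> v r vw; rewrite wd in vw.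
    by rewrite /F nth_cat vw ltnn subnn.
have cs : count id s = (count id w + count id s')%N by
  rewrite es count_cat /= add0n.
have take_s : take d.+1 s = rcons w false.
  by rewrite (take_nth false) // (negPf sd).
have nE : nseq d.+1 false = rcons (nseq d false) false.
  by elim: d {u Y uY Y' B B0l B0r F sK sd w ds wd es cs take_s s' s'm} => //= k
    {1}->.
rewrite take_s nE eqseq_rcons eqxx andbT.
have [ew|/eqP nw] := eqVneq w (nseq d false).
  have Y'0 : Y' (nseq d false) = 0 by rewrite /Y' count_nseq.
  rewrite ew Y'0 B0l flip0 addr0 {1}uY; congr (B _ _).
  by apply: eq_in_salvetti => v _; rewrite /Y' count_nseq mul0n => ->.
have w1 : (0 < count id w)%N.
  rewrite -has_count; apply/negPn/negP => /hasPn wF; apply: nw.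
  rewrite -wd; apply/all_pred1P/allP => b /wF /=; by case: b.
have -> : salvetti (op d.+1) 0 0 Y' w = 0.
  rewrite -(salvetti0 (op d.+1) 0 0 w); apply: eq_in_salvetti => v _ vc.
  by rewrite /Y' vc ifF //; lia.
rewrite B0l add0r /Y'; case: ifP => [/eqP w_1|_]; last by rewrite B0l flip0.
by rewrite dg ?B0r ?flip0 // -sq cs w_1.
Qed.


Variable d : nat.
Hypothesis coinv : forall n, (d < n)%N -> forall x : tensor_power V n,
  exists g, x = salvetti (op n) 0 0 g (nseq n.-1 false).

Lemma braided_salvetti_exact i n : ((d + 2) * i + d < n)%N ->
  salvetti_exact (op n) n.-1 i.
Proof.
have [l] := ubnP i; elim: l i n => // l IH i n il lt_n f df.
have [i0|i0] := posnP i.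
  have [|g gP] := coinv (n := n) _ (f (nseq n.-1 false)); first by lia.
  by exists g => s sK; rewrite i0 => /count0_nseq ->; rewrite sK.
pose m := (n - d.+1)%N.
have nE : n = (d.+1 + m)%N by rewrite /m; nia.
have m0 : (0 < m)%N by rewrite /m; nia.
have lin : (d.+1 + i <= n.-1)%N by nia.
have tK k g s : (k + size s)%N = n.-1 ->
  salvetti (op n) k 0 (salvetti (op n) k 0 g) s = 0.
  by move=> sK; apply: power_op_salvettiK; rewrite sK.
have ex k p : (k < d.+1)%N -> (0 < p <= i)%N ->
    salvetti_exact (fun j => op n (k + p.+1 + j)) (n.-1 - k - p.+1) (i - p).
  move=> kd pi; pose n' := (n - (k + p.+1))%N.
  have En : n = (k + p.+1 + n')%N by rewrite /n'; nia.
  have -> : (n.-1 - k - p.+1 = n'.-1)%N by rewrite /n'; lia.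
  rewrite En; apply: shifted_salvetti_exact; apply: IH; first by lia.
  (* For [k = d] and [p = 1] the bound required of [n'] in degree [i - 1] is equivalent to
     [lt_n]. *)
  by rewrite /n'; nia.
have [g gP] := kill_prefix tK lin ex df.
pose f1 u := f u - salvetti (op n) 0 0 g u.
have f1_0 s : size s = n.-1 -> count id s = i ->
    take d.+1 s <> nseq d.+1 false -> f1 s = 0.
  by move=> sK sq sp; rewrite /f1 gP // subrr.
have df1 s : size s = n.-1 -> (count id s).+1 = i ->
  salvetti (op n) 0 0 f1 s = 0.
  by move=> sK sq; rewrite salvettiB df // power_op_salvettiK ?sK // subr0.
suff [h hP] : exists h, forall s, size s = n.-1 -> count id s = i ->
    f1 s = salvetti (op n) 0 0 h s.
  exists (fun u => g u + h u) => s sK sq.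
  by rewrite salvettiD -hP // addrC subrK.
have nd : n.-1 = (d + m)%N by rewrite nE.
(* From here on [n] is literally [d.+1 + m], the exponent in which [power_cat] takes its values. *)
clearbody f1; clear f df g gP lt_n lin tK ex; clearbody m; subst n.
rewrite {}nd in f1_0 df1 *.
pose z u := f1 (nseq d.+1 false ++ u).
have dz s : size s = m.-1 -> (count id s).+1 = i ->
    salvetti (neg_op (fun j => braid_at T (d.+1 + m) (d.+1 + j))) 0 0 z s = 0.
  move=> sm sq.
  have sizeE : size (nseq d.+1 false ++ s) = (d + m)%N.
    by rewrite size_cat size_nseq sm; lia.
  have -> : salvetti (neg_op (fun j => braid_at T (d.+1 + m) (d.+1 + j))) 0 0 z
    s =
      salvetti (op (d.+1 + m)) d.+1 0 z s.
    by apply: (salvetti_natural (phi := idfun)) => j x _.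
  rewrite -salvetti_prefix_false; last first.
    move=> v vk vne vc; apply: f1_0; last by rewrite take_size_cat.
      by move: sizeE; rewrite !size_cat size_nseq vk.
    by rewrite count_cat vc add1n.
  by rewrite df1 // count_cat count_nseq mul0n.
have [bs [bs0 zE]] := power_cat_decompose dz.
have [h hP] : exists h, forall s, size s = (d + m)%N -> count id s = i ->
    salvetti (op (d.+1 + m)) 0 0 h s =
    if take d.+1 s == nseq d.+1 false
    then \sum_(p <- bs) power_cat (p.2 (drop d.+1 s)) d.+1 p.1 else 0.
  elim: bs bs0 {zE} => [|[u g] bs IHbs] bs0.
    by exists (fun=> 0) => s _ _; rewrite big_nil salvetti0; case: ifP.
  have [|h hP] := IHbs; first by move=> p pbs; apply: bs0; right.
  have [Y uY] := coinv (ltnSn d) u.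
  have [h' h'P] := null_product uY (bs0 (u, g) (or_introl erefl)) m0.
  exists (fun s => h' s + h s) => s sK sq.
  by rewrite salvettiD h'P // hP // big_cons; case: ifP => _ //=; rewrite addr0.
exists h => s sK sq; rewrite hP //.
have [e|/eqP ne] := eqVneq (take d.+1 s) (nseq d.+1 false); last exact: f1_0.
rewrite -zE; last by rewrite size_drop sK; lia.
by rewrite /z -e cat_take_drop.
Qed.

End BraidedPowers.

Theorem theorem1p1p1 (K : fieldType) (V : braidedVectorSpace K) (d : nat)
    (H0_vanishes : forall n : nat, (d < n)%N ->
      forall x : group_homology (braid_module V n) 0, x = 0%R) :
  forall i n : nat, ((d + 2) * i + d < n)%N ->
    forall x : group_homology (braid_module V n) i, x = 0%R.
Proof.
move=> i n lt_n; apply/group_homology_eq0.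
apply: (@salvetti_bar_exact n i (braid_module V n)).
(* The operators of the module and of the tensor power are matched on the indices below [n.-1], the
   only ones the complex uses. *)
apply: eq_salvetti_exact (braided_salvetti_exact _ lt_n) => [j x jn|m dm x].
  exact: esym (braid_op_module _ jn).
have /group_homology0_eq0/(_ x)/coinvariant_salvetti[g gE] := H0_vanishes m dm.
exists g; rewrite gE.
apply: (salvetti_natural (phi := idfun)) => j y.
by rewrite !add0n size_nseq => jm; exact: braid_op_module.
Qed.
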